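(* Let $P^n$ be a simple polytope with $m$ facets, let $K$ be the simplicial complex dual to $\partial P^n$, let $\lambda$ be a characteristic function for $P^n$, and let $J=(j_1,\ldots,j_m)$ be a sequence of positive integers. Then there is a diffeomorphism $$M(J)\longrightarrow Z(K;(\underline{D}^{2J},\underline{S}^{2J-1}))\big/\ker\lambda(J).$$
   Context: A simple polytope $P^n$ is an $n$-dimensional polytope in which exactly $n$ facets meet at each vertex. A simplicial complex $K$ is dual to $\partial P^n$ if its vertices $v_1,\ldots,v_m$ correspond to the facets $F_1,\ldots,F_m$ of $P^n$ and a set of vertices is a simplex exactly when the corresponding facets have nonempty common intersection. A characteristic function is a map $\lambda$ from facets of $P^n$ to $\mathbb{Z}^n$ such that whenever $F=F_{i_1}\cap\cdots\cap F_{i_l}$ is a codimension-$l$ face, $\lambda(F_{i_1}),\ldots,\lambda(F_{i_l})$ span a rank-$l$ direct summand of $\mathbb{Z}^n$. It is regarded as an $n\times m$ integer matrix $(\lambda_{ki})$ with columns $\lambda(F_i)$. The toric manifold of $(P^n,\lambda)$ is the smooth closed manifold $M^{2n}=T^n\times P^n/\!\sim$, where $(g,p)\sim(h,q)$ iff $p=q$ and $g^{-1}h\in G_{F(p)}$; here $F(p)=F_{i_1}\cap\cdots\cap F_{i_l}$ is the face with $p$ in its relative interior and $G_{F(p)}\subset T^n$ is the $l$-dimensional subtorus whose Lie algebra is spanned by $\lambda(F_{i_1}),\ldots,\lambda(F_{i_l})$. Put $d(J)=j_1+\cdots+j_m$. $K(J)$ is the simplicial complex on vertices $v_{it}$ ($1\le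 i\le m$, $1\le t\le j_i$) whose minimal non-faces (non-simplices all of whose proper subsets are simplices) are exactly the sets $\{v_{i_11},\ldots,v_{i_1j_{i_1}},\ldots,v_{i_k1},\ldots,v_{i_kj_{i_k}}\}$ with $\{v_{i_1},\ldots,v_{i_k}\}$ a minimal non-face of $K$. It is dual to the boundary of a simple polytope $P(J)$ of dimension $d(J)-m+n$ with $d(J)$ facets. $\lambda(J)$ is the $(d(J)-m+n)\times d(J)$ integer matrix, columns indexed by the $v_{it}$, with rows: for each $i$ and each $t=2,\ldots,j_i$, a row with $1$ in column $v_{it}$, $-1$ in column $v_{i1}$ and $0$ elsewhere; and for each $k=1,\ldots,n$ a row with $\lambda_{ki}$ in column $v_{i1}$ ($i=1,\ldots,m$) and $0$ elsewhere. $M(J)$ is the toric manifold of $(P(J),\lambda(J))$. Polyhedral products: $Z(K;(\underline X,\underline A))=\bigcup_{\sigma\in K}D(\sigma)\subseteq\prod_iX_i$ with $D(\sigma)=\prod_iW_i$, $W_i=X_i$ if $v_i\in\sigma$ and $W_i=A_i$ otherwise; $(\underline{D}^{2J},\underline{S}^{2J-1})=\{(D^{2j_i},S^{2j_i-1})\}_{i=1}^m$. Actions: $T^m$ acts on $(D^2)^{d(J)}=\prod_i(D^2)^{j_i}$ by letting $t_i$ multiply all coordinates of the $i$-th block $\underline z_{j_i}\in(D^2)^{j_i}\subset\mathbb{C}^{j_i}$; this restricts to $Z(K(J);(D^2,S^1))$. With standard (radial) homeomorphisms of pairs $h_i:((D^2)^{j_i},\partial((D^2)^{j_i}))\to(D^{2j_i},S^{2j_i-1})$,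 $T^m$ acts on $\prod_iD^{2j_i}$ by $(t_i)_i\cdot(h_i(\underline z_{j_i}))_i=(h_i(t_i\underline z_{j_i}))_i$, which restricts to $Z(K;(\underline{D}^{2J},\underline{S}^{2J-1}))$. The map $\prod_ih_i$ restricts to a $T^m$-equivariant homeomorphism $Z(K(J);(D^2,S^1))\to Z(K;(\underline{D}^{2J},\underline{S}^{2J-1}))$. The matrix $\lambda$ induces a homomorphism $T^m\to T^n$ with kernel $\ker\lambda\cong T^{m-n}$, and $\lambda(J)$ induces $T^{d(J)}\to T^{d(J)-m+n}$, whose kernel $\ker\lambda(J)$ is the image of $\ker\lambda$ under the block-diagonal inclusion $T^m\subset T^{d(J)}$ (repeating $t_i$ $j_i$ times). Thus $\ker\lambda(J)\cong\ker\lambda\subset T^m$ acts on both spaces, freely. The quotient $Z(K(J);(D^2,S^1))/\ker\lambda(J)$ carries the smooth structure of the standard theory of toric manifolds (as a quotient of the moment-angle manifold of $P(J)$), and $Z(K;(\underline{D}^{2J},\underline{S}^{2J-1}))/\ker\lambda(J)$ is given the smooth structure transported from it along the homeomorphism of orbit spaces induced by the equivariant homeomorphism above. *)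

(* Defs.v *)
From HB Require Import structures.
From mathcomp Require Import all_boot all_order all_algebra.
From mathcomp Require Import all_classical all_reals all_analysis.
From mathcomp Require Import complex.

Set Implicit Arguments.
Unset Strict Implicit.
Unset Printing Implicit Defensive.

Import Order.TTheory GRing.Theory Num.Theory.
Import numFieldNormedType.Exports.
Local Open Scope classical_set_scope.
Local Open Scope ring_scope.
Local Open Scope quotient_scope.

(* The topology of the modulus on R[i] is that of the alias R[i]^o. *)
Notation modulus := ComplexField.Normc.normc.
Definition Cspace (R : realType) (I : Type) : topologicalType :=
  prod_topology (fun _ : I => R[i]^o).

Definition cis {R : realType} (x : R) : R[i]^o := (cos x +i* sin x)%C.

Definition smooth_on {R : realType} {V W : normedModType R}
    (O : set V) (f : V -> W) : Prop :=
  forall s : seq V, let g := foldr (fun v h => 'D_v h) f s in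
  forall x, O x -> {for x, continuous g} /\ forall v, derivable g x v.

Definition chart (R : realType) (X : Type) (d : nat) : Type :=
  (set X * (X -> 'rV[R]_d))%type.

(* A homeomorphism from an open set onto an open subset of R^d. *)
Definition is_chart {R : realType} {X : topologicalType} {d : nat}
    (c : chart R X d) : Prop :=
  [/\ open c.1,
      {in c.1 &, injective c.2},
      (forall x, c.1 x -> {for x, continuous c.2}) &
      forall V, open V -> V `<=` c.1 -> open (c.2 @` V)].

(* g is c'.2 \o f \o c.2^-1, determined on c.2 @` (c.1 `&` f @^-1` c'.1). *)
Definition smooth_map {R : realType} {X Y : Type} {d e : nat}
    (A : set (chart R X d)) (B : set (chart R Y e)) (f : X -> Y) : Prop :=
  forall c c', A c -> B c' ->
  exists2 g : 'rV[R]_d -> 'rV[R]_e,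
    smooth_on (c.2 @` (c.1 `&` f @^-1` c'.1)) g &
    forall x, c.1 x -> c'.1 (f x) -> g (c.2 x) = c'.2 (f x).

Definition smooth_atlas {R : realType} {X : topologicalType} {d : nat}
    (A : set (chart R X d)) : Prop :=
  [/\ forall c, A c -> is_chart c,
      forall x, exists2 c, A c & c.1 x &
      smooth_map A A id].

Definition diffeomorphism {R : realType} {X Y : topologicalType} {d e : nat}
    (A : set (chart R X d)) (B : set (chart R Y e)) (f : X -> Y) : Prop :=
  [/\ smooth_atlas A, smooth_atlas B &
      exists g : Y -> X,
        [/\ cancel f g, cancel g f, continuous f & continuous g] /\
        (smooth_map A B f /\ smooth_map B A g)].

(* The half-spaces normal i . x + offset i >= 0 of R^n. *)
Record halfspaces (R : realType) (n : nat) (I : finType) := Halfspaces {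
  normal : I -> 'rV[R]_n;
  offset : I -> R }.

Section Polytope.
Context {R : realType} {n : nat} {I : finType} (P : halfspaces R n I).

Definition ell (i : I) (x : 'rV[R]_n) : R :=
  \sum_k normal P i 0 k * x 0 k + offset P i.

Definition polytope : set 'rV[R]_n := [set x | forall i, 0 <= ell i x].

Definition face (s : {set I}) : set 'rV[R]_n :=
  [set x | polytope x /\ forall i, i \in s -> ell i x = 0].

Definition facets_at (x : 'rV[R]_n) : {set I} := [set i | ell i x == 0]%SET.

Definition affinely_independent (d : nat) (x : 'I_d.+1 -> 'rV[R]_n) : bool :=
  row_free (\matrix_(k < d) (x (lift ord0 k) - x ord0)).

Definition has_dim (A : set 'rV[R]_n) (d : nat) : Prop :=
  (exists2 x : 'I_d.+1 -> 'rV[R]_n,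
     forall k, A (x k) & affinely_independent x) /\
  (forall x : 'I_d.+2 -> 'rV[R]_n,
     (forall k, A (x k)) -> ~~ affinely_independent x).

Definition vertex (x : 'rV[R]_n) : Prop :=
  polytope x /\
  forall y z (t : R), polytope y -> polytope z -> 0 < t < 1 ->
    x = t *: y + (1 - t) *: z -> y = x /\ z = x.

(* An n-dimensional polytope whose facets are the pairwise distinct sets
   face [set i], exactly n of them meeting at each vertex. *)
Definition simple_polytope : Prop :=
  [/\ bounded_set polytope,
      has_dim polytope n,
      (forall i, exists2 d, d.+1 = n & has_dim (face [set i]%SET) d),
      injective (fun i => face [set i]%SET) &
      forall x, vertex x -> #|facets_at x| = n].

Definition dual_complex (K : {set {set I}}) : Prop :=
  forall s : {set I}, s \in K <-> face s !=set0.

End Polytope.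

Section Characteristic.
Context {n m : nat} (lambda : 'M[int]_(n, m)).

Definition column_span (s : {set 'I_m}) : set 'cV[int]_n :=
  [set u | exists c : 'I_m -> int, u = \sum_(i in s) c i *: col i lambda].

Definition columns_independent (s : {set 'I_m}) : Prop :=
  forall c : 'I_m -> int, \sum_(i in s) c i *: col i lambda = 0 ->
  forall i, i \in s -> c i = 0.

End Characteristic.

Definition direct_summand {n : nat} (L : set 'cV[int]_n) : Prop :=
  exists N : set 'cV[int]_n,
    [/\ N 0, (forall u v, N u -> N v -> N (u - v)),
        L `&` N `<=` [set 0] &
        forall v, exists u w, [/\ L u, N w & v = u + w]].

(* The quantified condition says that face P s has codimension #|s|. *)
Definition characteristic {R : realType} {n m : nat}
    (P : halfspaces R n 'I_m) (lambda : 'M[int]_(n, m)) : Prop :=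
  forall s : {set 'I_m},
    (exists2 d, (d + #|s|)%N = n & has_dim (face P s) d) ->
    columns_independent lambda s /\ direct_summand (column_span lambda s).

Section Tori.
Context {R : realType} {D I : finType} (lambda : D -> I -> int).

Definition torus {A : Type} (t : A -> R[i]^o) : Prop := forall a, modulus (t a) = 1.

(* The exponential image of the real span of the columns indexed by s. *)
Definition subtorus (s : {set I}) (t : D -> R[i]^o) : Prop :=
  exists theta : I -> R,
    forall d, t d = cis (\sum_(i in s) theta i * (lambda d i)%:~R).

(* The kernel of the homomorphism T^I -> T^D induced by lambda. *)
Definition ker_torus (t : I -> R[i]^o) : Prop :=
  torus t /\ forall d, \prod_i t i ^ lambda d i = 1.

Lemma modulus_neq0 (z : R[i]^o) : modulus z = 1 -> z != 0.
Proof.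
by apply: contra_eqN => /eqP ->; rewrite ComplexField.Normc.normc0 eq_sym oner_eq0.
Qed.

Lemma cisD (x y : R) : cis (x + y) = cis x * cis y.
Proof.
by rewrite /cis cosD sinD /GRing.mul /= [X in (_ +i* X)%C]addrC.
Qed.

Lemma cis0 : cis (0 : R) = 1.
Proof. by rewrite /cis cos0 sin0. Qed.

Lemma cisN (x : R) : cis (- x) = (cis x)^-1.
Proof.
have h : cis (- x) * cis x = 1 by rewrite -cisD addNr cis0.
have u : cis x != 0.
  by apply/eqP => e; move: h; rewrite e mulr0 => /eqP; rewrite eq_sym oner_eq0.
by apply: (mulIf u); rewrite h mulVf.
Qed.

Lemma subtorus1 s : subtorus s (fun=> 1).
Proof.
by exists (fun=> 0) => d; rewrite big1 ?cis0// => i _; rewrite mul0r.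
Qed.

Lemma subtorusV s t : subtorus s t -> subtorus s (fun d => (t d)^-1).
Proof.
move=> [th h]; exists (fun i => - th i) => d; rewrite h -cisN; congr cis.
by rewrite -sumrN; apply: eq_bigr => i _; rewrite mulNr.
Qed.

Lemma subtorusM s t u :
  subtorus s t -> subtorus s u -> subtorus s (fun d => t d * u d).
Proof.
move=> [th h] [th' h']; exists (fun i => th i + th' i) => d.
rewrite h h' -cisD -big_split /=; congr cis.
by apply: eq_bigr => i _; rewrite mulrDl.
Qed.

Lemma ker_torus1 : ker_torus (fun=> 1).
Proof.
split=> [i|d]; first exact: ComplexField.Normc.normc1.
by rewrite big1 // => i _; rewrite exp1rz.
Qed.

Lemma ker_torusV t : ker_torus t -> ker_torus (fun i => (t i)^-1).
Proof.
move=> [h k]; split=> [i|d]; first by rewrite ComplexField.Normc.normcV h invr1.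
transitivity ((\prod_i t i ^ lambda d i)^-1); last by rewrite k invr1.
by rewrite -prodfV; apply: eq_bigr => i _; rewrite exprz_inv -invr_expz.
Qed.

Lemma ker_torusM t u :
  ker_torus t -> ker_torus u -> ker_torus (fun i => t i * u i).
Proof.
move=> [h k] [h' k']; split=> [i|d].
  by rewrite ComplexField.Normc.normcM h h' mulr1.
transitivity ((\prod_i t i ^ lambda d i) * (\prod_i u i ^ lambda d i)).
  by rewrite -big_split /=; apply: eq_bigr => i _; rewrite expfzMl.
by rewrite k k' mulr1.
Qed.

End Tori.

Section Toric.
Context {R : realType} {n : nat} {D I : finType}.
Variables (P : halfspaces R n I) (lambda : D -> I -> int).

Definition torus_polytope : set (Cspace R D * 'rV[R]_n)%type :=
  [set a | torus a.1 /\ polytope P a.2].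

Definition toric_sim (a b : set_type torus_polytope) : bool :=
  `[< (val a).2 = (val b).2 /\
      subtorus lambda (facets_at P (val a).2)
        (fun d => ((val a).1 d)^-1 * (val b).1 d) >].

Lemma toric_sim_refl : reflexive toric_sim.
Proof.
move=> a; apply/asboolP; split=> //.
have [/= ta _] := set_valP a.
rewrite (_ : (fun d => _) = (fun=> 1)); first exact: subtorus1.
by apply/funext => d; rewrite mulVf //; exact/modulus_neq0/ta.
Qed.

Lemma toric_sim_sym : symmetric toric_sim.
Proof.
suff h a b : toric_sim a b -> toric_sim b a by move=> a b; apply/idP/idP; exact: h.
move=> /asboolP[e s]; apply/asboolP; split=> //; rewrite -e.
move: (subtorusV s); congr (subtorus _ _ _); apply/funext => d.
by rewrite invfM invrK mulrC.
Qed.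

Lemma toric_sim_trans : transitive toric_sim.
Proof.
move=> b a c /asboolP[e s] /asboolP[e' s']; apply/asboolP; split; first by rewrite e.
rewrite -e in s'; move: (subtorusM s s'); congr (subtorus _ _ _).
have [/= tb _] := set_valP b.
by apply/funext => d; rewrite -mulrA mulVKf //; exact/modulus_neq0/tb.
Qed.

Definition toric_equiv : equiv_rel (set_type torus_polytope) :=
  EquivRel toric_sim toric_sim_refl toric_sim_sym toric_sim_trans.

Definition toric : topologicalType := quotient_topology {eq_quot toric_equiv}.

Definition toric_class : set_type torus_polytope -> toric :=
  \pi_({eq_quot toric_equiv}).

(* One chart for each vertex x and each ordering e of the facets through it,
   on the part of the manifold over the faces containing x.  The columns
   lambda (e k) form a basis of Z^n, so every t in T^n is
   (prod_k s_k ^ lambda_(d, e k))_d for a unique s = (cis (theta k))_k, and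
   the chart sends [t, p] to (sqrt (ell (e k) p) * s_k)_k in C^n = R^n * R^n.
   The square root makes the orbit map smooth: |z_k|^2 = ell (e k) p. *)
Definition toric_atlas : set (chart R toric (n + n)) :=
  [set c | exists x (e : 'I_n -> I),
    [/\ vertex P x,
        injective e,
        facets_at P x = [set e k | k : 'I_n]%SET,
        (forall a, c.1 (toric_class a) <->
                   facets_at P (val a).2 \subset facets_at P x) &
        forall (theta : 'I_n -> R) a,
          c.1 (toric_class a) ->
          (forall d, (val a).1 d =
             cis (\sum_k theta k * (lambda d (e k))%:~R)) ->
          c.2 (toric_class a) =
            row_mx
              (\row_k (Num.sqrt (ell P (e k) (val a).2) * cos (theta k)))
              (\row_k (Num.sqrt (ell P (e k) (val a).2) * sin (theta k)))]].

End Toric.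
Arguments toric_class {R n D I} P lambda _.
Arguments toric_atlas {R n D I} P lambda _.

Definition polyhedral_product {I : finType} {T : I -> Type}
    (K : {set {set I}}) (X A : forall i, set (T i)) : set (forall i, T i) :=
  [set x | exists2 s, s \in K & forall i, (if i \in s then X i else A i) (x i)].

Definition disk {R : realType} : set R[i]^o := [set z | modulus z <= 1].
Definition circle {R : realType} : set R[i]^o := [set z | modulus z = 1].

Definition l2norm {R : realType} {j : nat} (y : 'I_j -> R[i]^o) : R :=
  Num.sqrt (\sum_t modulus (y t) ^+ 2).
Definition maxnorm {R : realType} {j : nat} (y : 'I_j -> R[i]^o) : R :=
  \big[Num.max/0]_t modulus (y t).

Definition ball2 {R : realType} (j : nat) : set (Cspace R 'I_j) :=
  [set y | l2norm y <= 1].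
Definition sphere2 {R : realType} (j : nat) : set (Cspace R 'I_j) :=
  [set y | l2norm y = 1].
Arguments ball2 {R} j _.
Arguments sphere2 {R} j _.

(* The radial homeomorphism ((D^2)^j, boundary) -> (D^(2j), S^(2j-1)). *)
Definition radial {R : realType} {j : nat} (z : 'I_j -> R[i]^o) : 'I_j -> R[i]^o :=
  fun t => (maxnorm z / l2norm z)%:C%C * z t.

Lemma radial_equivariant {R : realType} {j : nat} (u : R[i]^o) (z : 'I_j -> R[i]^o) :
  modulus u = 1 -> radial (fun t => u * z t) = (fun t => u * radial z t).
Proof.
move=> u1; apply/funext => t; rewrite /radial mulrCA.
have h t' : modulus (u * z t') = modulus (z t').
  by rewrite ComplexField.Normc.normcM u1 mul1r.
congr (_ * (_ %:C%C * _)); congr (_ / _); first exact: eq_bigr.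
by congr Num.sqrt; apply: eq_bigr => t' _; rewrite h.
Qed.

Section Wedge.
Context {m : nat} (J : 'I_m -> nat).
(* The vertices v_(i t), with t counted from 0. *)
Local Notation VJ := {i : 'I_m & 'I_(J i)}.

Definition blocks (s : {set 'I_m}) : {set VJ} := [set v | tag v \in s]%SET.

Definition minimal_nonface {I : finType} (K : {set {set I}}) (s : {set I}) : bool :=
  (s \notin K) && [forall r : {set I}, (r \proper s) ==> (r \in K)].

Definition KJ (K : {set {set 'I_m}}) : {set {set VJ}} :=
  [set s : {set VJ} |
    [forall r : {set 'I_m}, minimal_nonface K r ==> ~~ (blocks r \subset s)]]%SET.

Lemma minimal_nonface_KJ (K : {set {set 'I_m}}) (s : {set VJ}) :
  (forall i, (0 < J i)%N) ->
  minimal_nonface (KJ K) s <-> exists2 r, minimal_nonface K r & s = blocks r.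
Proof.
move=> J0.
have subE r r' : (blocks r \subset blocks r') = (r \subset r').
  apply/idP/idP => /fintype.subsetP h; apply/fintype.subsetP => i.
    by move=> ir; have := h (Tagged (fun i => 'I_(J i)) (Ordinal (J0 i)));
       rewrite !inE /= => /(_ ir).
  by rewrite !inE => /h.
have notKJ r (s' : {set VJ}) : minimal_nonface K r -> blocks r \subset s' -> s' \notin KJ K.
  by move=> mr rs; rewrite inE; apply/forallPn; exists r; rewrite mr rs.
split=> [/andP[]|[r mr ->]].
  rewrite inE => /forallPn[r]; rewrite negb_imply negbK => /andP[mr rs].
  move=> /forallP smin; exists r => //; apply/eqP; rewrite eq_sym eqEproper rs /=.
  apply/negP => prs; have := smin (blocks r); rewrite prs /=.
  by apply/negP; apply: (notKJ r).
apply/andP; split; first exact: (notKJ r).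
apply/forallP => q; apply/implyP => qr; rewrite inE; apply/forallP => r'.
apply/implyP => mr'; apply/negP => r'q.
have : blocks r' \proper blocks r by exact: sub_proper_trans qr.
rewrite properE !subE -properE => r'r.
have /andP[_ /forallP/(_ r')] := mr; rewrite r'r /= => r'K.
by case/andP: mr'; rewrite r'K.
Qed.

(* Rows of lambda(J): the row inl (i; t) belongs to the vertex numbered t + 1
   (from 0) of the i-th block, and inr k to the k-th row of lambda. *)
Definition lambdaJ {n : nat} (lambda : 'M[int]_(n, m))
    (d : {i : 'I_m & 'I_(J i).-1} + 'I_n) (v : VJ) : int :=
  match d with
  | inl r => if tag v != tag r then 0
             else if tagged v == (tagged r).+1 :> nat then 1
             else if tagged v == 0 :> nat then -1 else 0
  | inr k => if tagged v == 0 :> nat then lambda k (tag v) else 0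
  end.

(* The block-diagonal inclusion T^m -> T^d(J). *)
Definition block_diag {R : realType} (t : 'I_m -> R[i]^o) : VJ -> R[i]^o :=
  fun v => t (tag v).

Definition radials {R : realType} (z : VJ -> R[i]^o) :
    forall i : 'I_m, 'I_(J i) -> R[i]^o :=
  fun i => radial (fun t => z (Tagged (fun i => 'I_(J i)) t)).

End Wedge.

Section MomentAngle.
Context {R : realType} {n : nat} {D I : finType}.
Variables (P : halfspaces R n I) (lambda : D -> I -> int).

(* The intersection of quadrics in C^I obtained by pulling back the orbit map
   z |-> (|z_i|^2)_i along the affine embedding (ell i)_i of the polytope. *)
Definition moment_angle : set (Cspace R I) :=
  [set z | exists2 p, polytope P p & forall i, modulus (z i) ^+ 2 = ell P i p].

Definition ma_sim (z w : set_type moment_angle) : bool :=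
  `[< exists2 t, ker_torus lambda t & val w = (fun i => t i * val z i) >].

Lemma ma_sim_refl : reflexive ma_sim.
Proof.
move=> z; apply/asboolP; exists (fun=> 1); first exact: ker_torus1.
by apply/funext => i; rewrite mul1r.
Qed.

Lemma ma_sim_sym : symmetric ma_sim.
Proof.
suff h a b : ma_sim a b -> ma_sim b a by move=> a b; apply/idP/idP; exact: h.
move=> /asboolP[t kt e]; apply/asboolP; exists (fun i => (t i)^-1).
  exact: ker_torusV.
by rewrite e; apply/funext => i; rewrite mulKf //; exact/modulus_neq0/(kt.1 i).
Qed.

Lemma ma_sim_trans : transitive ma_sim.
Proof.
move=> b a c /asboolP[t kt e] /asboolP[u ku e']; apply/asboolP.
exists (fun i => u i * t i); first exact: ker_torusM.
by rewrite e' e; apply/funext => i; rewrite mulrA.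
Qed.

Definition ma_equiv : equiv_rel (set_type moment_angle) :=
  EquivRel ma_sim ma_sim_refl ma_sim_sym ma_sim_trans.

Definition ma_quotient : topologicalType := quotient_topology {eq_quot ma_equiv}.

Definition ma_class : set_type moment_angle -> ma_quotient :=
  \pi_({eq_quot ma_equiv}).

Definition coords (z : I -> R[i]^o) : 'rV[R]_(#|I| + #|I|) :=
  row_mx (\row_k complex.Re (z (enum_val k))) (\row_k complex.Im (z (enum_val k))).

(* The smooth structure for which the projection from the submanifold
   moment_angle of C^I is a submersion.  Its charts are those along which the
   projection is smooth (locally the restriction of a smooth map on C^I) and
   has smooth local sections through every point. *)
Definition ma_quotient_atlas : set (chart R ma_quotient (n + n)) :=
  [set c | [/\ is_chart c,
    (forall z, c.1 (ma_class z) ->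
       exists (O : set 'rV[R]_(#|I| + #|I|)) (g : _ -> 'rV[R]_(n + n)),
         [/\ open O, O (coords (val z)), smooth_on O g &
             forall w, O (coords (val w)) -> c.1 (ma_class w) ->
               c.2 (ma_class w) = g (coords (val w))]) &
    (forall z, c.1 (ma_class z) ->
       exists (O : set 'rV[R]_(n + n)) (s : _ -> set_type moment_angle),
         [/\ open O, O (c.2 (ma_class z)),
             smooth_on O (fun u => coords (val (s u))),
             s (c.2 (ma_class z)) = z &
             forall u, O u ->
               c.1 (ma_class (s u)) /\ c.2 (ma_class (s u)) = u])]].

(* The standard homeomorphism from Z(K; (D^2, S^1)) onto moment_angle.  On
   orbit spaces it is the inverse of the cubical subdivision of the polytope:
   vert s is the common point of the facets in a maximal simplex s, bary s is
   the barycentre of the vertices of face P s, and cubical is the map, linear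
   on the simplices of the barycentric subdivision, which sends the point with
   y_i = 0 for i in s and y_i = 1 otherwise to bary s.  The points [set i | y_i < u],
   0 < u <= 1, form a chain of simplices and cubical y is the integral over u of
   their barycentres: weight y s is the length of the interval of those u with
   [set i | y_i < u] = s. *)
Variable K : {set {set I}}.

Definition vert (s : {set I}) : 'rV[R]_n := xget 0 (face P s).

Definition bary (s : {set I}) : 'rV[R]_n :=
  let V := [set r in K | (s \subset r) && (#|r| == n)]%SET in
  (#|V|%:R)^-1 *: \sum_(r in V) vert r.

Definition weight (y : I -> R) (s : {set I}) : R :=
  Num.max 0 (\big[Num.min/1]_(i | i \notin s) y i - \big[Num.max/0]_(i in s) y i).

Definition cubical (y : I -> R) : 'rV[R]_n := \sum_(s in K) weight y s *: bary s.

Definition to_moment_angle (z : I -> R[i]^o) : I -> R[i]^o :=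
  fun i => (Num.sqrt (ell P i (cubical (fun k => modulus (z k)))))%:C%C
           * (z i / (modulus (z i))%:C%C).

End MomentAngle.

Arguments ma_class {R n D I} P lambda _.
Arguments ma_quotient_atlas {R n D I} P lambda _.

Section Target.
Context {R : realType} {n m : nat}.
Variables (K : {set {set 'I_m}}) (lambda : 'M[int]_(n, m)) (J : 'I_m -> nat).

Definition ZDS : set (prod_topology (fun i : 'I_m => Cspace R 'I_(J i))) :=
  polyhedral_product K (fun i => ball2 (J i)) (fun i => sphere2 (J i)).

(* By radial_equivariant, T^m acts on the i-th factor by multiplication. *)
Definition ZDS_sim (x y : set_type ZDS) : bool :=
  `[< exists t : 'I_m -> R[i]^o,
        ker_torus (lambdaJ lambda) (block_diag (J := J) t) /\
        torus t /\
        forall i s, val y i s = t i * val x i s >].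

Lemma ZDS_sim_refl : reflexive ZDS_sim.
Proof.
move=> x; apply/asboolP; exists (fun=> 1); split; first exact: ker_torus1.
split=> [i|i s]; first exact: ComplexField.Normc.normc1.
by rewrite mul1r.
Qed.

Lemma ZDS_sim_sym : symmetric ZDS_sim.
Proof.
suff h a b : ZDS_sim a b -> ZDS_sim b a by move=> a b; apply/idP/idP; exact: h.
move=> /asboolP[t [kt [tt e]]]; apply/asboolP; exists (fun i => (t i)^-1).
split; first exact: ker_torusV kt.
split=> [i|i s]; first by rewrite ComplexField.Normc.normcV tt invr1.
by rewrite e mulKf //; exact/modulus_neq0/tt.
Qed.

Lemma ZDS_sim_trans : transitive ZDS_sim.
Proof.
move=> b a c /asboolP[t [kt [tt e]]] /asboolP[u [ku [tu e']]]; apply/asboolP.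
exists (fun i => u i * t i); split; first exact: ker_torusM ku kt.
split=> [i|i s]; first by rewrite ComplexField.Normc.normcM tt tu mulr1.
by rewrite e' e mulrA.
Qed.

Definition ZDS_equiv : equiv_rel (set_type ZDS) :=
  EquivRel ZDS_sim ZDS_sim_refl ZDS_sim_sym ZDS_sim_trans.

Definition ZDS_quotient : topologicalType := quotient_topology {eq_quot ZDS_equiv}.

Definition ZDS_class : set_type ZDS -> ZDS_quotient := \pi_({eq_quot ZDS_equiv}).

(* Charts of the quotient of the moment-angle manifold of PJ, transported to
   Z(K(J); (D^2, S^1)) / ker lambda(J) along to_moment_angle, then to
   ZDS_quotient along radials. *)
Definition ZDS_atlas {N : nat} (PJ : halfspaces R N {i : 'I_m & 'I_(J i)}) :
    set (chart R ZDS_quotient (N + N)) :=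
  [set c | exists2 c', ma_quotient_atlas PJ (lambdaJ lambda) c' &
    forall z x w,
      polyhedral_product (KJ J K) (fun=> disk) (fun=> circle) z ->
      val x = radials z ->
      val w = to_moment_angle PJ (KJ J K) z ->
      (c.1 (ZDS_class x) <-> c'.1 (ma_class PJ (lambdaJ lambda) w)) /\
      (c.1 (ZDS_class x) ->
       c.2 (ZDS_class x) = c'.2 (ma_class PJ (lambdaJ lambda) w))].

End Target.
Arguments ZDS_quotient R {n m} K lambda J.
Arguments ZDS_class {R n m} K lambda J _.
Arguments ZDS_atlas {R n m} K lambda {J N} PJ _.

(* Main.v *)
(* Both sides are compared with the quotient of the moment-angle manifold of
   P(J), whose charts at a vertex have explicit smooth local sections.

   Homeomorphisms.  T^d(J) x P(J) maps onto M(J), by lambda(J), and onto the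
   moment-angle manifold, by z_i = sqrt (ell_i p) s_i, and the two induced
   relations agree.  Likewise Z(K(J); (D^2, S^1)) maps onto
   Z(K; (D^2J, S^(2J-1))), by radials, and onto the moment-angle manifold.  A
   continuous surjection from a compact space onto a Hausdorff space is a
   quotient map, so each pair of orbit spaces is a pair of quotients of one
   compact space by the same relation.  That the second map is bijective is the
   cubical subdivision of P(J): a point of the polytope is, in exactly one way, a
   convex combination of the barycentres of a chain of faces.

   Smooth structures.  lambda(J) is unimodular at every vertex, since a maximal
   simplex of K(J) contains the full blocks of a maximal simplex of K and misses
   exactly one vertex of every other block.  Hence the charts of M(J) and of
   Z(K; (D^2J, S^(2J-1))) / ker lambda(J) are pulled back from charts of the
   moment-angle quotient, and two such charts differ by a local section of the
   projection followed by a smooth map.  Smoothness being stated with iterated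
   directional derivatives, the chain rule goes through the fact that C^1 maps
   are differentiable. *)

From HB Require Import structures.
Require Import Defs.
From mathcomp Require Import all_boot all_order all_algebra.
From mathcomp Require Import all_classical all_reals all_analysis.
From mathcomp Require Import complex ring zify.

Set Implicit Arguments.
Unset Strict Implicit.
Unset Printing Implicit Defensive.

Import Order.TTheory GRing.Theory Num.Theory.
Import numFieldNormedType.Exports.
Local Open Scope classical_set_scope.
Local Open Scope ring_scope.
Local Open Scope quotient_scope.

(** * Smooth maps *)

Section Smooth.
Context {R : realType}.
Implicit Types V W : normedModType R.

(** Neither [radial] nor [to_moment_angle] is smooth in general, so no smoothness can be read off
    the comparison maps. All analysis is confined to the moment-angle quotient, whose charts are
    tested against the linear coordinates of the surrounding complex space. The charts at a vertex
    come from a slice: a kernel element can rotate the coordinates away from the facets of the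
    vertex to positive reals, and unimodularity leaves it no further freedom. Squared moduli, unlike
    moduli, are affine on the polytope, which keeps the slice smooth where coordinates vanish. The
    cubical map is handled without triangulations. A point is encoded by nonnegative weights on a
    chain of sets, and vectors vanishing exactly on their indexing set determine these weights; the
    same statement serves the cube and the polytope. The polytope being given by inequalities only,
    its vertices are produced by moving a point until it meets new facets. *)

Fixpoint Ck {V W} (k : nat) (O : set V) (f : V -> W) : Prop :=
  (forall x, O x -> {for x, continuous f}) /\
  if k is k'.+1 then
    (forall x v, O x -> derivable f x v) /\ forall v, Ck k' O ('D_v f)
  else True.

Lemma Ck_continuous V W k (O : set V) (f : V -> W) x :
  Ck k O f -> O x -> {for x, continuous f}.
Proof. by case: k => [|k] [h _]; exact: h. Qed.

Lemma CkS V W k (O : set V) (f : V -> W) : Ck k.+1 O f -> Ck k O f.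
Proof.
elim: k f => [|k IH] f; first by move=> [].
by move=> [h [d D]]; split=> //; split=> // v; exact: IH (D v).
Qed.

(** [smooth_on] lists the outermost direction first, whereas [Ck] takes the innermost derivative
    first; so the list is cut at its last entry, and induction on the order becomes available. *)
Lemma smooth_onP V W (O : set V) (f : V -> W) :
  smooth_on O f <-> forall k, Ck k O f.
Proof.
split=> [h k|h s].
  have {}h s : forall x, O x -> {for x, continuous (foldr (fun v h => 'D_v h) f s)} /\
      forall v, derivable (foldr (fun v h => 'D_v h) f s) x v by exact: h.
  elim: k f h => [|k IH] f h; first by split=> // x /(h [::])[].
  split; first by move=> x /(h [::])[].
  split; first by move=> x v /(h [::])[_]; exact.
  by move=> v; apply: IH => s; have := h (rcons s v); rewrite foldr_rcons.
move=> g x Ox; rewrite {}/g.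
elim/last_ind: s f h => [|s v IH] f h.
  split; first exact: Ck_continuous (h 0%N) Ox.
  by case: (h 1%N) => _ [d _] v; exact: d.
rewrite foldr_rcons; apply: IH => k.
by case: (h k.+1) => _ [_ D]; exact: D.
Qed.

Lemma Ck_sub V W k (O O' : set V) (f : V -> W) :
  O' `<=` O -> Ck k O f -> Ck k O' f.
Proof.
move=> s; elim: k f => [|k IH] f [c d]; first by split=> // x /s; exact: c.
split=> [x /s|]; first exact: c.
case: d => d D; split=> [x v O'x|v]; last exact: IH (D v).
by apply: d; exact: s.
Qed.

Lemma near_eq_continuous (S T : topologicalType) (O : set S) (f g : S -> T) x :
  open O -> O x -> (forall y, O y -> f y = g y) ->
  {for x, continuous f} -> {for x, continuous g}.
Proof.
move=> oO Ox fg c; suff : g @ x --> g x by [].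
rewrite -fg //; apply: cvg_trans c; apply: near_eq_cvg.
by apply: filterS (open_nbhs_nbhs (conj oO Ox)) => y /fg.
Qed.

Lemma Ck_ext V W k (O : set V) (f g : V -> W) : open O ->
  (forall x, O x -> f x = g x) -> Ck k O f -> Ck k O g.
Proof.
move=> oO; elim: k f g => [|k IH] f g fg [c d].
  by split=> // x Ox; apply: near_eq_continuous fg (c _ Ox).
have nfg x : O x -> {near x, f =1 g}.
  by move=> Ox; apply: filterS (open_nbhs_nbhs (conj oO Ox)) => y /fg.
split; first by move=> x Ox; apply: near_eq_continuous fg (c _ Ox).
case: d => d D; split=> [x v Ox|v].
  by apply: near_eq_derivable (d _ _ Ox); exact: nfg.
apply: (IH ('D_v f)); last exact: D.
by move=> x Ox; apply: near_eq_derive; exact: nfg.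
Qed.

(** Each clause of [Ck] concerns single points, the derivatives being those of the total map [f], so
    the sets [O'] may vary with the point. *)
Lemma Ck_local V W k (O : set V) (f : V -> W) :
  (forall x, O x -> exists2 O', O' x & Ck k O' f) -> Ck k O f.
Proof.
elim: k f => [|k IH] f h.
  by split=> // x /h [U Ux] /Ck_continuous; apply.
split=> [x /h [U Ux] C|]; first exact: Ck_continuous C Ux.
split=> [x v /h [U Ux] [_ [d _]]|v]; first exact: d.
by apply: IH => x /h [U Ux] [_ [_ D]]; exists U => //; exact: D.
Qed.

Lemma smooth_sub V W (O O' : set V) (f : V -> W) :
  O' `<=` O -> smooth_on O f -> smooth_on O' f.
Proof. by move=> s /smooth_onP h; apply/smooth_onP => k; exact: Ck_sub s _. Qed.

Lemma smooth_ext V W (O : set V) (f g : V -> W) : open O ->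
  (forall x, O x -> f x = g x) -> smooth_on O f -> smooth_on O g.
Proof. by move=> o fg /smooth_onP h; apply/smooth_onP => k; exact: Ck_ext fg _. Qed.

Lemma smooth_local V W (O : set V) (f : V -> W) :
  (forall x, O x -> exists2 O', O' x & smooth_on O' f) -> smooth_on O f.
Proof.
move=> h; apply/smooth_onP => k; apply: Ck_local => x /h [U Ux].
by move=> /smooth_onP; exists U.
Qed.

Lemma smooth_continuous V W (O : set V) (f : V -> W) x :
  smooth_on O f -> O x -> {for x, continuous f}.
Proof. by move=> /smooth_onP/(_ 0%N); exact: Ck_continuous. Qed.

Lemma Ck_cst V W k (O : set V) (w : W) : Ck k O (cst w).
Proof.
elim: k w => [|k IH] w; first by split=> // x _; exact: cvg_cst.
split; first by move=> x _; exact: cvg_cst.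
split; first by move=> x v _; exact: derivable_cst.
move=> v; rewrite (_ : 'D_v _ = cst 0) //.
by apply/funext => x; rewrite derive_cst.
Qed.

Lemma CkD V W k (O : set V) (f g : V -> W) : open O ->
  Ck k O f -> Ck k O g -> Ck k O (f \+ g).
Proof.
move=> oO; elim: k f g => [|k IH] f g [cf df] [cg dg].
  by split=> // x Ox; apply: continuousD; [exact: cf|exact: cg].
split=> [x Ox|]; first by apply: continuousD; [exact: cf|exact: cg].
case: df => df Df; case: dg => dg Dg.
split=> [x v Ox|v]; first by apply: derivableD; [exact: df|exact: dg].
apply: (Ck_ext oO _ (IH _ _ (Df v) (Dg v))) => x Ox /=.
by rewrite deriveD //; [exact: df|exact: dg].
Qed.

Lemma CkM V k (O : set V) (f g : V -> R) : open O ->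
  Ck k O f -> Ck k O g -> Ck k O (f \* g).
Proof.
move=> oO; elim: k f g => [|k IH] f g hf hg.
  case: hf hg => [cf _] [cg _].
  by split=> // x Ox; apply: cvgM; [exact: cf|exact: cg].
have [cf [df Df]] := hf; have [cg [dg Dg]] := hg.
split=> [x Ox|]; first by apply: cvgM; [exact: cf|exact: cg].
split=> [x v Ox|v]; first by apply: derivableM; [exact: df|exact: dg].
apply: (Ck_ext oO _ (CkD oO (IH _ _ (CkS hf) (Dg v)) (IH _ _ (CkS hg) (Df v)))).
by move=> x Ox /=; rewrite (deriveM (df _ _ Ox) (dg _ _ Ox)).
Qed.

(** The derivative [- f^-2 * 'D_v f] is built from [f^-1] at one order less. *)
Lemma CkV V k (O : set V) (f : V -> R) : open O -> (forall x, O x -> f x != 0) ->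
  Ck k O f -> Ck k O (fun x => (f x)^-1).
Proof.
move=> oO n0; elim: k => [|k IH] hf.
  by case: hf => cf _; split=> // x Ox; apply: cvgV; [exact: n0|exact: cf].
have [cf [df Df]] := hf.
split=> [x Ox|]; first by apply: cvgV; [exact: n0|exact: cf].
split=> [x v Ox|v]; first by apply: derivableV; [exact: n0|exact: df].
have i := IH (CkS hf).
have ii := CkM oO i i.
have j := CkM oO ii (Df v).
have := CkM oO (@Ck_cst V R k O (-1)) j.
apply: Ck_ext => // x Ox /=.
rewrite (deriveV (n0 _ Ox) (df _ _ Ox)) /cst mulN1r scaleNr.
by congr (- (_ * _)); rewrite -invrM ?unitfE ?n0 // expr2.
Qed.

End Smooth.

(** * Chain rule along a line, square roots and matrix-valued maps *)

Section SmoothMore.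
Context {R : realType}.
Implicit Types V W : normedModType R.

Lemma derive_line V W (f : V -> W) x v :
  'D_v f x = 'D_1 (fun h : R => f (h *: v + x)) 0.
Proof.
rewrite /derive; set g1 := fun h => h^-1 *: _; set g2 := fun h => h^-1 *: _.
suff -> : g1 = g2 by [].
by rewrite funeqE /g1 /g2 => h /=; rewrite addr0 scale0r add0r [_%:A]mulr1.
Qed.

(** [f] is only known to be derivable in the direction [v]. Restricted to the line through [x] it is
    a map of one real variable, for which derivability is differentiability, so differentials
    compose. *)
Lemma derive_chain (V V' W : normedModType R) (f : V -> V') (g : V' -> W) x v :
  derivable f x v -> differentiable g (f x) ->
  derivable (g \o f) x v /\ 'D_v (g \o f) x = 'd g (f x) ('D_v f x).
Proof.
move=> df dg.
pose c := fun h : R => f (h *: v + x).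
have c0 : c 0 = f x by rewrite /c scale0r add0r.
have dc : differentiable c 0.
  apply/derivable1_diffP.
  exact: ((derivable1P f x v).1 df).
have dgc : differentiable g (c 0) by rewrite c0.
have dgoc : differentiable (g \o c) 0 by exact: differentiable_comp.
split; first by apply/derivable1P; exact/derivable1_diffP.
rewrite derive_line [in RHS]derive_line -c0.
by rewrite (deriveE _ dgoc) (deriveE _ dc) diff_comp.
Qed.

Lemma derive_sqrt_comp V (f : V -> R) x v : 0 < f x -> derivable f x v ->
  derivable (fun y => Num.sqrt (f y)) x v /\
  'D_v (fun y => Num.sqrt (f y)) x = 'D_v f x * (2 * Num.sqrt (f x))^-1.
Proof.
move=> fx df.
have dr : derivable (@Num.sqrt R) (f x) 1 by have [] := is_derive1_sqrt fx.
have ds : differentiable (@Num.sqrt R) (f x) by exact/derivable1_diffP.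
have [d e] := derive_chain df ds; split => //.
rewrite [LHS]e -(derive_sqrt fx) (deriveE _ ds).
by rewrite -[in LHS](mulr1 ('D_v f x)) -[X in 'd _ _ X = _]/(_ *: _) linearZ.
Qed.

(** The derivative contains the square root again, at one order less; hence the induction on [k]. *)
Lemma Ck_sqrt V k (O : set V) (f : V -> R) : open O -> (forall x, O x -> 0 < f x) ->
  Ck k O f -> Ck k O (fun x => Num.sqrt (f x)).
Proof.
move=> oO p; elim: k => [|k IH] hf.
  case: hf => cf _; split=> // x Ox.
  by apply: continuous_comp; [exact: cf|exact: sqrt_continuous].
have [cf [df Df]] := hf.
split=> [x Ox|].
  by apply: continuous_comp; [exact: cf|exact: sqrt_continuous].
split=> [x v Ox|v]; first by case: (derive_sqrt_comp (p _ Ox) (df x v Ox)).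
have i := IH (CkS hf).
have i2 : Ck k O (fun x => (2 * Num.sqrt (f x))^-1).
  apply: CkV => //; first by move=> x Ox; rewrite mulf_neq0 // gt_eqF ?sqrtr_gt0 ?p.
  by have := CkM oO (@Ck_cst R V R k O 2) i.
have := CkM oO (Df v) i2.
by apply: Ck_ext => // x Ox /=; case: (derive_sqrt_comp (p _ Ox) (df x v Ox)).
Qed.

Lemma Ck_sum V W (I : Type) (r : seq I) k (O : set V) (f : I -> V -> W) : open O ->
  (forall i, Ck k O (f i)) -> Ck k O (fun x => \sum_(i <- r) f i x).
Proof.
move=> oO h; elim: r => [|i r IH].
  by have := @Ck_cst R V W k O 0; apply: Ck_ext => // x _; rewrite big_nil.
by have := CkD oO (h i) IH; apply: Ck_ext => // x _; rewrite big_cons.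
Qed.

Lemma continuous_mx (T : topologicalType) m n (f : T -> 'M[R]_(m, n)) x :
  (forall i j, {for x, continuous (fun y => f y i j)}) -> {for x, continuous f}.
Proof.
move=> h; apply/cvgrPdist_le => /= e e0; near=> y.
rewrite /Num.Def.normr/= mx_normrE (bigmax_le _ (ltW e0))//= => i _.
rewrite !mxE/=; move: i; near: y; apply: filter_forall => /= i.
exact: ((cvgrPdist_le _ _).1 (h i.1 i.2)).
Unshelve. all: by end_near. Qed.

Lemma continuous_mx_coord (T : topologicalType) m n (f : T -> 'M[R]_(m, n)) x i j :
  {for x, continuous f} -> {for x, continuous (fun y => f y i j)}.
Proof.
move=> c; apply: (@continuous_comp _ _ _ f (fun M : 'M[R]_(m, n) => M i j)) => //.
exact: coord_continuous.
Qed.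

Lemma Ck_mx m n V k (O : set V) (f : V -> 'M[R]_(m, n)) : open O ->
  Ck k O f <-> forall i j, Ck k O (fun x => f x i j).
Proof.
move=> oO; elim: k f => [|k IH] f.
  split=> [[cf _] i j|h].
    by split=> // x Ox; exact: continuous_mx_coord (cf _ Ox).
  by split=> // x Ox; apply: continuous_mx => i j; case: (h i j) => c _; exact: c.
split=> [[cf [df Df]] i j|h].
  split; first by move=> x Ox; exact: continuous_mx_coord (cf _ Ox).
  split; first by move=> x v Ox; exact: ((derivable_mxP _ _ _).1 (df _ _ Ox)).
  move=> v; have /(IH _)/(_ i j) := Df v.
  by apply: Ck_ext => // x Ox; rewrite derive_mx ?mxE //; exact: df.
have df x v : O x -> derivable f x v.
  by move=> Ox; apply/derivable_mxP => i j; case: (h i j) => _ [d _]; exact: d.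
split.
  by move=> x Ox; apply: continuous_mx => i j; case: (h i j) => c _; exact: c.
split=> // v; apply/IH => i j; case: (h i j) => _ [_ D].
have := D v; apply: Ck_ext => // x Ox.
by rewrite derive_mx ?mxE //; exact: df.
Qed.

End SmoothMore.

(** * Composition of smooth maps *)

Section SmoothComp.
Context {R : realType}.
Implicit Types V W : normedModType R.

(** Either sign of [t] is allowed because coordinate increments have no fixed sign; the bound on [c]
    is in absolute value for the same reason. *)
Lemma mvt_signed (f df : R -> R) (t : R) :
  (forall s : R, `|s| <= `|t| -> is_derive s (1 : R) f (df s)) ->
  exists2 c, `|c| <= `|t| & f t - f 0 = t * df c.
Proof.
move=> h.
have cf s : `|s| <= `|t| -> {for s, continuous f}.
  by move=> /h [d _]; apply/differentiable_continuous/derivable1_diffP.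
have [t0|t0] := leP 0 t.
- have inE s : s \in `[0, t] -> `|s| <= `|t|.
    by rewrite in_itv /= => /andP[s0 st]; rewrite !ger0_norm.
  have [s st||c ct e] := @MVT_segment R f df 0 t t0.
  + by apply: h; apply: inE; rewrite in_itv /= !ltW ?(itvP st).
  + by apply: continuous_in_subspaceT => s /set_mem /inE /cf.
  by exists c; [exact: inE|rewrite e subr0 mulrC].
- have inE s : s \in `[t, 0] -> `|s| <= `|t|.
    rewrite in_itv /= => /andP[ts s0].
    by rewrite !ler0_norm // ?lerN2 // ltW.
  have [s st||c ct e] := @MVT_segment R f df t 0 (ltW t0).
  + by apply: h; apply: inE; rewrite in_itv /= !ltW ?(itvP st).
  + by apply: continuous_in_subspaceT => s /set_mem /inE /cf.
  exists c; first exact: inE.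
  by rewrite -opprB e sub0r mulrN opprK mulrC.
Qed.

Lemma derive_on_line V W (g : V -> W) z e (s : R) :
  derivable g (z + s *: e) e ->
  is_derive s (1 : R) (fun u : R => g (z + u *: e)) ('D_e g (z + s *: e)).
Proof.
move=> d; rewrite /derive in d *.
have E : (fun h : R => h^-1 *: (((fun u : R => g (z + u *: e)) \o shift s) (h *: (1 : R))
            - g (z + s *: e))) =
    (fun h : R => h^-1 *: ((g \o shift (z + s *: e)) (h *: e) - g (z + s *: e))).
  apply/funext => h /=; rewrite [h *: 1]mulr1 /shift /= scalerDl.
  by rewrite addrCA.
by apply: DeriveDef; rewrite /derivable ?/derive E.
Qed.

Lemma coord_le_norm m n (M : 'M[R]_(m, n)) i j : `|M i j| <= `|M|.
Proof.
rewrite [leRHS]/Num.Def.normr/= mx_normrE.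
exact: (le_bigmax _ (fun ij => `|M ij.1 ij.2|) (i, j)).
Qed.

Lemma norm_le_coord m n (M : 'M[R]_(m, n)) c :
  0 <= c -> (forall i j, `|M i j| <= c) -> `|M| <= c.
Proof.
move=> c0 h; rewrite [leLHS]/Num.Def.normr/= mx_normrE.
by apply: bigmax_le => // ij _; exact: h.
Qed.

Lemma continuous_sum (T : topologicalType) W I (r : seq I) (P : pred I)
    (f : I -> T -> W) x :
  (forall i, P i -> {for x, continuous (f i)}) ->
  {for x, continuous (fun y => \sum_(i <- r | P i) f i y)}.
Proof.
move=> h; elim: r => [|i r IH].
  suff : (fun y => \sum_(i <- [::] | P i) f i y) y @[y --> x] -->
         \sum_(i <- [::] | P i) f i x by [].
  by under eq_cvg do rewrite big_nil; rewrite big_nil; exact: cvg_cst.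
suff : (fun y => \sum_(j <- i :: r | P j) f j y) y @[y --> x] -->
       \sum_(j <- i :: r | P j) f j x by [].
under eq_cvg do rewrite big_cons.
rewrite big_cons; case: ifP => Pi; last exact: IH.
by apply: cvgD; [exact: h|exact: IH].
Qed.

(* Change one coordinate at a time and apply the mean value theorem to each step. *)
Lemma C1_differentiable n (O : set 'rV[R]_n) (g : 'rV[R]_n -> R) y :
  open O -> O y -> Ck 1 O g -> differentiable g y /\
  forall w, 'd g y w = \sum_j w 0 j * 'D_(delta_mx 0 j) g y.
Proof.
move=> oO Oy [_ [dg Dg]].
pose df (w : 'rV[R]_n) : R := \sum_j w 0 j * 'D_(delta_mx 0 j) g y.
have ldf : linear df.
  move=> a u v; rewrite /df scaler_sumr -big_split /=; apply: eq_bigr => j _.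
  by rewrite !mxE mulrDl -mulrA.
pose L : {linear 'rV[R]_n -> R} := HB.pack df (GRing.isLinear.Build _ _ _ _ _ ldf).
have cL : continuous L.
  move=> w; rewrite /L /= /df; apply: continuous_sum => j _.
  apply: (@continuousM _ _ (fun u : 'rV[R]_n => u 0 j) (cst _)); last exact: cst_continuous.
  exact: coord_continuous.
have E (eps : R) : 0 < eps -> \forall h \near (0 : 'rV[R]_n),
    `|(g \o shift y - (cst (g y) + L)) h| <= eps * `|h|.
  move=> /posnumP[e].
  (* Each of the [n] coordinate steps will cost at most [e'] times the norm of [h]; dividing by
     [n + 1] also covers [n = 0]. *)
  pose e' := e%:num / n.+1%:R.
  have e'0 : 0 < e' by rewrite divr_gt0.
  have : \forall z \near y, O z /\ forall j : 'I_n, `|'D_(delta_mx 0 j) g y - 'D_(delta_mx 0 j) g z| <= e'.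
    apply: filterI; first exact: open_nbhs_nbhs.
    apply: (@filter_forall _ _ (fun (j : 'I_n) z => `|'D_(delta_mx 0 j) g y - 'D_(delta_mx 0 j) g z| <= e') (nbhs y) (nbhs_filter y)) => j.
    have [c _] := Dg (delta_mx 0 j).
    exact: ((cvgrPdist_le _ _).1 (c _ Oy) _ e'0).
  move=> /nbhs_normP[d /= d0 hd].
  apply/nbhs_norm0P; exists d => //= h hd'.
  (* [tr k] keeps the first [k] coordinates of [h], so that [y + tr k] leads from [y] to [y + h]. *)
  pose tr k : 'rV[R]_n := \row_j (if (j < k)%N then h 0 j else 0).
  have trS (k : 'I_n) : tr k.+1 = tr k + h 0 k *: delta_mx 0 k.
    apply/rowP => j; rewrite !mxE eqxx /= ltnS leq_eqVlt.
    have [->|jk] := eqVneq j k; first by rewrite eqxx ltnn mulr1 add0r.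
    by rewrite (_ : (j == k :> nat) = false) ?mulr0 ?addr0 //; exact/negbTE.
  have tr0 : tr 0%N = 0 by apply/rowP => j; rewrite !mxE.
  have trn : tr n = h by apply/rowP => j; rewrite !mxE ltn_ord.
  have near_tr (k : 'I_n) c : `|c| <= `|h 0 k| -> `|tr k + c *: delta_mx 0 k| <= `|h|.
    move=> ch; apply: norm_le_coord => // i j; rewrite !mxE ord1 eqxx /=.
    have [->|jk] := eqVneq j k.
      by rewrite ltnn add0r mulr1 (le_trans ch) // coord_le_norm.
    by rewrite mulr0 addr0; case: ifP => _; rewrite ?normr0 ?coord_le_norm.
  have step (k : 'I_n) : `|g (y + tr k.+1) - g (y + tr k) - h 0 k * 'D_(delta_mx 0 k) g y|
       <= `|h| * e'.
    have good c : `|c| <= `|h 0 k| -> O (y + tr k + c *: delta_mx 0 k) /\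
        `|'D_(delta_mx 0 k) g y - 'D_(delta_mx 0 k) g (y + tr k + c *: delta_mx 0 k)| <= e'.
      move=> ch; have [|Oz /(_ k)] := hd (y + tr k + c *: delta_mx 0 k); last by [].
      by rewrite /= -addrA opprD addNKr normrN (le_lt_trans (near_tr _ _ ch)).
    have [c ch] := mvt_signed (fun s hs => derive_on_line (dg _ (delta_mx 0 k) (good s hs).1)).
    rewrite scale0r addr0 -addrA -trS => ->.
    rewrite -mulrBr normrM ler_pM ?coord_le_norm // distrC.
    by case: (good _ ch).
  have -> : (g \o shift y - (cst (g y) + L)) h =
      \sum_(k < n) (g (y + tr k.+1) - g (y + tr k) - h 0 k * 'D_(delta_mx 0 k) g y).
    rewrite big_split /= sumrN -[\sum_(j < n) _ * _]/(df h).
    rewrite -(big_mkord xpredT (fun k => g (y + tr k.+1) - g (y + tr k))).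
    rewrite telescope_sumr // tr0 trn addr0.
    transitivity (g (h + y) - (g y + df h)); first by [].
    by rewrite opprD addrA [h + y]addrC.
  rewrite (le_trans (ler_norm_sum _ _ _)) //.
  rewrite (le_trans (ler_sum _ (fun k _ => step k))) // sumr_const card_ord.
  rewrite -mulr_natr -mulrA mulrC ler_wpM2r // /e' -mulrA ler_piMr //.
  by rewrite mulrC ler_pdivrMr // mul1r ler_nat.
have dE : 'd g y = L :> ('rV[R]_n -> R).
  by apply: (diff_unique cL); apply/eqaddoP => eps; exact: E.
split; last by move=> w; rewrite dE.
apply/diff_locallyP; rewrite dE; split=> //.
by apply/eqaddoP => eps; exact: E.
Qed.

Lemma Ck1 V W k (O : set V) (f : V -> W) : Ck k.+1 O f -> Ck 1 O f.
Proof. by elim: k => [//|k IH] /CkS. Qed.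

(** By the differential of a C^1 map, a derivative of [g \o f] is a sum of products of a coordinate
    of ['D_v f] with a partial derivative of [g] composed with [f]. The partial derivatives have
    order [k], so the induction runs over all [g]. *)
Lemma Ck_comp_scalar n V k (O : set V) (U : set 'rV[R]_n)
    (f : V -> 'rV[R]_n) (g : 'rV[R]_n -> R) :
  open O -> open U -> (forall x, O x -> U (f x)) ->
  Ck k O f -> Ck k U g -> Ck k O (g \o f).
Proof.
move=> oO oU fU; elim: k g => [|k IH] g hf hg.
  split=> // x Ox; apply: continuous_comp.
    exact: Ck_continuous hf Ox.
  exact: Ck_continuous hg (fU _ Ox).
have [cf [df Df]] := hf; have [cg [dg Dg]] := hg.
have diffg y : U y -> differentiable g y /\
    forall w, 'd g y w = \sum_j w 0 j * 'D_(delta_mx 0 j) g y.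
  by move=> Uy; apply: (C1_differentiable oU) => //; exact: Ck1 hg.
have chain x v : O x -> derivable (g \o f) x v /\
    'D_v (g \o f) x = \sum_j 'D_v f x 0 j * 'D_(delta_mx 0 j) g (f x).
  move=> Ox; have [dgx <-] := diffg _ (fU _ Ox).
  exact: derive_chain (df _ _ Ox) dgx.
split.
  by move=> x Ox; apply: continuous_comp; [exact: cf|exact: cg (fU _ Ox)].
split; first by move=> x v Ox; case: (chain x v Ox).
move=> v.
have P j : Ck k O ((fun x => 'D_v f x 0 j) \* ('D_(delta_mx 0 j) g \o f)).
  apply: CkM => //; first by have /(Ck_mx _ _ oO)/(_ 0 j) := Df v.
  by apply: IH; [exact: CkS|exact: Dg].
have := Ck_sum (index_enum 'I_n) oO P.
by apply: Ck_ext => // x Ox; case: (chain x v Ox).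
Qed.

Lemma smooth_comp n p V (O : set V) (U : set 'rV[R]_n)
    (f : V -> 'rV[R]_n) (g : 'rV[R]_n -> 'rV[R]_p) :
  open O -> open U -> (forall x, O x -> U (f x)) ->
  smooth_on O f -> smooth_on U g -> smooth_on O (g \o f).
Proof.
move=> oO oU fU /smooth_onP hf /smooth_onP hg; apply/smooth_onP => k.
apply/(Ck_mx _ _ oO) => i j.
apply: (Ck_comp_scalar (g := fun y => g y i j) oO oU fU) => //.
by have /(Ck_mx _ _ oU)/(_ i j) := hg k.
Qed.

Lemma smooth_mx m n V (O : set V) (f : V -> 'M[R]_(m, n)) : open O ->
  (forall i j, smooth_on O (fun x => f x i j)) -> smooth_on O f.
Proof.
move=> oO h; apply/smooth_onP => k; apply/(Ck_mx _ _ oO) => i j.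
by have /smooth_onP := h i j.
Qed.

Lemma smooth_cst V W (O : set V) (w : W) : smooth_on O (fun=> w).
Proof. by apply/smooth_onP => k; exact: Ck_cst. Qed.

Lemma smooth_coord n (O : set 'rV[R]_n) j : open O -> smooth_on O (fun x : 'rV[R]_n => x 0 j).
Proof.
move=> oO; apply/smooth_onP => k.
have idd (x : 'rV[R]_n) v : derivable (fun x : 'rV[R]_n => x 0 j) x v /\
    'D_v (fun x : 'rV[R]_n => x 0 j) x = v 0 j.
  have d : derivable (id : 'rV[R]_n -> 'rV[R]_n) x v by exact: derivable_id.
  split; first exact: ((derivable_mxP _ _ _).1 d).
  by have := derive_mx d; rewrite derive_id => /matrixP/(_ 0 j); rewrite mxE.
case: k => [|k]; first by split=> // x _; exact: coord_continuous.
split; first by move=> x _; exact: coord_continuous.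
split=> [x v _|v]; first by case: (idd x v).
have := @Ck_cst R 'rV[R]_n R k O (v 0 j).
by apply: Ck_ext => // x _; case: (idd x v).
Qed.

(** * Algebra of smooth real and complex functions *)

Section Algebra.
Variables (V : normedModType R) (O : set V).
Hypothesis oO : open O.

Lemma smoothD (f g : V -> R) :
  smooth_on O f -> smooth_on O g -> smooth_on O (fun x => f x + g x).
Proof. by move=> /smooth_onP hf /smooth_onP hg; apply/smooth_onP => k; exact: CkD. Qed.

Lemma smoothM (f g : V -> R) :
  smooth_on O f -> smooth_on O g -> smooth_on O (fun x => f x * g x).
Proof. by move=> /smooth_onP hf /smooth_onP hg; apply/smooth_onP => k; exact: CkM. Qed.

Lemma smoothN (f : V -> R) : smooth_on O f -> smooth_on O (fun x => - f x).
Proof.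
move=> hf; have := smoothM (@smooth_cst V R O (-1)) hf.
by apply: smooth_ext => // x _; rewrite mulN1r.
Qed.

Lemma smooth_sum (I : Type) (r : seq I) (f : I -> V -> R) :
  (forall i, smooth_on O (f i)) -> smooth_on O (fun x => \sum_(i <- r) f i x).
Proof.
move=> h; apply/smooth_onP => k; apply: Ck_sum => // i.
by have /smooth_onP := h i.
Qed.

Lemma smoothV (f : V -> R) : (forall x, O x -> f x != 0) ->
  smooth_on O f -> smooth_on O (fun x => (f x)^-1).
Proof. by move=> n0 /smooth_onP hf; apply/smooth_onP => k; exact: CkV. Qed.

Lemma smooth_sqrt (f : V -> R) : (forall x, O x -> 0 < f x) ->
  smooth_on O f -> smooth_on O (fun x => Num.sqrt (f x)).
Proof. by move=> n0 /smooth_onP hf; apply/smooth_onP => k; exact: Ck_sqrt. Qed.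

Definition csmooth (f : V -> R[i]) : Prop :=
  smooth_on O (fun x => complex.Re (f x)) /\ smooth_on O (fun x => complex.Im (f x)).

Lemma csmooth_ext (f g : V -> R[i]) :
  (forall x, O x -> f x = g x) -> csmooth f -> csmooth g.
Proof.
by move=> fg [a b]; split; [move: a|move: b]; apply: smooth_ext => // x /fg ->.
Qed.

Lemma csmooth_cst (z : R[i]) : csmooth (fun=> z).
Proof. by split; exact: smooth_cst. Qed.

Lemma csmooth_real (f : V -> R) : smooth_on O f -> csmooth (fun x => (f x)%:C%C).
Proof. by move=> h; split; [exact: h|exact: (@smooth_cst V R O 0)]. Qed.

Lemma csmoothM (f g : V -> R[i]) :
  csmooth f -> csmooth g -> csmooth (fun x => f x * g x).
Proof.
move=> [fr fi] [gr gi]; split.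
  have := smoothD (smoothM fr gr) (smoothN (smoothM fi gi)).
  by apply: smooth_ext => // x _; case: (f x) (g x) => [a b] [c d].
have := smoothD (smoothM fr gi) (smoothM fi gr).
by apply: smooth_ext => // x _; case: (f x) (g x) => [a b] [c d].
Qed.

Lemma csmooth_normsq (f : V -> R[i]) : csmooth f ->
  smooth_on O (fun x => complex.Re (f x) ^+ 2 + complex.Im (f x) ^+ 2).
Proof.
move=> [fr fi]; have := smoothD (smoothM fr fr) (smoothM fi fi).
by apply: smooth_ext => // x _; rewrite !expr2.
Qed.

Lemma normsq_gt0 (z : R[i]) : z != 0 -> 0 < complex.Re z ^+ 2 + complex.Im z ^+ 2.
Proof.
case: z => a b /eqP n0; rewrite lt_neqAle addr_ge0 ?sqr_ge0 // andbT eq_sym /=.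
by rewrite paddr_eq0 ?sqr_ge0 // !sqrf_eq0; apply/andP => -[/eqP a0 /eqP b0];
  apply: n0; rewrite a0 b0.
Qed.

Lemma csmoothV (f : V -> R[i]) : (forall x, O x -> f x != 0) ->
  csmooth f -> csmooth (fun x => (f x)^-1).
Proof.
move=> n0 h; have [fr fi] := h.
have i : smooth_on O (fun x => (complex.Re (f x) ^+ 2 + complex.Im (f x) ^+ 2)^-1).
  by apply: smoothV; [move=> x /n0 /normsq_gt0/lt0r_neq0|exact: csmooth_normsq].
split.
  by have := smoothM fr i; apply: smooth_ext => // x _; case: (f x).
by have := smoothN (smoothM fi i); apply: smooth_ext => // x _; case: (f x).
Qed.

Lemma csmooth_modulus (f : V -> R[i]) : (forall x, O x -> f x != 0) ->
  csmooth f -> smooth_on O (fun x => modulus (f x)).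
Proof.
move=> n0 /csmooth_normsq h.
have := smooth_sqrt (fun x Ox => normsq_gt0 (n0 x Ox)) h.
by apply: smooth_ext => // x _; case: (f x).
Qed.

Lemma csmooth_exprz (f : V -> R[i]) (k : int) : (forall x, O x -> f x != 0) ->
  csmooth f -> csmooth (fun x => f x ^ k).
Proof.
move=> n0 h.
have N k' : csmooth (fun x => f x ^+ k').
  elim: k' => [|k' IH]; first exact: csmooth_cst.
  by have := csmoothM h IH; apply: csmooth_ext => x _; rewrite exprS.
case: k => k'; first exact: N.
have := csmoothV (fun x Ox => expf_neq0 k'.+1 (n0 x Ox)) (N k'.+1).
by apply: csmooth_ext.
Qed.

Lemma csmooth_prod (I : Type) (r : seq I) (P : pred I) (f : I -> V -> R[i]) :
  (forall i, P i -> csmooth (f i)) -> csmooth (fun x => \prod_(i <- r | P i) f i x).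
Proof.
move=> h; elim: r => [|i r IH].
  by have := csmooth_cst 1; apply: csmooth_ext => x _; rewrite big_nil.
case Pi : (P i).
  by have := csmoothM (h _ Pi) IH; apply: csmooth_ext => x _; rewrite big_cons Pi.
by move: IH; apply: csmooth_ext => x _; rewrite big_cons Pi.
Qed.

End Algebra.
End SmoothComp.

(** * Atlases *)

Section Atlases.
Context {R : realType}.

Lemma image_injP (X Y : Type) (f : X -> Y) (A : set X) x y :
  {in A &, injective f} -> A x -> A y -> f x = f y -> x = y.
Proof. by move=> h Ax Ay; apply: h; rewrite inE. Qed.

Section Transport.
Variables (X Z : topologicalType) (d : nat) (F : X -> Z).

(** The charts compared here are prescribed only on their domains, so the coordinate maps have to
    agree only there. *)
Definition pulled_back (c : chart R X d) (c0 : chart R Z d) : Prop :=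
  (forall x, c.1 x <-> c0.1 (F x)) /\ forall x, c.1 x -> c.2 x = c0.2 (F x).

Lemma pulled_back_chart (Fi : Z -> X) c c0 :
  continuous F -> continuous Fi -> cancel F Fi -> cancel Fi F ->
  pulled_back c c0 -> is_chart c0 -> is_chart c.
Proof.
move=> cF cFi FK FiK [c1 c2] [po i0 k0 op0].
have c1E : c.1 = F @^-1` c0.1 by apply/seteqP; split=> x /=; rewrite c1.
have oc : open c.1 by rewrite c1E; apply: open_comp => // x _; exact: cF.
split=> //.
- move=> x y /set_mem cx /set_mem cy; rewrite !c2 // => /(image_injP i0) e.
  by apply: (can_inj FK); apply: e; exact/c1.
- move=> x cx; apply: (near_eq_continuous (f := c0.2 \o F) oc cx).
    by move=> y /c2.
  by apply: continuous_comp; [exact: cF|exact/k0/c1].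
- move=> V oV Vc.
  have -> : c.2 @` V = c0.2 @` (Fi @^-1` V).
    apply/seteqP; split=> u [x Vx <-].
      by exists (F x); rewrite /= ?FK // c2 //; exact: Vc.
    by exists (Fi x) => //; rewrite c2 ?FiK //; exact: Vc.
  apply: op0; first by apply: open_comp => // x _; exact: cFi.
  by move=> z /= /Vc/c1; rewrite FiK.
Qed.

End Transport.

(** Since [G \o f = F], the map [f] reads in the charts [c0], [c0'] as the identity of [Z]; its
    smoothness is the compatibility of the two atlases of [Z]. *)
Lemma smooth_map_transport (X Y Z : topologicalType) (d e : nat)
    (F : X -> Z) (G : Y -> Z) (f : X -> Y)
    (A : set (chart R X d)) (A' : set (chart R Y e))
    (B : set (chart R Z d)) (B' : set (chart R Z e)) :
  (forall x, G (f x) = F x) ->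
  (forall c, A c -> exists2 c0, B c0 & pulled_back F c c0) ->
  (forall c, A' c -> exists2 c0, B' c0 & pulled_back G c c0) ->
  smooth_map B B' id -> smooth_map A A' f.
Proof.
move=> Gf AB AB' sm c c' /AB [c0 Bc0 [c1 c2]] /AB' [c0' Bc0' [c1' c2']].
have [g sg ge] := sm _ _ Bc0 Bc0'; exists g.
  apply: smooth_sub sg => u [x [/= cx c'x] <-]; exists (F x); last by rewrite c2.
  by split; [exact/c1|rewrite /preimage /= -Gf; exact/c1'].
move=> x cx c'x; rewrite c2 // c2' // Gf; apply: ge; first exact/c1.
by rewrite -Gf; exact/c1'.
Qed.

Lemma pulled_back_atlas (X Z : topologicalType) (d : nat) (F : X -> Z) (Fi : Z -> X)
    (A : set (chart R X d)) (B : set (chart R Z d)) :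
  continuous F -> continuous Fi -> cancel F Fi -> cancel Fi F ->
  (forall c, A c -> exists2 c0, B c0 & pulled_back F c c0) ->
  (forall x, exists2 c, A c & c.1 x) ->
  smooth_atlas B -> smooth_atlas A.
Proof.
move=> cF cFi FK FiK AB cov [ch _ sm]; split=> //.
  by move=> c /AB [c0 /ch h0 p]; exact: (pulled_back_chart cF cFi FK FiK p h0).
exact: (smooth_map_transport (F := F) (G := F) _ AB AB sm).
Qed.

End Atlases.

(** * Compatibility of the charts of the moment-angle quotient *)

Section QuotientAtlas.
Context {R : realType} {n : nat} {D I : finType}.
Variables (P : halfspaces R n I) (lambda : D -> I -> int).
Local Notation B := (ma_quotient_atlas P lambda).

Lemma ma_class_surj (y : ma_quotient P lambda) : exists z, ma_class P lambda z = y.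
Proof. by exists (repr y); rewrite /ma_class reprK. Qed.

(** The section and the smooth extension depend on the point, so one map [g] is fixed beforehand and
    then shown to be smooth near each point of its domain. *)
Lemma ma_quotient_atlas_transition : smooth_map B B id.
Proof.
move=> c c' [hc _ hs] [hc' hp' _].
have [hoc ic kc opc] := hc; have [hoc' ic' kc' opc'] := hc'.
set W := c.2 @` _.
have oW : open W by apply: opc => [|x []//]; exact: openI.
(* [c.2] is injective on its domain, so the value is unique on [W]; elsewhere it is the default
   0. *)
pose g u : 'rV[R]_(n + n) :=
  xget 0 [set v | exists2 y, c.1 y /\ c'.1 y & c.2 y = u /\ c'.2 y = v].
have gE y : c.1 y -> c'.1 y -> g (c.2 y) = c'.2 y.
  move=> cy c'y; apply: xget_unique; first by exists y.
  by move=> v [y' [cy' _] [/(image_injP ic cy' cy) -> ->]].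
exists g => //; apply: smooth_local => u0 [y0 [cy0 c'y0] e0].
have [z0 z0E] := ma_class_surj y0; subst y0.
have [U [s [hU]]] := hs _ cy0; rewrite e0 => Uu0 ss sz su.
have [U' [g' [hU' U'z sg' g'E]]] := hp' _ c'y0.
(* The points of [W] whose lift by the section also lies in the domain of [g']. *)
pose N := U `&` W `&` (fun u => coords (val (s u))) @^-1` U'.
have oN : open N.
  rewrite openE => u [[Uu Wu] U'u]; rewrite /interior.
  apply: filterI; first by apply: open_nbhs_nbhs; split; [exact: openI|].
  by apply: (smooth_continuous ss Uu); exact: open_nbhs_nbhs.
exists N.
  by split; [split=> //; exists (ma_class P lambda z0)|rewrite /preimage /= sz].
apply: (smooth_ext (f := g' \o (fun u => coords (val (s u)))) oN).
  move=> u [[Uu [y [cy c'y] yu]] U'u] /=.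
  have [cs csu] := su _ Uu.
  have ys : y = ma_class P lambda (s u) by apply: (image_injP ic) => //; rewrite csu.
  by rewrite -(g'E (s u)) -?ys // -yu gE.
apply: (smooth_comp (U := U')) => //.
- by move=> u [].
- by apply: smooth_sub ss => u [[]].
Qed.

End QuotientAtlas.

(** * Quotient maps and continuity *)

Section QuotientMaps.

Definition quotient_map (X Y : topologicalType) (q : X -> Y) : Prop :=
  [/\ continuous q, forall y, exists x, q x = y &
      forall U, open (q @^-1` U) -> open U].

Lemma quotient_map_comp (X Y Z : topologicalType) (p : X -> Y) (q : Y -> Z) :
  quotient_map p -> quotient_map q -> quotient_map (q \o p).
Proof.
move=> [cp sp hp] [cq sq hq]; split.
- by move=> x; apply: continuous_comp; [exact: cp|exact: cq].
- by move=> z; have [y <-] := sq z; have [x <-] := sp y; exists x.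
- by move=> U h; apply/hq/hp.
Qed.

Lemma quotient_map_pi (X : topologicalType) (Q : quotType X) :
  quotient_map (\pi_(quotient_topology Q)).
Proof.
split; [exact: pi_continuous|by move=> y; exists (repr y); rewrite reprK|by []].
Qed.

Lemma compact_quotient_map (X Y : topologicalType) (q : X -> Y) :
  compact [set: X] -> hausdorff_space Y -> continuous q ->
  (forall y, exists x, q x = y) -> quotient_map q.
Proof.
move=> cX hY cq sq; split=> // U oU.
rewrite -(setCK U); apply: closed_openC.
have -> : ~` U = q @` (q @^-1` (~` U)).
  apply/seteqP; split=> [y nUy|_ [x nUx <-] //].
  by have [x xy] := sq y; exists x => //; rewrite /preimage /= xy.
apply: compact_closed => //; apply: continuous_compact.
  exact: continuous_subspaceT.
apply: subclosed_compact cX _ => //.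
by rewrite preimage_setC; exact: open_closedC.
Qed.

Lemma quotient_map_homeo (X Y Z : topologicalType) (p : X -> Y) (q : X -> Z) :
  quotient_map p -> quotient_map q ->
  (forall x x', p x = p x' <-> q x = q x') ->
  exists (F : Y -> Z) (Fi : Z -> Y),
    [/\ continuous F, continuous Fi, cancel F Fi, cancel Fi F & forall x, F (p x) = q x].
Proof.
move=> [cp sp hp] [cq sq hq] pq.
pose F y := q (sval (cid (sp y))); pose Fi z := p (sval (cid (sq z))).
have FE x : F (p x) = q x by rewrite /F; case: cid => x' /= /pq.
have FiE x : Fi (q x) = p x by rewrite /Fi; case: cid => x' /= /pq.
exists F, Fi; split=> //.
- apply/continuousP => A oA; apply: hp; rewrite -comp_preimage.
  by rewrite (_ : F \o p = q); [move/continuousP: cq; exact|exact/funext].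
- apply/continuousP => A oA; apply: hq; rewrite -comp_preimage.
  by rewrite (_ : Fi \o q = p); [move/continuousP: cp; exact|exact/funext].
- by move=> y; have [x <-] := sp y; rewrite FE FiE.
- by move=> z; have [x <-] := sq z; rewrite FiE FE.
Qed.

(** Continuity is available only over [O]; the neighbourhood of [y] is cut down to [O], and its
    openness is checked on the preimage under [q]. *)
Lemma quotient_map_continuous_at (X Y Z : topologicalType) (q : X -> Y) (O : set Y)
    (f : Y -> Z) y :
  quotient_map q -> open O -> (forall x, O (q x) -> {for x, continuous (f \o q)}) ->
  O y -> {for y, continuous f}.
Proof.
move=> [cq sq hq] oO cf Oy; suff : f @ y --> f y by [].
move=> V; rewrite nbhsE => -[W [oW Wy] WV].
apply: (filterS (P := O `&` f @^-1` W)) => [z [_ /WV]//|].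
apply: open_nbhs_nbhs; split=> //; apply: hq; rewrite openE => x [Oqx Wx].
apply: filterI; first by apply: cq; exact: open_nbhs_nbhs.
by apply: (cf x Oqx); exact: open_nbhs_nbhs.
Qed.

End QuotientMaps.

Section Subtypes.
Variables (X : topologicalType) (A : set X).

Lemma val_continuous : continuous (val : set_type A -> X).
Proof. exact: initial_continuous. Qed.

Lemma continuous_val_at (Y : topologicalType) (f : Y -> set_type A) y :
  {for y, continuous (val \o f)} -> {for y, continuous f}.
Proof.
move=> cf U [?/= [[W oW <-]]] /= Wsfz /filterS; apply; apply: cf.
exact: open_nbhs_nbhs.
Qed.

Lemma compact_set_type : compact A -> compact [set: set_type A].
Proof.
move=> cA F PF _.
have AF : F ((val : set_type A -> X) @^-1` A).
  by rewrite (_ : _ @^-1` _ = setT); [exact: filterT|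
    apply/seteqP; split=> x // _; exact: (set_valP x)].
have [x [Ax xF]] := cA _ (fmap_proper_filter (val : set_type A -> X) PF) AF.
exists (SigSub (mem_set Ax)); split=> // B N FB [?/= [[W oW <-]]] /= Wx /(_ _) WN.
have [|_ [[y By <-] Wy]] := xF (val @` B) W _ (open_nbhs_nbhs (conj oW Wx)).
  have : F ((val : set_type A -> X) @^-1` (val @` B)) by apply: filterS FB => y By; exists y.
  by [].
by exists y; split=> //; exact: WN.
Qed.

Lemma hausdorff_set_type : hausdorff_space X -> hausdorff_space (set_type A).
Proof.
move=> hX x y xy; apply: val_inj; apply: hX => U V Ux Vy.
have [z [Uz Vz]] := xy _ _ (val_continuous Ux) (val_continuous Vy).
by exists (val z).
Qed.

End Subtypes.
Arguments continuous_val_at : clear implicits.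
Arguments continuous_val_at {X A} {Y f y} _.

Section ProdTopology.
Variables (I : eqType) (K : I -> topologicalType).

Lemma continuous_prod_at (X : topologicalType) (f : X -> prod_topology K) x :
  (forall i, {for x, continuous (fun y => f y i)}) -> {for x, continuous f}.
Proof.
move=> h; apply/cvg_sup => i U [?/= [[W oW <-]]] /= Wf /filterS; apply.
by apply: (h i); exact: open_nbhs_nbhs.
Qed.

Lemma continuous_eval i : continuous (fun f : prod_topology K => f i).
Proof. exact: proj_continuous. Qed.

End ProdTopology.
Arguments continuous_prod_at : clear implicits.
Arguments continuous_prod_at {I K} {X f x} _.

Lemma eq_continuous_at (T U : topologicalType) (f g : T -> U) (x : T) :
  (forall y, f y = g y) -> {for x, continuous f} -> {for x, continuous g}.
Proof. by move=> /funext ->. Qed.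


(* The statement {for x, continuous f} unfolds to a product, whose variables
   would otherwise be declared implicit. *)
Arguments eq_continuous_at : clear implicits.
Arguments eq_continuous_at {T U f g x} _ _.

Lemma continuous_comp_at (T U V : topologicalType) (f : T -> U) (g : U -> V) (x : T) :
  {for x, continuous f} -> {for f x, continuous g} -> {for x, continuous (fun y => g (f y))}.
Proof. exact: continuous_comp. Qed.
Arguments continuous_comp_at : clear implicits.
Arguments continuous_comp_at {T U V} f g x _ _.



Section RealContinuity.
Context {R : realType} {T : topologicalType}.
Implicit Types (f g : T -> R) (x : T).

Lemma continuous_addr f g x : {for x, continuous f} -> {for x, continuous g} ->
  {for x, continuous (fun y => f y + g y)}.
Proof. exact: continuousD. Qed.

Lemma continuous_mulr f g x : {for x, continuous f} -> {for x, continuous g} ->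
  {for x, continuous (fun y => f y * g y)}.
Proof. exact: continuousM. Qed.

Lemma continuous_oppr f x : {for x, continuous f} ->
  {for x, continuous (fun y => - f y)}.
Proof. exact: continuousN. Qed.

Lemma continuous_invr f x : f x != 0 -> {for x, continuous f} ->
  {for x, continuous (fun y => (f y)^-1)}.
Proof. exact: continuousV. Qed.

Lemma continuous_sqrtr f x : {for x, continuous f} ->
  {for x, continuous (fun y => Num.sqrt (f y))}.
Proof. by move=> cf; apply: (continuous_comp cf); exact: sqrt_continuous. Qed.

Lemma continuous_cstr (a : R) x : {for x, continuous (fun=> a)}.
Proof. exact: cst_continuous. Qed.

Lemma continuous_maxr f g x : {for x, continuous f} -> {for x, continuous g} ->
  {for x, continuous (fun y => Num.max (f y) (g y))}.
Proof. exact: continuous_max. Qed.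

Lemma continuous_minr f g x : {for x, continuous f} -> {for x, continuous g} ->
  {for x, continuous (fun y => Num.min (f y) (g y))}.
Proof. exact: continuous_min. Qed.

Lemma continuous_bigmaxr (I : Type) (r : seq I) (P : pred I) (f : I -> T -> R) a x :
  (forall i, {for x, continuous (f i)}) ->
  {for x, continuous (fun y => \big[Num.max/a]_(i <- r | P i) f i y)}.
Proof.
move=> h; elim: r => [|i r IH].
  by apply: (eq_continuous_at _ (@continuous_cstr a x)) => y; rewrite big_nil.
case Pi : (P i).
  by apply: (eq_continuous_at _ (@continuous_maxr _ _ _ (h i) IH)) => y; rewrite big_cons Pi.
by apply: (eq_continuous_at _ IH) => y; rewrite big_cons Pi.
Qed.

Lemma continuous_bigminr (I : Type) (r : seq I) (P : pred I) (f : I -> T -> R) a x :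
  (forall i, {for x, continuous (f i)}) ->
  {for x, continuous (fun y => \big[Num.min/a]_(i <- r | P i) f i y)}.
Proof.
move=> h; elim: r => [|i r IH].
  by apply: (eq_continuous_at _ (@continuous_cstr a x)) => y; rewrite big_nil.
case Pi : (P i).
  by apply: (eq_continuous_at _ (@continuous_minr _ _ _ (h i) IH)) => y; rewrite big_cons Pi.
by apply: (eq_continuous_at _ IH) => y; rewrite big_cons Pi.
Qed.

End RealContinuity.
Arguments continuous_addr : clear implicits.
Arguments continuous_addr {R T} {f g x} _ _.
Arguments continuous_mulr : clear implicits.
Arguments continuous_mulr {R T} {f g x} _ _.
Arguments continuous_oppr : clear implicits.
Arguments continuous_oppr {R T} {f x} _.
Arguments continuous_invr : clear implicits.
Arguments continuous_invr {R T} {f x} _ _.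
Arguments continuous_sqrtr : clear implicits.
Arguments continuous_sqrtr {R T} {f x} _.
Arguments continuous_cstr : clear implicits.
Arguments continuous_cstr {R T} a x.
Arguments continuous_maxr : clear implicits.
Arguments continuous_maxr {R T} {f g x} _ _.
Arguments continuous_minr : clear implicits.
Arguments continuous_minr {R T} {f g x} _ _.
Arguments continuous_bigmaxr : clear implicits.
Arguments continuous_bigmaxr {R T} {I r P f a x} _.
Arguments continuous_bigminr : clear implicits.
Arguments continuous_bigminr {R T} {I r P f a x} _.

(** * Topology of the complex numbers *)

Section ComplexTopology.
Context {R : realType}.
Local Notation C := (R[i]^o).

Lemma normc_modulus (z : C) : `|z| = (modulus z)%:C%C.
Proof. by case: z. Qed.

Lemma Re_le_modulus (z : R[i]) : `|complex.Re z| <= modulus z.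
Proof.
case: z => a b /=; rewrite -sqrtr_sqr ler_wsqrtr //.
by rewrite lerDl sqr_ge0.
Qed.

Lemma Im_le_modulus (z : R[i]) : `|complex.Im z| <= modulus z.
Proof.
case: z => a b /=; rewrite -sqrtr_sqr ler_wsqrtr //.
by rewrite lerDr sqr_ge0.
Qed.

Lemma modulus_le (z : R[i]) : modulus z <= `|complex.Re z| + `|complex.Im z|.
Proof.
case: z => a b /=; rewrite -[leRHS]ger0_norm ?addr_ge0 // -sqrtr_sqr ler_wsqrtr //.
rewrite sqrrD !real_normK ?num_real // lerD2r lerDl mulrn_wge0 // mulr_ge0 //.
Qed.

Lemma near_modulus (z : C) (e : R) : 0 < e ->
  \forall w \near z, modulus (z - w) < e.
Proof.
move=> e0; have e0' : 0 < e%:C%C :> R[i] by rewrite ltcR.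
have := nbhsx_ballx z _ e0'.
by apply: filterS => w; rewrite -ball_normE /ball_ /= normc_modulus ltcR.
Qed.

Lemma continuous_Re : continuous (fun z : C => complex.Re z).
Proof.
move=> z; suff : complex.Re w @[w --> z] --> complex.Re z by [].
apply/(@cvgrPdist_lt _ _ _ (nbhs z) (nbhs_filter z)) => e e0.
apply: filterS (near_modulus z e0) => w h.
by apply: le_lt_trans h; rewrite -raddfB; exact: Re_le_modulus.
Qed.

Lemma continuous_Im : continuous (fun z : C => complex.Im z).
Proof.
move=> z; suff : complex.Im w @[w --> z] --> complex.Im z by [].
apply/(@cvgrPdist_lt _ _ _ (nbhs z) (nbhs_filter z)) => e e0.
apply: filterS (near_modulus z e0) => w h.
by apply: le_lt_trans h; rewrite -raddfB; exact: Im_le_modulus.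
Qed.

Lemma continuous_complex (T : topologicalType) (f : T -> C) (x : T) :
  {for x, continuous (fun y => complex.Re (f y))} ->
  {for x, continuous (fun y => complex.Im (f y))} -> {for x, continuous f}.
Proof.
move=> cr ci; suff : f y @[y --> x] --> f x by [].
apply/(@cvgrPdist_lt _ _ _ (nbhs x) (nbhs_filter x)) => -[e e'] /=.
(* A positive element of [R[i]] is real, so only real radii [e] occur. *)
rewrite ltcE /= => /andP[/eqP -> e0].
have e2 : 0 < e / 2 by rewrite divr_gt0.
near=> y; rewrite normc_modulus ltcR.
apply: le_lt_trans (modulus_le _) _; rewrite (splitr e) raddfB /= [complex.Im _]raddfB.
by apply: ltrD; near: y; [exact: ((cvgrPdist_lt _ _).1 cr)|exact: ((cvgrPdist_lt _ _).1 ci)].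
Unshelve. all: by end_near. Qed.

Lemma continuous_modulus : continuous (fun z : C => modulus z).
Proof.
move=> z; rewrite (_ : (fun z : C => modulus z) =
  fun z => Num.sqrt (complex.Re z ^+ 2 + complex.Im z ^+ 2)); last by apply/funext => -[].
have sq (f : C -> R) : {for z, continuous f} -> {for z, continuous (fun w => f w ^+ 2)}.
  by move=> cf; apply: (eq_continuous_at _ (continuous_mulr cf cf)) => w; rewrite expr2.
apply: (@continuous_sqrtr R C (fun w => complex.Re w ^+ 2 + complex.Im w ^+ 2) z).
apply: (@continuous_addr R C (fun w => complex.Re w ^+ 2) (fun w => complex.Im w ^+ 2) z).
  by apply: sq; exact: continuous_Re.
by apply: sq; exact: continuous_Im.
Qed.

Lemma complex_hausdorff : hausdorff_space C.
Proof. exact: norm_hausdorff. Qed.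

(** The disk is a closed subset of the image of the square [-1, 1]^2. *)
Lemma compact_disk : compact (@disk R).
Proof.
pose f (x : R * R) : C := (x.1 +i* x.2)%C.
have cf : continuous f.
  by move=> x; apply: continuous_complex; [exact: cvg_fst|exact: cvg_snd].
have cK : compact (f @` (`[-1, 1]%classic `*` `[-1, 1]%classic)).
  apply: continuous_compact; first exact: continuous_subspaceT.
  by apply: compact_setX; exact: segment_compact.
apply: subclosed_compact cK _ => [|z /= z1].
  rewrite (_ : disk = (fun z : C => modulus z) @^-1` [set x | x <= 1]) //.
  by apply: closed_comp => [x _|]; [exact: continuous_modulus|exact: closed_le].
exists (complex.Re z, complex.Im z); last by case: z {z1}.
by split; rewrite /= in_itv /= -ler_norml (le_trans _ z1) // ?Re_le_modulus ?Im_le_modulus.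
Qed.

Lemma compact_circle : compact (@circle R).
Proof.
apply: subclosed_compact compact_disk _ => [|z]; last by rewrite /circle /disk /= => ->.
rewrite (_ : circle = (fun z : C => modulus z) @^-1` [set 1]) //.
by apply: closed_comp => [x _|]; [exact: continuous_modulus|exact: closed_eq].
Qed.

End ComplexTopology.
Arguments continuous_complex : clear implicits.
Arguments continuous_complex {R} {T f x} _ _.

(** * Polytopes *)

Section Geometry.
Context {R : realType} {n : nat} {I : finType} (P : halfspaces R n I).

Definition slope (i : I) (v : 'rV[R]_n) : R := \sum_k normal P i 0 k * v 0 k.

Lemma slopeD i v w : slope i (v + w) = slope i v + slope i w.
Proof. by rewrite /slope -big_split; apply: eq_bigr => k _; rewrite mxE mulrDr. Qed.

Lemma slopeZ i a v : slope i (a *: v) = a * slope i v.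
Proof. by rewrite /slope mulr_sumr; apply: eq_bigr => k _; rewrite mxE mulrCA. Qed.

Lemma slopeN i v : slope i (- v) = - slope i v.
Proof. by rewrite -scaleN1r slopeZ mulN1r. Qed.

Lemma slope_sum (J : Type) (r : seq J) (Q : pred J) i (f : J -> 'rV[R]_n) :
  slope i (\sum_(j <- r | Q j) f j) = \sum_(j <- r | Q j) slope i (f j).
Proof.
elim/big_rec2: _ => [|j a b _ <-]; last by rewrite slopeD.
by rewrite /slope big1 // => k _; rewrite mxE mulr0.
Qed.

Lemma ellE i x : ell P i x = slope i x + offset P i. Proof. by []. Qed.

Lemma ellD i x v : ell P i (x + v) = ell P i x + slope i v.
Proof. by rewrite !ellE slopeD addrAC. Qed.

Lemma slope_sub i x y : slope i (y - x) = ell P i y - ell P i x.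
Proof. by rewrite slopeD slopeN !ellE; ring. Qed.

Lemma ell_conv i t x y :
  ell P i (t *: x + (1 - t) *: y) = t * ell P i x + (1 - t) * ell P i y.
Proof. by rewrite !ellE slopeD !slopeZ; ring. Qed.

Lemma facets_atE x i : (i \in facets_at P x) = (ell P i x == 0).
Proof. by rewrite inE. Qed.

Hypothesis bP : bounded_set (polytope P).

(** Otherwise the ray from [x] in the direction [v] would be an unbounded part of the polytope. *)
Lemma recession_cone0 x v : polytope P x -> (forall i, 0 <= slope i v) -> v = 0.
Proof.
move=> Px sv; have [M [_ hM]] := bP; apply/eqP/negPn/negP => v0.
(* With this [t] the vector [t *: v] has norm |M| + |x| + 2, while boundedness allows at most |M| +
   |x| + 1. *)
pose t := (`|M| + 1 + `|x|) / `|v| + 1 / `|v|.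
have nv : 0 < `|v| by rewrite normr_gt0.
have t0 : 0 <= t by rewrite addr_ge0 // divr_ge0 ?addr_ge0.
have /(hM (`|M| + 1)) : M < `|M| + 1 by rewrite (le_lt_trans (ler_norm _)) // ltrDl.
have Pt : polytope P (x + t *: v).
  by move=> i; rewrite ellD slopeZ addr_ge0 // mulr_ge0.
move=> /(_ _ Pt) h.
have : `|t *: v| <= `|M| + 1 + `|x|.
  rewrite -[t *: v](addrK x) (le_trans (ler_normB _ _)) // lerD2r.
  by rewrite addrC.
rewrite normrZ ger0_norm // /t mulrDl !divfK ?gt_eqF //.
by rewrite gerDl ler10.
Qed.

(* Unless p is a vertex, it moves inside its face, in a direction in which ell i
   does not decrease, until it meets a further facet. *)
Lemma vertex_above p i : polytope P p ->
  exists x, [/\ vertex P x, facets_at P p \subset facets_at P x & ell P i p <= ell P i x].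
Proof.
move: {2}_.+1 (ltnSn #|~: facets_at P p|) => N.
elim: N p => // N IH p; rewrite ltnS => hN Pp.
have [vp|nvp] := pselect (vertex P p); first by exists p.
(* If [p] is interior to a segment from [y] to [z] in the polytope, each facet through [p] contains
   the segment, and [z - y] is such a direction; its sign is chosen for [slope i]. *)
have [v [v0 fv iv]] : exists v, [/\ v != 0,
    forall k, k \in facets_at P p -> slope k v = 0 & 0 <= slope i v].
  suff [v v0 fv] : exists2 v, v != 0 & forall k, k \in facets_at P p -> slope k v = 0.
    have [iv|iv] := leP 0 (slope i v); first by exists v.
    exists (- v); split; first by rewrite oppr_eq0.
      by move=> k /fv h; rewrite slopeN h oppr0.
    by rewrite slopeN oppr_ge0 ltW.
  apply: contrapT => h; apply: nvp; split=> // y z t Py Pz /andP[t0 t1] e.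
  have yz : z = y.
    apply/eqP; rewrite -subr_eq0; apply/negPn/negP => zy; apply: h.
    exists (z - y) => // k; rewrite facets_atE e ell_conv slope_sub => /eqP ek.
    have := Py k; have := Pz k => hz hy.
    have a1 : 0 <= t * ell P k y by rewrite mulr_ge0 // ltW.
    have a2 : 0 <= (1 - t) * ell P k z by rewrite mulr_ge0 // subr_ge0 ltW.
    move/eqP: ek; rewrite paddr_eq0 // => /andP[].
    rewrite !mulf_eq0 (gt_eqF t0) subr_eq0 (gt_eqF t1) /= => /eqP -> /eqP ->.
    by rewrite subrr.
  by rewrite e yz -scalerDl addrC subrK scale1r.
have [k0 k0v] : exists k, slope k v < 0.
  apply: contrapT => h; move/eqP: v0; apply; apply: recession_cone0 Pp _ => k.
  by rewrite leNgt; apply/negP => hk; apply: h; exists k.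
(* The time at which a facet function decreasing along [v] reaches zero; the first such time is
   used. *)
pose q k := ell P k p / - slope k v.
have [k kv kmin] := @arg_minP _ R I k0 (fun k => slope k v < 0) q k0v.
have qk0 : 0 <= q k by rewrite divr_ge0 ?Pp // oppr_ge0 ltW.
pose p' := p + q k *: v.
have sub : facets_at P p \subset facets_at P p'.
  apply/fintype.subsetP => l lp; move: (lp); rewrite !facets_atE ellD slopeZ fv //.
  by rewrite mulr0 addr0.
have kp' : k \in facets_at P p'.
  rewrite facets_atE ellD slopeZ /q invrN mulrN mulNr divfK ?subrr //.
  by rewrite lt_eqF.
have kp : k \notin facets_at P p.
  by apply/negP => /fv h; move: kv; rewrite h ltxx.
have Pp' : polytope P p'.
  move=> l; rewrite ellD slopeZ; have [lv|lv] := leP 0 (slope l v).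
    by rewrite addr_ge0 ?Pp // mulr_ge0.
  have := kmin _ lv; rewrite /q ler_pdivlMr ?oppr_gt0 // mulrN.
  by rewrite lerNl -subr_ge0 opprK addrC.
have [||x [vx px ix]] := IH p' => //.
  apply: leq_trans hN; apply: proper_card.
  by rewrite properC properE sub; apply/fintype.subsetPn; exists k.
exists x; split=> //; first exact: fintype.subset_trans px.
by apply: le_trans ix; rewrite ellD slopeZ lerDl mulr_ge0.
Qed.

(** Only finitely many facet functions are positive at [x]. The minimum has default 1 in case there
    is none, and [1 +] keeps the denominators positive. *)
Lemma small_step x v : polytope P x -> exists2 t, 0 < t &
  forall s k, `|s| <= t -> k \notin facets_at P x -> 0 <= ell P k (x + s *: v).
Proof.
move=> Px.
pose q k := ell P k x / (1 + `|slope k v|).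
have d0 k : 0 < 1 + `|slope k v| by rewrite ltr_pwDl.
exists (\big[Num.min/1]_(k | k \notin facets_at P x) q k).
  apply: lt_bigmin => // k; rewrite facets_atE => kx.
  by rewrite divr_gt0 // lt_neqAle eq_sym kx Px.
move=> s k hs kx; rewrite ellD slopeZ.
have : `|s| <= q k by apply: le_trans hs _; exact: bigmin_le_cond.
rewrite ler_pdivlMr // => h.
have : `|s * slope k v| <= ell P k x.
  by apply: le_trans h; rewrite normrM ler_wpM2l // lerDr.
by rewrite ler_norml => /andP[h1 _]; rewrite -(subrr (ell P k x)) lerD2l.
Qed.

(** Otherwise [x] would be the midpoint of [x + t *: v] and [x - t *: v], both in the polytope for
    small [t]. So the normals of the facets at a vertex span. *)
Lemma vertex_slopes0 x v : vertex P x ->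
  (forall k, k \in facets_at P x -> slope k v = 0) -> v = 0.
Proof.
move=> [Px vx] fv; have [t t0 ht] := small_step v Px.
have inP s : `|s| <= t -> polytope P (x + s *: v).
  move=> st k; have [kx|kx] := boolP (k \in facets_at P x); last exact: ht.
  by rewrite ellD slopeZ fv // mulr0 addr0.
have [||||] := vx (x + t *: v) (x + (- t) *: v) (2^-1).
- by apply: inP; rewrite ger0_norm // ltW.
- by apply: inP; rewrite normrN ger0_norm // ltW.
- by rewrite invr_gt0 ltr0n invf_lt1 ?ltr1n ?ltr0n.
- rewrite [1 - _](_ : _ = 2^-1); last by field.
  by rewrite -scalerDr addrACA scaleNr subrr addr0 -mulr2n -[x *+ 2]scaler_nat scalerA
    mulVf ?scale1r ?pnatr_eq0.
move=> /eqP; rewrite -subr_eq0 addrAC subrr add0r scaler_eq0 gt_eqF //= => /eqP ->.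
by [].
Qed.

(** * Affine coordinates at a vertex *)

Section Vertex.
Variables (x : 'rV[R]_n) (e : 'I_n -> I).
Hypotheses (vx : vertex P x) (fx : facets_at P x = [set e k | k : 'I_n]%SET).

Definition normals : 'M[R]_n := \matrix_(k, l) normal P (e k) 0 l.

(** Column [l] of the inverse: the direction of the edge at [x] that leaves the facet [e l]. *)
Definition dual_basis (l : 'I_n) : 'rV[R]_n := row l (invmx normals)^T.

Lemma normals_unit : normals \in unitmx.
Proof.
rewrite -unitmx_tr -row_free_unit; apply: inj_row_free => v hv.
apply: (vertex_slopes0 vx) => k; rewrite fx => /imsetP[l _ ->].
have := congr1 (fun M : 'rV[R]_n => M 0 l) hv; rewrite !mxE => <-.
by apply: eq_bigr => j _; rewrite !mxE mulrC.
Qed.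

Lemma slope_dual_basis k l : slope (e k) (dual_basis l) = (k == l)%:R.
Proof.
have := congr1 (fun M : 'M[R]_n => M k l) (mulmxV normals_unit); rewrite !mxE => <-.
by apply: eq_bigr => j _; rewrite !mxE.
Qed.

Lemma slope_vertex0 v : (forall k, slope (e k) v = 0) -> v = 0.
Proof.
by move=> h; apply: (vertex_slopes0 vx) => k; rewrite fx => /imsetP[l _ ->].
Qed.

Lemma vertex_coords y : y = x + \sum_k ell P (e k) y *: dual_basis k.
Proof.
apply/eqP; rewrite -subr_eq0; apply/eqP/slope_vertex0 => k.
rewrite opprD addrA slopeD slopeN slope_sum slope_sub (bigD1 k) //= slopeZ.
rewrite slope_dual_basis eqxx mulr1 big1; last first.
  by move=> l lk; rewrite slopeZ slope_dual_basis eq_sym (negbTE lk) mulr0.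
have : e k \in facets_at P x by rewrite fx; apply/imsetP; exists k.
by rewrite facets_atE => /eqP ->; ring.
Qed.

Lemma ell_vertex_coords (c : 'I_n -> R) k :
  ell P (e k) (x + \sum_l c l *: dual_basis l) = c k.
Proof.
rewrite ellD slope_sum (bigD1 k) //= slopeZ slope_dual_basis eqxx mulr1 big1; last first.
  by move=> l lk; rewrite slopeZ slope_dual_basis eq_sym (negbTE lk) mulr0.
have : e k \in facets_at P x by rewrite fx; apply/imsetP; exists k.
by rewrite facets_atE => /eqP ->; rewrite add0r addr0.
Qed.

Lemma ell_vertex_inj y z : (forall k, ell P (e k) y = ell P (e k) z) -> y = z.
Proof.
by move=> h; rewrite (vertex_coords y) (vertex_coords z); congr (_ + _);
  apply: eq_bigr => k _; rewrite h.
Qed.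

End Vertex.
End Geometry.

(** * Vertices and barycentres of simple polytopes *)

Section SimplePolytope.
Context {R : realType} {n : nat} {I : finType} (P : halfspaces R n I).
Hypothesis sP : simple_polytope P.

Let bP : bounded_set (polytope P). Proof. by case: sP. Qed.

Lemma polytope_nonempty : exists p, polytope P p.
Proof. by case: sP => _ [[x Px _] _] _ _ _; exists (x ord0). Qed.

Lemma vertex_enum x : vertex P x ->
  exists2 e : 'I_n -> I, injective e & facets_at P x = [set e k | k : 'I_n]%SET.
Proof.
move=> vx; have c : #|facets_at P x| = n by case: sP => _ _ _ _; apply.
exists (fun k => enum_val (cast_ord (esym c) k)).
  by move=> k l /enum_val_inj /cast_ord_inj.
apply/setP => i; apply/idP/imsetP => [ix|[k _ ->]]; last exact: enum_valP.
by exists (cast_ord c (enum_rank_in ix i)) => //; rewrite cast_ordK enum_rankK_in.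
Qed.

Lemma polytope_vertex p : polytope P p ->
  exists2 x, vertex P x & facets_at P p \subset facets_at P x.
Proof.
move=> Pp; suff [x [vx px]] : exists x, vertex P x /\ facets_at P p \subset facets_at P x.
  by exists x.
(* [vertex_above] asks for a facet function to increase. Without facets the bounded polytope is the
   whole space, which is then a point. *)
have [[i _]|nI] := pselect (exists i : I, True); last first.
  exists p; split=> //; split=> // y z t Py Pz _ _.
  have no v : v = 0 :> 'rV[R]_n.
    apply: (recession_cone0 bP Pp) => i; by exfalso; apply: nI; exists i.
  by rewrite [y]no [z]no [p]no.
by have [x [vx px _]] := vertex_above bP i Pp; exists x.
Qed.

Lemma ell_inj p q : (forall i, ell P i p = ell P i q) -> p = q.
Proof.
move=> h; have [x0 Px0] := polytope_nonempty.
have [x vx _] := polytope_vertex Px0; have [e _ fx] := vertex_enum vx.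
by apply: (ell_vertex_inj vx fx) => k; exact: h.
Qed.

Lemma face_facets_at (s : {set I}) p : face P s p <-> polytope P p /\ s \subset facets_at P p.
Proof.
split=> -[Pp h]; split=> //.
  by apply/fintype.subsetP => i /h e; rewrite facets_atE e.
by move=> i /(fintype.subsetP h); rewrite facets_atE => /eqP.
Qed.

Lemma face_vertex (s : {set I}) : face P s !=set0 ->
  exists2 x, vertex P x & s \subset facets_at P x.
Proof.
move=> [p /face_facets_at [Pp sp]]; have [x vx px] := polytope_vertex Pp.
by exists x => //; exact: fintype.subset_trans px.
Qed.

Lemma face_card (s : {set I}) : face P s !=set0 -> (#|s| <= n)%N.
Proof.
move=> /face_vertex [x vx sx]; have <- : #|facets_at P x| = n by case: sP => _ _ _ _; apply.
exact: subset_leq_card.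
Qed.

Lemma maximal_face (s : {set I}) : face P s !=set0 -> #|s| = n ->
  exists x, [/\ vertex P x, facets_at P x = s & face P s = [set x]].
Proof.
move=> /face_vertex [x vx sx] sn.
have fx : facets_at P x = s.
  apply/esym/eqP; rewrite eqEcard sx sn /=.
  by case: sP => _ _ _ _ /(_ _ vx) ->.
exists x; split=> //; apply/seteqP; split=> [y /= [_ hy]|_ ->]; last first.
  by apply/face_facets_at; case: vx; rewrite fx.
have [e _ fe] := vertex_enum vx.
apply: (ell_vertex_inj vx fe) => k.
have ek : e k \in facets_at P x by rewrite fe; apply/imsetP; exists k.
rewrite hy -?fx //; by move: ek; rewrite facets_atE => /eqP.
Qed.

(** From a vertex on the facet [i], a short step along the edge leaving it keeps the other facets of
    the vertex and makes [ell i] positive; climbing from there to a vertex does not decrease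
    [ell i]. *)
Lemma face_vertex_off (s : {set I}) i : face P s !=set0 -> i \notin s ->
  exists x, [/\ vertex P x, s \subset facets_at P x & i \notin facets_at P x].
Proof.
move=> /face_vertex [x vx sx] nis.
have [ix|ix] := boolP (i \in facets_at P x); last by exists x.
have [e _ fe] := vertex_enum vx.
have [k _ ik] : exists2 k, k \in 'I_n & i = e k by move: ix; rewrite fe => /imsetP.
pose d := dual_basis P e k.
have Px : polytope P x by case: vx.
have [t t0 ht] := small_step d Px.
have E l : ell P (e l) (x + t *: d) = t * (l == k)%:R.
  rewrite ellD slopeZ (slope_dual_basis vx fe).
  have : e l \in facets_at P x by rewrite fe; apply/imsetP; exists l.
  by rewrite facets_atE => /eqP ->; rewrite add0r.
have Pp : polytope P (x + t *: d).
  move=> j; have [|jx] := boolP (j \in facets_at P x); last first.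
    by apply: ht => //; rewrite ger0_norm // ltW.
  by rewrite fe => /imsetP[l _ ->]; rewrite E mulr_ge0 // ltW.
have [y [vy py iy]] := vertex_above bP i Pp; exists y; split=> //.
  apply: fintype.subset_trans py; apply/fintype.subsetP => j js.
  have := fintype.subsetP sx _ js; rewrite fe => /imsetP[l _ jl]; rewrite facets_atE jl E.
  have [lk|_] := eqVneq l k; last by rewrite mulr0.
  by move: nis; rewrite ik -lk -jl js.
rewrite facets_atE gt_eqF // (lt_le_trans _ iy) // ik E eqxx mulr1.
exact: t0.
Qed.

Variable K : {set {set I}}.
Hypothesis dK : dual_complex P K.

Lemma facets_at_complex p : polytope P p -> facets_at P p \in K.
Proof. by move=> Pp; apply/dK; exists p; apply/face_facets_at. Qed.

Lemma complex_sub (s r : {set I}) : s \in K -> r \subset s -> r \in K.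
Proof.
move=> /dK [p /face_facets_at [Pp sp]] rs; apply/dK; exists p.
by apply/face_facets_at; split=> //; exact: fintype.subset_trans rs sp.
Qed.

Lemma vertP (s : {set I}) : s \in K -> #|s| = n ->
  vertex P (vert P s) /\ facets_at P (vert P s) = s.
Proof.
move=> /dK sK sn; have [x [vx fx e]] := maximal_face sK sn.
by rewrite /vert e (@xget_subset1 _ _ _ x) // => ? ? -> ->.
Qed.

Lemma ell_baryE (s : {set I}) i :
  let V := [set r in K | (s \subset r) && (#|r| == n)]%SET in
  s \in K -> ell P i (bary P K s) = (#|V|%:R)^-1 * \sum_(r in V) ell P i (vert P r).
Proof.
move=> V sK; have [x vx sx] : exists2 x, vertex P x & s \subset facets_at P x.
  by apply: face_vertex; exact/dK.
have V0 : #|V|%:R != 0 :> R.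
  rewrite pnatr_eq0 -lt0n; apply/card_gt0P; exists (facets_at P x).
  rewrite !inE sx facets_at_complex; last by case: vx.
  by case: sP => _ _ _ _ /(_ _ vx) ->; rewrite eqxx.
rewrite /bary -/V ellE slopeZ slope_sum -[offset P i](mulKf V0).
rewrite -mulrDr; congr (_ * _); rewrite mulr_natl -sumr_const -big_split /=.
by apply: eq_bigr => r _; rewrite -ellE.
Qed.

(** By [face_vertex_off] every facet outside [s] misses some vertex of the face, so its function is
    positive on average: the barycentre lies in the relative interior of the face. *)
Lemma baryP (s : {set I}) : s \in K ->
  polytope P (bary P K s) /\ facets_at P (bary P K s) = s.
Proof.
move=> sK.
have vV r : r \in [set r in K | (s \subset r) && (#|r| == n)]%SET ->
    [/\ vertex P (vert P r), facets_at P (vert P r) = r & s \subset r].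
  by rewrite inE => /and3P[rK sr /eqP rn]; have [] := vertP rK rn.
have ell0 r i : r \in [set r in K | (s \subset r) && (#|r| == n)]%SET ->
    0 <= ell P i (vert P r).
  by move=> /vV [[] + _ _ _]; apply.
split.
  by move=> i; rewrite ell_baryE // mulr_ge0 // ?invr_ge0 // sumr_ge0 // => r /ell0.
apply/setP => i; rewrite facets_atE ell_baryE //.
have [is_|nis] := boolP (i \in s).
  rewrite big1 ?mulr0 ?eqxx // => r /vV [_ fr sr].
  by apply/eqP; rewrite -facets_atE fr; exact: (fintype.subsetP sr).
have [x [vx sx ix]] := face_vertex_off (i := i) ((dK s).1 sK) nis.
have xV : facets_at P x \in [set r in K | (s \subset r) && (#|r| == n)]%SET.
  rewrite inE sx facets_at_complex /=; last by case: vx.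
  by case: sP => _ _ _ _ /(_ _ vx) ->.
rewrite mulf_eq0 invr_eq0 pnatr_eq0 -leqn0 leqNgt; apply/negbTE; rewrite negb_or negbK.
apply/andP; split; first by apply/card_gt0P; exists (facets_at P x).
apply: contra ix; rewrite psumr_eq0; last by move=> r /ell0.
move=> /allP /(_ _ (mem_index_enum (facets_at P x))).
rewrite xV /= -facets_atE.
by have [_ -> _] := vV _ xV.
Qed.

End SimplePolytope.

(** * Cubical subdivision *)

Section Chains.
Context {R : realType} {I : finType}.
Implicit Types (w : {set I} -> R) (s : {set I}).

(** Formal combinations of sets along a flag. In what follows [b s] is a vector vanishing exactly on
    [s]: the indicator of the complement for the cube, the facet coordinates of [bary s] for the
    polytope. *)
Definition chain w : Prop :=
  (forall s, 0 <= w s) /\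
  forall s s', 0 < w s -> 0 < w s' -> s \subset s' \/ s' \subset s.

Lemma chain_min (Q : pred {set I}) w s0 : chain w -> 0 < w s0 -> Q s0 ->
  exists s, [/\ 0 < w s, Q s & forall s', 0 < w s' -> Q s' -> s \subset s'].
Proof.
move=> [_ cw] w0 Q0.
have [|s /andP[ws Qs] smin] := @arg_minnP _ s0 (fun s => (0 < w s) && Q s) (fun s => #|s|).
  by rewrite w0 Q0.
exists s; split=> // s' ws' Qs'; have [//|s's] := cw _ _ ws ws'.
suff /eqP -> : s' == s by [].
by rewrite eqEcard s's smin // ws' Qs'.
Qed.

Lemma chain_max (Q : pred {set I}) w s0 : chain w -> 0 < w s0 -> Q s0 ->
  exists s, [/\ 0 < w s, Q s & forall s', 0 < w s' -> Q s' -> s' \subset s].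
Proof.
move=> [_ cw] w0 Q0.
have [|s /andP[ws Qs] smax] := @arg_maxnP _ s0 (fun s => (0 < w s) && Q s) (fun s => #|s|).
  by rewrite w0 Q0.
exists s; split=> // s' ws' Qs'; have [ss'|//] := cw _ _ ws ws'.
suff /eqP -> : s == s' by [].
by rewrite eqEcard ss'; apply: smax; rewrite ws' Qs'.
Qed.

Variables (K : {set {set I}}) (b : {set I} -> I -> R).
Hypothesis b0 : forall s i, s \in K -> 0 <= b s i.
Hypothesis bE : forall s i, s \in K -> (b s i == 0) = (i \in s).

Definition supported w : Prop := forall s, 0 < w s -> s \in K.

(** A sum of nonnegative terms vanishes where all its terms do, that is on the intersection of the
    support, which is the least set of the chain. *)
Lemma chain_zero_set w s0 : chain w -> supported w -> 0 < w s0 ->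
  exists2 s, 0 < w s & forall i, (\sum_r w r * b r i == 0) = (i \in s).
Proof.
move=> cw sw w0; have [s [ws _ smin]] := chain_min (Q := xpredT) cw w0 isT.
exists s => // i.
have [w_ge0 _] := cw.
have t0 r : 0 <= w r * b r i.
  have := w_ge0 r; rewrite le_eqVlt => /predU1P[<-|wr]; first by rewrite mul0r.
  by rewrite mulr_ge0 // b0 // sw.
rewrite psumr_eq0 //; apply/allP/idP => [|is_ r _ /=].
  move=> /(_ _ (mem_index_enum s)) /=.
  by rewrite mulf_eq0 gt_eqF //= bE // sw.
have := w_ge0 r; rewrite le_eqVlt => /predU1P[<-|wr]; first by rewrite mul0r.
by rewrite mulf_eq0 bE ?sw // (fintype.subsetP (smin _ wr isT)) ?orbT.
Qed.

(* The zero set of the combination is the smallest set of the chain, so both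
   chains have the same one; the smaller of its two weights is subtracted. *)
Lemma chain_unique w w' : chain w -> chain w' -> supported w -> supported w' ->
  \sum_s w s = \sum_s w' s ->
  (forall i, \sum_s w s * b s i = \sum_s w' s * b s i) -> w =1 w'.
Proof.
move: {2}_.+1 (ltnSn (#|[set s | 0 < w s]%SET| + #|[set s | 0 < w' s]%SET|)) => N.
elim: N w w' => // N IH w w'; rewrite ltnS => hN cw cw' sw sw' mE fE.
have [w0 cw2] := cw; have [w0' cw2'] := cw'.
have pos (v : {set I} -> R) : (forall s, 0 <= v s) -> 0 < \sum_s v s -> exists s, 0 < v s.
  move=> v0; rewrite lt_neqAle eq_sym psumr_neq0 // => /andP[/hasP[s _ /= h] _].
  by exists s.
have [m0|m0] := leP (\sum_s w s) 0.
  have z (v : {set I} -> R) : (forall s, 0 <= v s) -> \sum_s v s <= 0 -> forall s, v s = 0.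
    move=> v0 v1 s; have : \sum_s v s == 0 by rewrite eq_le v1 sumr_ge0.
    by rewrite psumr_eq0 // => /allP /(_ _ (mem_index_enum s)) /eqP.
  by move=> s; rewrite (z w) // (z w') // -mE.
have [s0 ws0] := pos _ w0 m0; have [s0' ws0'] : exists s, 0 < w' s.
  by apply: pos => //; rewrite -mE.
have [S wS SE] := chain_zero_set cw sw ws0.
have [S' wS' SE'] := chain_zero_set cw' sw' ws0'.
have e : S' = S by apply/setP => i; rewrite -SE -SE' fE.
subst S'; pose c := Num.min (w S) (w' S).
pose cut (v : {set I} -> R) s := v s - (if s == S then c else 0) : R.
have c0 : 0 < c by rewrite lt_min wS.
have cut_le v s : cut v s <= v s.
  by rewrite /cut; case: ifP; rewrite ?subr0 // lerBlDr lerDl ltW.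
have cut_ge0 (v : {set I} -> R) : (forall s, 0 <= v s) -> c <= v S -> forall s, 0 <= cut v s.
  by move=> v0 cv s; rewrite /cut; case: eqP => [->|_]; rewrite ?subr0 // subr_ge0.
have cut_chain (v : {set I} -> R) : chain v -> c <= v S -> chain (cut v).
  move=> [v0 v2] cv; split=> [|s s' h h']; first exact: cut_ge0.
  by apply: v2; [apply: lt_le_trans h _|apply: lt_le_trans h' _]; exact: cut_le.
have cut_supp (v : {set I} -> R) : supported v -> supported (cut v).
  by move=> sv s h; apply: sv; apply: lt_le_trans h _; exact: cut_le.
have cut_sum v (a : {set I} -> R) : \sum_s cut v s * a s = \sum_s v s * a s - c * a S.
  under eq_bigr do rewrite mulrBl.
  rewrite sumrB; congr (_ - _); rewrite (bigD1 S) //= eqxx big1 ?addr0 //.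
  by move=> s /negbTE ->; rewrite mul0r.
have cut_sum1 v : \sum_s cut v s = \sum_s v s - c.
  have s1 (u : {set I} -> R) : \sum_s u s * 1 = \sum_s u s.
    by apply: eq_bigr => s _; rewrite mulr1.
  by have := cut_sum v (fun=> 1); rewrite mulr1 !s1.
have cw1 : c <= w S by rewrite ge_min lexx.
have cw1' : c <= w' S by rewrite ge_min lexx orbT.
have key : cut w =1 cut w'.
  apply: IH; try by [exact: cut_chain|exact: cut_supp].
  - apply: leq_trans hN.
    have sub v : [set s | 0 < cut v s]%SET \subset [set s | 0 < v s]%SET.
      by apply/fintype.subsetP => s; rewrite !inE => h; apply: lt_le_trans h _; exact: cut_le.
    have sub' (v : {set I} -> R) : 0 < v S -> v S <= c -> (#|[set s | (0 < cut v s)%R]%SET| < #|[set s | (0 < v s)%R]%SET|)%N.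
      move=> vS vc; apply: proper_card; rewrite properE sub; apply/fintype.subsetPn; exists S.
        by rewrite inE.
      by rewrite inE /cut eqxx -leNgt subr_le0.
    have [h|h] := leP (w S) (w' S).
      rewrite -addSn leq_add ?subset_leq_card //; apply: sub' => //.
      by rewrite /c le_min lexx.
    rewrite -addnS leq_add ?subset_leq_card //; apply: sub' => //.
    by rewrite /c le_min lexx andbT ltW.
  - by rewrite !cut_sum1 mE.
  - by move=> i; rewrite !cut_sum fE.
by move=> s; have := key s; rewrite /cut => /addIr.
Qed.

(** [C f mu] stands for a point [f] of mass [mu] in the cone over the space to be subdivided. The
    hypotheses say that only the apex has mass 0 and that zero sets at positive mass are simplices,
    and they let a multiple of [b] at the zero set be subtracted as long as the mass and all
    coordinates stay nonnegative. *)
Variable C : (I -> R) -> R -> Prop.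
Hypothesis C_ge0 : forall f mu, C f mu -> 0 <= mu /\ forall i, 0 <= f i.
Hypothesis C_zero : forall f, C f 0 -> forall i, f i = 0.
Hypothesis C_zero_set : forall f mu, C f mu -> 0 < mu -> [set i | f i == 0]%SET \in K.
Hypothesis C_sub : forall f mu t, C f mu -> 0 < mu -> 0 <= t <= mu ->
  (forall i, 0 <= f i - t * b [set i | f i == 0]%SET i) ->
  C (fun i => f i - t * b [set i | f i == 0]%SET i) (mu - t).

(* Greedily, the largest admissible multiple of b is subtracted at the zero set
   of f, which enlarges the zero set or exhausts mu. *)
Lemma chain_exists f mu : C f mu ->
  exists w, [/\ chain w, supported w, mu = \sum_s w s,
    forall i, f i = \sum_s w s * b s i &
    forall s, 0 < w s -> [set i | f i == 0]%SET \subset s].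
Proof.
move: {2}_.+1 (ltnSn #|~: [set i | f i == 0]%SET|) => N.
elim: N f mu => // N IH f mu; rewrite ltnS => hN Cf.
have [mu0 f0] := C_ge0 Cf.
move: mu0; rewrite le_eqVlt => /predU1P[m0|m0].
  subst mu; exists (fun=> 0); split.
  - by split=> // s s'; rewrite ltxx.
  - by move=> s; rewrite ltxx.
  - by rewrite big1.
  - by move=> i; rewrite (C_zero Cf) big1 // => s _; rewrite mul0r.
  - by move=> s; rewrite ltxx.
have ZK := C_zero_set Cf m0.
have sub t := @C_sub f mu t Cf m0.
set Z := [set i | f i == 0]%SET in hN ZK sub *.
have bZ i : i \notin Z -> 0 < b Z i.
  by move=> iZ; rewrite lt_neqAle eq_sym bE // iZ b0.
pose t := \big[Num.min/mu]_(i | i \notin Z) (f i / b Z i).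
have t0 : 0 < t.
  apply: lt_bigmin => // i iZ; rewrite divr_gt0 ?bZ // lt_neqAle eq_sym f0 andbT.
  by move: iZ; rewrite inE.
have tmu : t <= mu by exact: bigmin_le_id.
have f1 i : 0 <= f i - t * b Z i.
  have [iZ|iZ] := boolP (i \in Z).
    by have := iZ; rewrite -bE // => /eqP ->; rewrite mulr0 subr0.
  rewrite subr_ge0 -ler_pdivlMr ?bZ //; exact: bigmin_le_cond.
have C1 : C (fun i => f i - t * b Z i) (mu - t).
  by apply: sub => //; rewrite (ltW t0).
pose d s := (if s == Z then t else 0) : R.
have dsum (a : {set I} -> R) : \sum_s d s * a s = t * a Z.
  rewrite (bigD1 Z) //= /d eqxx big1 ?addr0 // => s /negbTE ->; rewrite mul0r //.
have dsum1 : \sum_s d s = t.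
  by have := dsum (fun=> 1); rewrite mulr1 => <-; apply: eq_bigr => s _; rewrite mulr1.
have d_ge0 s : 0 <= d s by rewrite /d; case: ifP => // _; exact: ltW.
suff [w [cw sw mw fw Zw]] : exists w, [/\ chain w, supported w, mu - t = \sum_s w s,
    forall i, f i - t * b Z i = \sum_s w s * b s i & forall s, 0 < w s -> Z \subset s].
  exists (fun s => w s + d s); have [w_ge0 w2] := cw.
  have sp s : 0 < w s + d s -> s = Z \/ 0 < w s.
    by rewrite /d; case: eqP => [->|_]; [left|rewrite addr0; right].
  split.
  - split=> [s|s s' /sp h /sp h']; first exact: addr_ge0.
    case: h => [->|h]; first by case: h' => [->|/Zw]; left.
    by case: h' => [->|h']; [right; exact: Zw|exact: w2].
  - by move=> s /sp [->|/sw].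
  - by rewrite big_split /= -mw dsum1 subrK.
  - move=> i; under eq_bigr do rewrite mulrDl.
    by rewrite big_split /= -fw dsum subrK.
  - by move=> s /sp [->|/Zw].
have [mt|mt] := eqVneq t mu.
  exists (fun=> 0); split.
  - by split=> // s s'; rewrite ltxx.
  - by move=> s; rewrite ltxx.
  - by rewrite mt subrr big1.
  - move: C1; rewrite mt subrr => C1 i.
    by rewrite (C_zero C1 i) big1 // => s _; rewrite mul0r.
  - by move=> s; rewrite ltxx.
(* As [t] differs from [mu], the minimum is attained at some [j] outside [Z], where the new vector
   acquires a zero. *)
have [j jZ fj] : exists2 j, j \notin Z & f j - t * b Z j = 0.
  apply: contrapT => h.
  have : t < t; last by rewrite ltxx.
  rewrite {2}/t; apply: lt_bigmin => [|i iZ]; first by rewrite lt_neqAle mt.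
  rewrite ltr_pdivlMr ?bZ // -subr_gt0 lt_neqAle f1 andbT eq_sym.
  by apply/eqP => e; apply: h; exists i.
have ZZ1 : Z \subset [set i | f i - t * b Z i == 0]%SET.
  apply/fintype.subsetP => i iZ; rewrite inE.
  have /eqP -> : f i == 0 by move: iZ; rewrite /Z inE.
  by rewrite sub0r oppr_eq0 mulf_eq0 bE // iZ orbT.
have [|w [cw sw mw fw Zw]] := IH _ _ _ C1.
  apply: leq_trans hN; apply: proper_card; rewrite properC properE ZZ1.
  by apply/fintype.subsetPn; exists j; rewrite // inE fj.
by exists w; split=> // s /Zw; exact: fintype.subset_trans.
Qed.

End Chains.

(** * Barycentric weights in the cube *)

Section Weights.
Context {R : realType} {I : finType}.
Implicit Types (w : {set I} -> R) (s : {set I}) (y : I -> R).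

(* For a set s comparable with the whole chain, the largest y i with i in s is the
   total weight of the sets strictly below s, and the smallest y i with i not in s
   is that weight plus w s; otherwise their difference is not positive. *)
Lemma weight_of_chain w y : chain w -> \sum_s w s = 1 ->
  (forall i, y i = \sum_s w s * (i \notin s)%:R) -> weight y =1 w.
Proof.
move=> cw w1 yE s; have [w0 w2] := cw.
have wle (p q : pred {set I}) : (forall r, 0 < w r -> p r -> q r) ->
    \sum_r w r * (p r)%:R <= \sum_r w r * (q r)%:R.
  move=> pq; apply: ler_sum => r _.
  have := w0 r; rewrite le_eqVlt => /predU1P[<-|wr]; first by rewrite !mul0r.
  by apply: ler_wpM2l => //; have := pq r wr; case: (p r) => [->|_] //; exact: ler0n.
have wge0 (p : pred {set I}) : 0 <= \sum_r w r * (p r)%:R.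
  by apply: sumr_ge0 => r _; rewrite mulr_ge0 // ler0n.
have wle1 (p : pred {set I}) : \sum_r w r * (p r)%:R <= 1.
  by rewrite -[leRHS]w1; apply: ler_sum => r _; rewrite ler_piMr // lern1 leq_b1.
rewrite /weight; set M := \big[Num.max/0]_(i in s) y i.
set m := \big[Num.min/1]_(i | i \notin s) y i.
have [comp|] := pselect (forall r, 0 < w r -> r \subset s \/ s \subset r); last first.
  move=> /existsNP[r /not_implyP[wr /not_orP[/negP /fintype.subsetPn[j jr js]]]].
  move=> /negP/fintype.subsetPn[i is_ ir].
  (* Here [j] lies in [r] but not in [s], and [i] in [s] but not in [r]. Every set of the chain that
     misses [j] is inside [r], so it misses [i], and [y j <= y i]. *)
  have mM : m <= M.
    have h1 : m <= y j by exact: bigmin_le_cond.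
    have h2 : y i <= M by exact: (le_bigmax_cond 0 y is_).
    apply: le_trans h1 (le_trans _ h2); rewrite !yE; apply: wle => q wq jq.
    have [qr|rq] := w2 _ _ wq wr; last by move: jq; rewrite (fintype.subsetP rq).
    by apply: contra ir => /(fintype.subsetP qr).
  have -> : w s = 0.
    have := w0 s; rewrite le_eqVlt => /predU1P[//|ws]; exfalso.
    have [/fintype.subsetP h|/fintype.subsetP h] := w2 _ _ ws wr.
      by move: ir; rewrite h.
    by move: js; rewrite h.
  by apply/max_idPl; rewrite subr_le0.
pose a := \sum_r w r * (r \proper s)%:R.
have aw : a + w s = \sum_r w r * (r \subset s)%:R.
  rewrite (bigD1 s) //= subxx mulr1 addrC; congr (_ + _).
  rewrite /a (bigD1 s) //= fintype.properxx mulr0 add0r; apply: eq_bigr => r rs.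
  by rewrite finset.properEneq rs.
have M_a : M = a.
  apply/eqP; rewrite eq_le; apply/andP; split.
    apply: bigmax_le => [|i is_]; first exact: wge0.
    rewrite yE; apply: wle => r wr ir; rewrite properE.
    have [rs|sr] := comp _ wr; last by move: ir; rewrite (fintype.subsetP sr).
    by rewrite rs; apply/fintype.subsetPn; exists i.
  have [[r0 /andP[wr0 r0s]]|no] := pselect (exists r, (0 < w r) && (r \proper s)).
    have [r [wr rs rmax]] := chain_max (Q := fun r => r \proper s) cw wr0 r0s.
    have [i is_ ir] : exists2 i, i \in s & i \notin r.
      by move: rs; rewrite properE => /andP[_ /fintype.subsetPn].
    apply: (le_trans _ (le_bigmax_cond 0 y is_)).
    rewrite yE; apply: wle => q wq qs.
    by apply: contra ir => /(fintype.subsetP (rmax _ wq qs)).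
  rewrite /a big1 ?bigmax_ge_id // => r _.
  have := w0 r; rewrite le_eqVlt => /predU1P[<-|wr]; first by rewrite mul0r.
  case: (boolP (r \proper s)) => rs; last by rewrite mulr0.
  by exfalso; apply: no; exists r; rewrite wr.
have m_a : m = a + w s.
  apply/eqP; rewrite eq_le; apply/andP; split; last first.
    apply: le_bigmin => [|i is_]; first by rewrite aw; exact: wle1.
    rewrite aw yE; apply: wle => r wr rs.
    by apply: contra is_ => /(fintype.subsetP rs).
  rewrite aw.
  have [[r0 /andP[wr0 r0s]]|no] := pselect (exists r, (0 < w r) && ~~ (r \subset s)).
    have [r [wr rs rmin]] := chain_min (Q := fun r => ~~ (r \subset s)) cw wr0 r0s.
    have [i ir is_] : exists2 i, i \in r & i \notin s by exact/fintype.subsetPn.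
    apply: (@le_trans _ _ (y i)); first exact: bigmin_le_cond.
    rewrite yE; apply: wle => q wq iq; apply: contraNT iq => qs.
    exact: (fintype.subsetP (rmin _ wq qs)).
  rewrite (_ : \sum_r _ = 1) ?bigmin_le_id // -[RHS]w1; apply: eq_bigr => r _.
  have := w0 r; rewrite le_eqVlt => /predU1P[<-|wr]; first by rewrite mul0r.
  case: (boolP (r \subset s)) => rs; first by rewrite mulr1.
  by exfalso; apply: no; exists r; rewrite wr.
by rewrite M_a m_a addrAC subrr add0r; exact/max_idPr.
Qed.

(** The decomposition in the cube, where the cone is [0 <= f i <= mu] and every set is a simplex; by
    [weight_of_chain] its weights can only be [weight y]. *)
Lemma weightP y : (forall i, 0 <= y i <= 1) ->
  [/\ chain (weight y), \sum_s weight y s = 1 &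
      forall i, y i = \sum_s weight y s * (i \notin s)%:R].
Proof.
move=> y01.
pose C (f : I -> R) (mu : R) := 0 <= mu /\ forall i, 0 <= f i <= mu.
have [|||||||w [cw _ mw fw _]] := @chain_exists R I [set: {set I}]%SET
    (fun s i => (i \notin s)%:R) _ _ C _ _ _ _ y 1.
- by move=> s i _; exact: ler0n.
- by move=> s i _; rewrite pnatr_eq0 eqb0 negbK.
- by move=> f mu [m0 h]; split=> // i; case/andP: (h i).
- by move=> f [_ h] i; apply/eqP; rewrite eq_le andbC.
- by move=> f mu _ _; rewrite inE.
- move=> f mu t [m0 h] _ /andP[t0 tm] h'; split=> [|i]; first by rewrite subr_ge0.
  rewrite h' /=; have /andP[fi0 fim] := h i.
  rewrite inE; case: eqP => [->|_] /=; first by rewrite mulr0 subr0 subr_ge0.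
  by rewrite mulr1 lerD2r.
- by split=> // i; exact: y01.
have wE := weight_of_chain cw (esym mw) fw.
have -> : weight y = w by exact/funext.
by split.
Qed.

Lemma weight_supp y s : 0 < weight y s -> s \subset [set i | y i < 1]%SET.
Proof.
rewrite lt_max ltxx /= subr_gt0 => h; apply/fintype.subsetP => i is_; rewrite inE.
apply: le_lt_trans (le_bigmax_cond 0 y is_) _.
by apply: lt_le_trans h _; exact: bigmin_le_id.
Qed.

End Weights.

(** * The cubical map as a bijection onto the polytope *)

Section Cubical.
Context {R : realType} {n : nat} {I : finType} (P : halfspaces R n I).
Variable K : {set {set I}}.
Hypotheses (sP : simple_polytope P) (dK : dual_complex P K).

(** What the moduli of a point of Z(K; (D^2, S^1)) satisfy. Sets of positive weight lie inside the
    set where [y i < 1], so they are simplices. *)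
Definition admissible (y : I -> R) : Prop :=
  (forall i, 0 <= y i <= 1) /\ [set i | y i < 1]%SET \in K.

Let b (s : {set I}) i := ell P i (bary P K s).

Let b_ge0 s i : s \in K -> 0 <= b s i.
Proof. by move=> sK; have [Pb _] := baryP sP dK sK; exact: Pb. Qed.

Let b_eq0 s i : s \in K -> (b s i == 0) = (i \in s).
Proof. by move=> sK; have [_ fb] := baryP sP dK sK; rewrite -facets_atE fb. Qed.

Lemma admissible_supported y : admissible y -> supported K (weight y).
Proof. by move=> [_ yK] s /weight_supp; exact: complex_sub. Qed.

Lemma supported_sum (y : I -> R) (a : {set I} -> R) : supported K (weight y) ->
  \sum_(s in K) weight y s * a s = \sum_s weight y s * a s.
Proof.
move=> sy; rewrite [RHS](bigID (fun s => s \in K)) /= [X in _ = _ + X]big1 ?addr0 //.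
move=> s sK; have : 0 <= weight y s by rewrite le_max lexx.
rewrite le_eqVlt => /predU1P[<-|/sy]; first by rewrite mul0r.
by rewrite (negbTE sK).
Qed.

Lemma ell_cubical y i : admissible y ->
  ell P i (cubical P K y) = \sum_s weight y s * b s i.
Proof.
move=> ya; have [y01 _] := ya; have [_ w1 _] := weightP y01.
have sy := admissible_supported ya.
rewrite -supported_sum // /cubical ellE slope_sum -[offset P i]mul1r -w1.
rewrite (_ : \sum_s weight y s = \sum_(s in K) weight y s); last first.
  have := supported_sum (fun=> 1) sy.
  by under eq_bigr do rewrite mulr1; under [in RHS]eq_bigr do rewrite mulr1; move=> ->.
rewrite mulr_suml -big_split /=; apply: eq_bigr => s _.
by rewrite slopeZ -mulrDr.
Qed.

(** Both are sums, with the weights of [y], of nonnegative terms that vanish together. In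
    [to_moment_angle] the square root therefore vanishes exactly where the phase degenerates. *)
Lemma ell_cubical_eq0 y i : admissible y -> (ell P i (cubical P K y) == 0) = (y i == 0).
Proof.
move=> ya; have [y01 _] := ya; have [[w0 _] w1 yE] := weightP y01.
have sy := admissible_supported ya.
have wb s : 0 <= weight y s * b s i.
  have := w0 s; rewrite le_eqVlt => /predU1P[<-|ws]; first by rewrite mul0r.
  by rewrite mulr_ge0 // b_ge0 // sy.
rewrite ell_cubical // yE !psumr_eq0 //; last first.
  by move=> s _; rewrite mulr_ge0 // ler0n.
apply: eq_all => s /=; rewrite !mulf_eq0 pnatr_eq0 eqb0 negbK.
have := w0 s; rewrite le_eqVlt => /predU1P[<-|ws]; first by rewrite eqxx.
by rewrite b_eq0 // sy.
Qed.

Lemma cubical_polytope y : admissible y -> polytope P (cubical P K y).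
Proof.
move=> ya i; rewrite ell_cubical //; apply: sumr_ge0 => s _.
have [y01 _] := ya; have [[w0 _] _ _] := weightP y01.
have := w0 s; rewrite le_eqVlt => /predU1P[<-|ws]; first by rewrite mul0r.
by rewrite mulr_ge0 // b_ge0 // (admissible_supported ya).
Qed.

Lemma cubical_inj y y' : admissible y -> admissible y' ->
  cubical P K y = cubical P K y' -> y =1 y'.
Proof.
move=> ya ya' e; have [y01 _] := ya; have [y01' _] := ya'.
have [cw w1 yE] := weightP y01; have [cw' w1' yE'] := weightP y01'.
have wE : weight y =1 weight y'.
  apply: (chain_unique (K := K) b_ge0 b_eq0) => //; try exact: admissible_supported.
    by rewrite w1.
  by move=> i; rewrite -!ell_cubical // e.
by move=> i; rewrite yE yE'; apply: eq_bigr => s _; rewrite wE.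
Qed.

(** The greedy decomposition runs in the cone over the polytope: [slope P i q + mu * offset P i] is
    [ell P i] made homogeneous. For [mu > 0] the point [mu^-1 *: q] lies in the polytope; for
    [mu = 0], [q] is a direction of recession, hence zero. *)
Lemma cubical_surj p : polytope P p -> exists2 y, admissible y & cubical P K y = p.
Proof.
move=> Pp.
pose C (f : I -> R) (mu : R) := [/\ 0 <= mu, forall i, 0 <= f i &
  exists q, forall i, f i = slope P i q + mu * offset P i].
have CZ f mu : C f mu -> 0 < mu -> exists q, polytope P q /\
    facets_at P q = [set i | f i == 0]%SET.
  move=> [_ f0 [q qE]] m0; exists (mu^-1 *: q).
  have E i : ell P i (mu^-1 *: q) = mu^-1 * f i.
    by rewrite ellE slopeZ qE mulrDr mulKf // gt_eqF.
  split; first by move=> i; rewrite E mulr_ge0 // invr_ge0 ltW.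
  by apply/setP => i; rewrite facets_atE E inE mulf_eq0 invr_eq0 gt_eqF.
have CK f mu : C f mu -> 0 < mu -> [set i | f i == 0]%SET \in K.
  by move=> Cf m0; have [q [Pq <-]] := CZ _ _ Cf m0; exact: facets_at_complex.
have [||||w [cw sw mw fw _]] := @chain_exists R I K b b_ge0 b_eq0 C _ _ CK _
    (fun i => ell P i p) 1.
- by move=> f mu [].
- move=> f [_ f0 [q qE]] i.
  have : q = 0.
    apply: (recession_cone0 (P := P) _ Pp); first by case: sP.
    by move=> k; have := f0 k; rewrite qE mul0r addr0.
  by move=> q0; rewrite qE q0 mul0r addr0 /slope big1 // => k _; rewrite mxE mulr0.
- move=> f mu t Cf m0 /andP[t0 tm] h; have [_ f0 [q qE]] := Cf.
  split=> //; first by rewrite subr_ge0.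
  exists (q - t *: bary P K [set i | f i == 0]%SET) => i.
  by rewrite slopeD slopeN slopeZ qE /b ellE; ring.
- by split=> //; exists p => i; rewrite ellE mul1r.
pose y i := \sum_s w s * (i \notin s)%:R.
have wE := weight_of_chain cw (esym mw) (fun i => erefl (y i)).
have [w0 _] := cw.
have y01 i : 0 <= y i <= 1.
  rewrite sumr_ge0 /=; last by move=> s _; rewrite mulr_ge0 // ler0n.
  by rewrite [leRHS]mw; apply: ler_sum => s _; rewrite ler_piMr // lern1 leq_b1.
have ya : admissible y.
  split=> //.
  have [s0 ws0] : exists s, 0 < w s.
    apply: contrapT => h; have : (1 : R) <= 0.
      by rewrite [leLHS]mw; apply: sumr_le0 => s _; rewrite leNgt; apply/negP => ?; apply: h; exists s.
    by rewrite ler10.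
  (* An index with [y i < 1] belongs to some set of the chain, hence to the largest one. *)
  have [s [ws _ smax]] := chain_max (Q := xpredT) cw ws0 isT.
  apply: (complex_sub dK (sw _ ws)); apply/fintype.subsetP => i; rewrite inE.
  apply: contraLR => is_; rewrite -leNgt [leLHS]mw; apply: ler_sum => r _.
  have := w0 r; rewrite le_eqVlt => /predU1P[<-|wr]; first by rewrite mul0r.
  rewrite (_ : i \notin r) ?mulr1 //.
  by apply: contra is_ => /(fintype.subsetP (smax _ wr isT)).
exists y => //; apply: (ell_inj sP) => i; rewrite ell_cubical // fw.
by apply: eq_bigr => s _; rewrite wE.
Qed.

End Cubical.

(** * Charts of the moment-angle quotient *)

Section ComplexVectors.
Context {R : realType}.

Definition cvec {m} (F : 'I_m -> R[i]) : 'rV[R]_(m + m) :=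
  row_mx (\row_k complex.Re (F k)) (\row_k complex.Im (F k)).

Definition cplx {m} (u : 'rV[R]_(m + m)) (k : 'I_m) : R[i] :=
  (u 0 (lshift m k) +i* u 0 (rshift m k))%C.

Lemma cvecK m (F : 'I_m -> R[i]) : cplx (cvec F) = F.
Proof.
apply/funext => k; rewrite /cplx /cvec row_mxEl row_mxEr !mxE.
by case: (F k).
Qed.

Lemma cplxK m : cancel (@cplx m) cvec.
Proof.
move=> u; apply/rowP => j; rewrite /cvec -(splitK j).
by case: (fintype.split j) => k; rewrite /= ?row_mxEl ?row_mxEr mxE.
Qed.

Lemma smooth_cvec (V : normedModType R) (O : set V) m (F : V -> 'I_m -> R[i]) :
  open O -> (forall k, csmooth O (fun v => F v k)) -> smooth_on O (fun v => cvec (F v)).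
Proof.
move=> oO h; apply: smooth_mx => // i j; rewrite -(splitK j).
case: (fintype.split j) => k /=; have [hr hi] := h k.
  by move: hr; apply: smooth_ext => // v _; rewrite row_mxEl mxE.
by move: hi; apply: smooth_ext => // v _; rewrite row_mxEr mxE.
Qed.

Lemma csmooth_cplx m (O : set 'rV[R]_(m + m)) k :
  open O -> csmooth O (fun u => cplx u k).
Proof. by move=> oO; split; exact: smooth_coord. Qed.

Definition decoords {I : finType} (v : 'rV[R]_(#|I| + #|I|)) : I -> R[i]^o :=
  fun i => cplx v (enum_rank i).

Lemma coordsE (I : finType) (z : I -> R[i]^o) : coords z = cvec (fun k => z (enum_val k)).
Proof. by []. Qed.

Lemma coordsK (I : finType) : cancel (@coords R I) decoords.
Proof.
by move=> z; apply/funext => i; rewrite /decoords coordsE cvecK enum_rankK.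
Qed.

Lemma smooth_coords (V : normedModType R) (O : set V) (I : finType) (F : V -> I -> R[i]) :
  open O -> (forall i, csmooth O (fun v => F v i)) -> smooth_on O (fun v => coords (F v)).
Proof. by move=> oO h; apply: (smooth_cvec (F := fun v k => F v (enum_val k))). Qed.

(* phase 0 = 0. *)
Definition phase (z : R[i]) : R[i] := z / (modulus z)%:C%C.

Lemma modulus_eq0 (z : R[i]) : (modulus z == 0) = (z == 0).
Proof.
apply/eqP/eqP => [|->]; first exact: ComplexField.Normc.eq0_normc.
exact: ComplexField.Normc.normc0.
Qed.

Lemma modulus_ge0 (z : R[i]) : 0 <= modulus z.
Proof. by case: z => a b /=; exact: sqrtr_ge0. Qed.

Lemma modulus_real (a : R) : 0 <= a -> modulus (a%:C%C) = a.
Proof. by move=> a0; rewrite /= expr0n addr0 sqrtr_sqr ger0_norm. Qed.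

Lemma phaseE (z : R[i]) : z = (modulus z)%:C%C * phase z.
Proof.
have [->|z0] := eqVneq z 0; first by rewrite /phase mul0r mulr0.
by rewrite /phase mulrC divfK // (inj_eq (@complexI R)) modulus_eq0.
Qed.

Lemma phase_unit (z : R[i]) : z != 0 -> modulus (phase z) = 1.
Proof.
move=> z0; rewrite /phase ComplexField.Normc.normcM ComplexField.Normc.normcV.
by rewrite modulus_real ?modulus_ge0 // divff // modulus_eq0.
Qed.

Lemma phaseM (t z : R[i]) : modulus t = 1 -> phase (t * z) = t * phase z.
Proof. by move=> t1; rewrite /phase ComplexField.Normc.normcM t1 mul1r mulrA. Qed.

Lemma phase_pos (a : R) : 0 < a -> phase a%:C%C = 1.
Proof.
move=> a0; rewrite /phase modulus_real ?ltW // divff //.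
by rewrite (inj_eq (@complexI R)) gt_eqF.
Qed.

Lemma modulusX (z : R[i]) (k : nat) : modulus (z ^+ k) = modulus z ^+ k.
Proof.
elim: k => [|k IH]; first exact: ComplexField.Normc.normc1.
by rewrite !exprS ComplexField.Normc.normcM IH.
Qed.

Lemma modulus_unitZ (z : R[i]) (k : int) : modulus z = 1 -> modulus (z ^ k) = 1.
Proof.
move=> z1; case: k => k; first by rewrite -exprnP modulusX z1 expr1n.
by rewrite NegzE -exprnN ComplexField.Normc.normcV modulusX z1 expr1n invr1.
Qed.

Lemma modulus_prod (J : Type) (r : seq J) (Q : pred J) (F : J -> R[i]) :
  (forall j, Q j -> modulus (F j) = 1) -> modulus (\prod_(j <- r | Q j) F j) = 1.
Proof.
move=> h; elim/big_ind: _ => //; first exact: ComplexField.Normc.normc1.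
by move=> a b a1 b1; rewrite ComplexField.Normc.normcM a1 b1 mulr1.
Qed.

Lemma modulus_sqr (z : R[i]) : modulus z ^+ 2 = complex.Re z ^+ 2 + complex.Im z ^+ 2.
Proof. by case: z => a b /=; rewrite sqr_sqrtr // addr_ge0 // sqr_ge0. Qed.

Lemma csmooth_phase (V : normedModType R) (O : set V) (f : V -> R[i]) :
  open O -> (forall x, O x -> f x != 0) -> csmooth O f ->
  csmooth O (fun x => phase (f x)).
Proof.
move=> oO n0 h.
have n0' x : O x -> (modulus (f x))%:C%C != 0 :> R[i].
  by move=> Ox; rewrite (inj_eq (@complexI R)) modulus_eq0 n0.
have hm := csmooth_real (csmooth_modulus oO n0 h).
exact: (csmoothM oO h (csmoothV oO n0' hm)).
Qed.

End ComplexVectors.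

Section QuotientClasses.
Context {R : realType} {n : nat} {D I : finType}.
Variables (P : halfspaces R n I) (lambda : D -> I -> int).

Lemma ma_classP (z w : set_type (moment_angle P)) :
  ma_class P lambda z = ma_class P lambda w <->
  exists2 t, ker_torus lambda t & val w = (fun i => t i * val z i).
Proof.
rewrite /ma_class; split=> [/eqmodP /asboolP //|h].
by apply/eqmodP/asboolP.
Qed.

Lemma ma_class_quotient_map : quotient_map (ma_class P lambda).
Proof. exact: quotient_map_pi. Qed.

End QuotientClasses.

(** * The slice of the kernel action at a vertex *)

Section VertexChart.
Context {R : realType} {n : nat} {D I : finType}.
Variables (P : halfspaces R n I) (lambda : D -> I -> int).
Hypothesis sP : simple_polytope P.
Variables (x : 'rV[R]_n) (e : 'I_n -> I).
Hypotheses (vx : vertex P x) (e_inj : injective e)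
  (fx : facets_at P x = [set e k | k : 'I_n]%SET).
Variable B : 'I_n -> D -> int.
Hypotheses (B1 : forall k l, \sum_d B k d * lambda d (e l) = (k == l)%:R)
  (B2 : forall d d', \sum_k lambda d (e k) * B k d' = (d == d')%:R).
Local Notation f := (facets_at P x).
Local Notation ma := (set_type (moment_angle P)).

(** Coordinates of column [i] of [lambda] in the basis of the columns at the vertex. *)
Definition transition (k : 'I_n) (i : I) : int := \sum_d B k d * lambda d i.

Lemma transition_vertex k l : transition k (e l) = (k == l)%:R.
Proof. exact: B1. Qed.

Lemma lambda_transition d i : \sum_k lambda d (e k) * transition k i = lambda d i.
Proof.
rewrite /transition; under eq_bigr do rewrite mulr_sumr.
rewrite exchange_big /=.
have E d' : \sum_k lambda d (e k) * (B k d' * lambda d' i) = (d == d')%:R * lambda d' i.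
  by rewrite -B2 mulr_suml; apply: eq_bigr => k _; rewrite mulrA.
under eq_bigr do rewrite E.
rewrite (bigD1 d) //= eqxx mul1r big1 ?addr0 // => d' /negbTE d'd.
by rewrite eq_sym d'd mul0r.
Qed.

Lemma vertex_facet k : e k \in f.
Proof. by rewrite fx; apply/imsetP; exists k. Qed.

Lemma prod_facets (F : I -> R[i]) : \prod_(i in f) F i = \prod_k F (e k).
Proof. by rewrite fx big_imset //= => k l _ _; exact: e_inj. Qed.

Lemma prod_exprz (J : Type) (r : seq J) (Q : pred J) (z : R[i]) (a : J -> int) :
  z != 0 -> \prod_(j <- r | Q j) z ^ a j = z ^ (\sum_(j <- r | Q j) a j).
Proof.
move=> z0; elim/big_rec2: _ => [|j c d _ ->]; first by rewrite expr0z.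
by rewrite expfzDr.
Qed.

Lemma exprz_prod (J : Type) (r : seq J) (Q : pred J) (F : J -> R[i]) (k : int) :
  (\prod_(j <- r | Q j) F j) ^ k = \prod_(j <- r | Q j) F j ^ k.
Proof.
elim/big_rec2: _ => [|j c d _ <-]; first by rewrite exp1rz.
by rewrite expfzMl.
Qed.

(** The equations of the kernel, raised to the powers [B k d] and multiplied over [d], become its
    equations in the basis at the vertex. *)
Lemma ker_transition t k : ker_torus lambda t -> \prod_i t i ^ transition k i = 1 :> R[i].
Proof.
move=> [t1 kt].
transitivity (\prod_i \prod_d (t i ^ lambda d i) ^ B k d : R[i]).
  apply: eq_bigr => i _; rewrite /transition.
  rewrite -(prod_exprz _ _ _ (modulus_neq0 (t1 i))).
  by apply: eq_bigr => d _; rewrite mulrC -exprz_exp.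
rewrite exchange_big /= big1 // => d _.
by rewrite -exprz_prod kt exp1rz.
Qed.

(* An element of the kernel multiplies z (e k) by t (e k), and the product by its
   inverse. *)
Definition chart_coord (k : 'I_n) (z : I -> R[i]) : R[i] :=
  z (e k) * \prod_(i | i \notin f) phase (z i) ^ transition k i.

Definition chart_map (z : I -> R[i]) : 'rV[R]_(n + n) := cvec (fun k => chart_coord k z).

Lemma chart_map_invariant t (z : I -> R[i]^o) : ker_torus lambda t ->
  chart_map (fun i => t i * z i) = chart_map z.
Proof.
move=> kt; have [t1 _] := kt; congr cvec; apply/funext => k; rewrite /chart_coord.
have := ker_transition k kt; rewrite (bigID (fun i => i \in f)) /= prod_facets.
rewrite (bigD1 k) //= transition_vertex eqxx expr1z big1 ?mulr1 => [h|l lk]; last first.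
  by rewrite transition_vertex eq_sym (negbTE lk) expr0z.
under eq_bigr do rewrite phaseM ?t1 // expfzMl.
by rewrite big_split /= mulrACA h mul1r.
Qed.

Definition off_facets (z : I -> R[i]) : Prop := forall i, i \notin f -> z i != 0.

Lemma modulus_chart_coord k z : off_facets z -> modulus (chart_coord k z) = modulus (z (e k)).
Proof.
move=> z0; rewrite /chart_coord ComplexField.Normc.normcM modulus_prod ?mulr1 //.
by move=> i /z0 zi; apply: modulus_unitZ; exact: phase_unit.
Qed.

(** The point at which each [ell P (e k)] is the squared modulus of the coordinate [k] of [u]; it
    may lie outside the polytope when [u] is not in [chart_image]. *)
Definition foot (u : 'rV[R]_(n + n)) : 'rV[R]_n :=
  x + \sum_k (complex.Re (cplx u k) ^+ 2 + complex.Im (cplx u k) ^+ 2) *: dual_basis P e k.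

Definition chart_image : set 'rV[R]_(n + n) :=
  [set u | forall i, i \notin f -> 0 < ell P i (foot u)].

(** The slice: positive real coordinates off the facets at the vertex, free ones on them. *)
Definition chart_section (u : 'rV[R]_(n + n)) (i : I) : R[i] :=
  if [pick k | e k == i] is Some k then cplx u k
  else (Num.sqrt (ell P i (foot u)))%:C%C.

Lemma chart_section_facet u k : chart_section u (e k) = cplx u k.
Proof.
rewrite /chart_section; case: pickP => [l /eqP /e_inj -> //|/(_ k)].
by rewrite eqxx.
Qed.

Lemma chart_section_off u i : i \notin f -> chart_section u i = (Num.sqrt (ell P i (foot u)))%:C%C.
Proof.
move=> nif; rewrite /chart_section; case: pickP => [k /eqP ek|//].
by move: nif; rewrite -ek vertex_facet.
Qed.

Lemma ell_foot u k : ell P (e k) (foot u) = modulus (cplx u k) ^+ 2.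
Proof. by rewrite (ell_vertex_coords vx fx) modulus_sqr. Qed.

Lemma foot_unique u p : (forall k, ell P (e k) p = modulus (cplx u k) ^+ 2) -> foot u = p.
Proof. by move=> h; apply: (ell_vertex_inj vx fx) => k; rewrite ell_foot h. Qed.

Lemma foot_polytope u : chart_image u -> polytope P (foot u).
Proof.
move=> uO i; have [|/uO /ltW //] := boolP (i \in f).
by rewrite fx => /imsetP[k _ ->]; rewrite ell_foot sqr_ge0.
Qed.

Lemma modulus_chart_section u i : chart_image u -> modulus (chart_section u i) ^+ 2 = ell P i (foot u).
Proof.
move=> uO; have [|nif] := boolP (i \in f).
  by rewrite fx => /imsetP[k _ ->]; rewrite chart_section_facet ell_foot.
by rewrite chart_section_off // modulus_real ?sqrtr_ge0 // sqr_sqrtr // foot_polytope.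
Qed.

Lemma chart_map_section u : chart_image u -> chart_map (chart_section u) = u.
Proof.
move=> uO; rewrite -[RHS]cplxK; congr cvec; apply/funext => k.
rewrite /chart_coord chart_section_facet big1 ?mulr1 // => i nif.
by rewrite chart_section_off // phase_pos ?exp1rz // sqrtr_gt0 uO.
Qed.

Lemma chart_section_off_facets u : chart_image u -> off_facets (chart_section u).
Proof.
move=> uO i nif; rewrite chart_section_off // (inj_eq (@complexI R)) gt_eqF // sqrtr_gt0.
exact: uO.
Qed.

Lemma foot_chart_map (z : I -> R[i]) p : off_facets z -> polytope P p ->
  (forall i, modulus (z i) ^+ 2 = ell P i p) -> foot (chart_map z) = p.
Proof.
move=> z0 Pp zp; apply: foot_unique => k.
by rewrite /chart_map cvecK modulus_chart_coord.
Qed.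

Lemma chart_map_image (z : ma) : off_facets (val z) -> chart_image (chart_map (val z)).
Proof.
move=> z0 i nif; have [p Pp zp] := set_valP z.
by rewrite (foot_chart_map z0 Pp zp) -zp exprn_gt0 // lt_neqAle eq_sym modulus_eq0 z0 // modulus_ge0.
Qed.

Lemma chart_section_map (z : ma) : off_facets (val z) ->
  exists2 t, ker_torus lambda t & val z = (fun i => t i * chart_section (chart_map (val z)) i).
Proof.
move=> z0; have [p Pp zp] := set_valP z.
have ph1 i : i \notin f -> modulus (phase (val z i)) = 1.
  by move=> nif; apply: phase_unit; exact: z0.
have ph0 i : i \notin f -> phase (val z i) != 0.
  by move=> nif; rewrite -modulus_eq0 ph1 // oner_eq0.
(* Off the facets [t] must be the phase of [z]; the kernel equations then leave [T k] as the only
   value at [e k]. *)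
pose T k := \prod_(i | i \notin f) phase (val z i) ^ (- transition k i).
pose t i : R[i]^o := if [pick k | e k == i] is Some k then T k else phase (val z i).
have tE k : t (e k) = T k.
  rewrite /t; case: pickP => [l /eqP /e_inj -> //|/(_ k)]; by rewrite eqxx.
have t_off i : i \notin f -> t i = phase (val z i).
  move=> nif; rewrite /t; case: pickP => [k /eqP ek|//].
  by move: nif; rewrite -ek vertex_facet.
have T1 k : modulus (T k) = 1.
  by apply: modulus_prod => i nif; apply: modulus_unitZ; exact: ph1.
exists t.
  split=> [i|d].
    have [|nif] := boolP (i \in f); last by rewrite t_off // ph1.
    by rewrite fx => /imsetP[k _ ->]; rewrite tE.
  rewrite (bigID (fun i => i \in f)) /= prod_facets.
  have -> : \prod_k t (e k) ^ lambda d (e k) =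
      \prod_(i | i \notin f) phase (val z i) ^ (- lambda d i) :> R[i].
    transitivity (\prod_k \prod_(i | i \notin f)
        phase (val z i) ^ (- transition k i * lambda d (e k)) : R[i]).
      apply: eq_bigr => k _; rewrite tE exprz_prod.
      by apply: eq_bigr => i _; rewrite exprz_exp.
    rewrite exchange_big /=; apply: eq_bigr => i nif.
    rewrite prod_exprz; last exact: ph0.
    congr (_ ^ _); rewrite -lambda_transition -sumrN; apply: eq_bigr => k _.
    by rewrite mulNr mulrC.
  rewrite -big_split /= big1 // => i nif.
  by rewrite t_off // -expfzDr ?ph0 // addNr expr0z.
apply/funext => i; have [|nif] := boolP (i \in f).
  rewrite fx => /imsetP[k _ ->]; rewrite tE chart_section_facet /chart_map cvecK /chart_coord.
  rewrite mulrCA -big_split /= big1 ?mulr1 // => j njf.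
  by rewrite -expfzDr ?ph0 // addNr expr0z.
rewrite t_off // chart_section_off // (foot_chart_map z0 Pp zp) -zp sqrtr_sqr.
by rewrite ger0_norm ?modulus_ge0 // mulrC -phaseE.
Qed.

End VertexChart.

Lemma open_forall (T : topologicalType) (I : finType) (Q : I -> set T) :
  (forall i, open (Q i)) -> open [set x | forall i, Q i x].
Proof.
move=> oQ; rewrite openE => x Qx; rewrite /interior.
apply: (@filter_forall _ _ Q (nbhs x) (nbhs_filter x)) => i.
exact: open_nbhs_nbhs.
Qed.

(** The Boolean premise matches conditions imposed only on the facets outside a given set. *)
Lemma open_positive (R : realType) (T : topologicalType) (f : T -> R) (b : bool) :
  continuous f -> open [set x | b -> 0 < f x].
Proof.
move=> cf; case: b.
  rewrite (_ : [set _ | _] = f @^-1` [set y | 0 < y]).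
    by apply: open_comp; [move=> y _; exact: cf|exact: open_gt].
  by apply/seteqP; split=> y /=; [exact|].
by rewrite (_ : [set _ | _] = setT); [exact: openT|apply/seteqP; split].
Qed.

(** * The slice as a chart of the quotient *)

Section VertexChartSmooth.
Context {R : realType} {n : nat} {D I : finType}.
Variables (P : halfspaces R n I) (lambda : D -> I -> int).
Hypothesis sP : simple_polytope P.
Variables (x : 'rV[R]_n) (e : 'I_n -> I).
Hypotheses (vx : vertex P x) (e_inj : injective e)
  (fx : facets_at P x = [set e k | k : 'I_n]%SET).
Variable B : 'I_n -> D -> int.
Hypotheses (B1 : forall k l, \sum_d B k d * lambda d (e l) = (k == l)%:R)
  (B2 : forall d d', \sum_k lambda d (e k) * B k d' = (d == d')%:R).
Local Notation f := (facets_at P x).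
Local Notation ma := (set_type (moment_angle P)).
Local Notation chart_map := (chart_map P lambda x e B).
Local Notation chart_section := (chart_section P x e).
Local Notation foot := (foot P x e).
Local Notation chart_image := (chart_image P x e).
Local Notation off_facets := (off_facets P x).
Local Notation cl := (ma_class P lambda).

(** A polynomial in the real coordinates of [u], hence smooth also where some complex coordinate
    vanishes. *)
Lemma smooth_ell_foot i : smooth_on setT (fun u => ell P i (foot u)).
Proof.
have oT := @openT 'rV[R]_(n + n).
have h k : smooth_on setT (fun u : 'rV[R]_(n + n) =>
    (complex.Re (cplx u k) ^+ 2 + complex.Im (cplx u k) ^+ 2) * slope P i (dual_basis P e k)).
  apply: (smoothM oT); last exact: smooth_cst.
  by apply: (csmooth_normsq oT); exact: csmooth_cplx.
have := smoothD oT (@smooth_cst R _ _ setT (ell P i x)) (smooth_sum oT (index_enum 'I_n) h).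
apply: (smooth_ext oT) => u _; rewrite /foot ellD slope_sum; congr (_ + _).
by apply: eq_bigr => k _; rewrite slopeZ.
Qed.

Lemma continuous_ell_foot i : continuous (fun u => ell P i (foot u)).
Proof. by move=> u; apply: (smooth_continuous (smooth_ell_foot i)). Qed.

Lemma open_chart_image : open chart_image.
Proof. by apply: open_forall => i; apply: open_positive; exact: continuous_ell_foot. Qed.

Lemma smooth_chart_section t : smooth_on chart_image (fun u => coords (fun i => t i * chart_section u i)).
Proof.
have oO := open_chart_image.
apply: (smooth_coords oO) => i.
apply: (csmoothM oO); first exact: csmooth_cst.
have [|nif] := boolP (i \in f).
  rewrite fx => /imsetP[k _ ->].
  apply: (csmooth_ext oO (f := fun u => cplx u k)) => [u _|]; last exact: csmooth_cplx.
  by rewrite chart_section_facet.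
apply: (csmooth_ext oO (f := fun u => (Num.sqrt (ell P i (foot u)))%:C%C)) => [u _|].
  by rewrite (chart_section_off fx).
apply: csmooth_real; apply: (smooth_sqrt oO); first by move=> u; exact.
by apply: smooth_sub (smooth_ell_foot i).
Qed.

Definition off_coords : set 'rV[R]_(#|I| + #|I|) := [set v | off_facets (decoords v)].

Lemma open_off_coords : open off_coords.
Proof.
have oT := @openT 'rV[R]_(#|I| + #|I|).
rewrite (_ : off_coords = [set v | forall i, i \notin f ->
    0 < complex.Re (decoords v i) ^+ 2 + complex.Im (decoords v i) ^+ 2]); last first.
  apply/seteqP; split=> v h i nif; first exact/normsq_gt0/h.
  apply/eqP => v0; have := h i nif; rewrite v0 /= expr0n addr0 ltxx //.
apply: open_forall => i; apply: open_positive => v.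
by apply: (smooth_continuous (csmooth_normsq oT (csmooth_cplx _ oT))).
Qed.

Lemma smooth_chart_map : smooth_on off_coords (fun v => chart_map (decoords v)).
Proof.
have oO := open_off_coords.
apply: (smooth_cvec oO) => k; apply: (csmoothM oO); first exact: csmooth_cplx.
apply: (csmooth_prod oO) => i nif.
have n0 v : off_coords v -> decoords v i != 0 by move=> h; exact: h.
apply: (csmooth_exprz oO).
  by move=> v /n0 vi; rewrite -modulus_eq0 phase_unit // oner_eq0.
by apply: (csmooth_phase oO) => //; exact: csmooth_cplx.
Qed.

(** Computed on the canonical representative; [vertex_chart1] and [vertex_chart2] show that every
    representative gives the same domain and coordinates. *)
Definition vertex_chart : chart R (ma_quotient P lambda) (n + n) :=
  (fun q => off_facets (val (repr q)), fun q => chart_map (val (repr q))).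

Lemma off_facetsM (t : I -> R[i]^o) (z : I -> R[i]^o) : torus t ->
  off_facets (fun i => t i * z i) <-> off_facets z.
Proof.
move=> t1; have E i : (t i * z i != 0) = (z i != 0).
  by rewrite mulf_eq0 negb_or (modulus_neq0 (t1 i)).
by split=> h i /h; rewrite E.
Qed.

Lemma class_repr (z : ma) : exists2 t, ker_torus lambda t &
  val (repr (cl z)) = (fun i => t i * val z i).
Proof. by apply/ma_classP; rewrite /ma_class reprK. Qed.

Lemma vertex_chart1 (z : ma) : vertex_chart.1 (cl z) <-> off_facets (val z).
Proof. by rewrite /=; have [t [t1 _] ->] := class_repr z; exact: off_facetsM. Qed.

Lemma vertex_chart2 (z : ma) : vertex_chart.2 (cl z) = chart_map (val z).
Proof. by rewrite /=; have [t kt ->] := class_repr z; exact: chart_map_invariant. Qed.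

Lemma moment_angleM t z : torus t -> moment_angle P z -> moment_angle P (fun i => t i * z i).
Proof.
move=> t1 [p Pp zp]; exists p => // i.
by rewrite ComplexField.Normc.normcM t1 mul1r.
Qed.

Lemma chart_section_moment_angle u : chart_image u -> moment_angle P (chart_section u).
Proof.
move=> uO; exists (foot u); first exact: (foot_polytope vx).
by move=> i; exact: modulus_chart_section.
Qed.

(* Outside chart_image the value is the junk default z. *)
Definition local_section (z : ma) (t : I -> R[i]^o) (u : 'rV[R]_(n + n)) : ma :=
  if pselect (moment_angle P (fun i => t i * chart_section u i)) is left h
  then SigSub (mem_set h) else z.

Lemma local_sectionE z t u : torus t -> chart_image u ->
  val (local_section z t u) = (fun i => t i * chart_section u i).
Proof.
move=> t1 uO; rewrite /local_section; case: pselect => // nh; exfalso; apply: nh.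
by apply: moment_angleM => //; exact: chart_section_moment_angle.
Qed.

Lemma local_section_chart z t u : ker_torus lambda t -> chart_image u ->
  vertex_chart.1 (cl (local_section z t u)) /\
  vertex_chart.2 (cl (local_section z t u)) = u.
Proof.
move=> kt uO; rewrite vertex_chart1 vertex_chart2 local_sectionE //; last by case: kt.
split; last by rewrite (chart_map_invariant e_inj fx B1 _ kt) chart_map_section.
by apply/off_facetsM; [case: kt|exact: chart_section_off_facets].
Qed.

Lemma vertex_chart_inj z z' : off_facets (val z) -> off_facets (val z') ->
  chart_map (val z) = chart_map (val z') -> cl z = cl z'.
Proof.
move=> z0 z0' zz'.
have [t kt zt] := chart_section_map vx e_inj fx B2 z0.
have [t' kt' zt'] := chart_section_map vx e_inj fx B2 z0'.
apply/ma_classP; exists (fun i => t' i * (t i)^-1).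
  exact: (ker_torusM kt' (ker_torusV kt)).
rewrite zt' zt zz'; apply/funext => i; rewrite mulrA mulfVK //.
by apply: modulus_neq0; case: kt.
Qed.

Lemma continuous_coords : continuous (@coords R I : Cspace R I -> _).
Proof.
move=> z; apply: continuous_mx => i j; rewrite -(splitK j).
have ce (k : 'I_#|I|) : {for z, continuous (fun w : Cspace R I => w (enum_val k))}.
  exact: continuous_eval.
case: (fintype.split j) => k.
  apply: (eq_continuous_at (f := fun w : Cspace R I => complex.Re (w (enum_val k)))).
    by move=> w; rewrite coordsE /= row_mxEl mxE.
  exact: (continuous_comp_at (fun w : Cspace R I => w (enum_val k)) (fun c : R[i]^o => complex.Re c) z (ce k) (@continuous_Re R _)).
apply: (eq_continuous_at (f := fun w : Cspace R I => complex.Im (w (enum_val k)))).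
  by move=> w; rewrite coordsE /= row_mxEr mxE.
exact: (continuous_comp_at (fun w : Cspace R I => w (enum_val k)) (fun c : R[i]^o => complex.Im c) z (ce k) (@continuous_Im R _)).
Qed.

Lemma continuous_coords_val (z : ma) : {for z, continuous (fun w : ma => coords (val w))}.
Proof.
apply: (@continuous_comp _ _ _ (val : ma -> Cspace R I) (@coords R I)).
  exact: val_continuous.
exact: continuous_coords.
Qed.

Lemma continuous_chart_map (z : ma) : off_facets (val z) ->
  {for z, continuous (fun w : ma => chart_map (val w))}.
Proof.
move=> z0.
apply: (eq_continuous_at (f := (fun v => chart_map (decoords v)) \o (fun w : ma => coords (val w)))).
  by move=> w /=; rewrite coordsK.
apply: continuous_comp; first exact: continuous_coords_val.
by apply: (smooth_continuous smooth_chart_map); rewrite /off_coords /= coordsK.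
Qed.

Lemma open_off_facets : open [set z : ma | off_facets (val z)].
Proof.
rewrite (_ : [set _ | _] = (fun w : ma => coords (val w)) @^-1` off_coords).
  by apply: open_comp; [move=> z _; exact: continuous_coords_val|exact: open_off_coords].
by apply/seteqP; split=> z; rewrite /off_coords /= coordsK.
Qed.

Lemma open_vertex_chart : open vertex_chart.1.
Proof.
have [_ _ hq] := ma_class_quotient_map P lambda; apply: hq.
rewrite (_ : _ @^-1` _ = [set z : ma | off_facets (val z)]); first exact: open_off_facets.
by apply/seteqP; split=> z /vertex_chart1.
Qed.

Lemma ker_one : ker_torus lambda (fun=> 1 : R[i]^o). Proof. exact: ker_torus1. Qed.

Lemma continuous_local_section z t u : torus t -> chart_image u ->
  {for u, continuous (local_section z t)}.
Proof.
move=> t1 uO; apply: continuous_val_at.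
apply: (@near_eq_continuous _ (Cspace R I) chart_image (fun v i => t i * chart_section v i) _ u
  open_chart_image uO); first by move=> v vO; rewrite /= local_sectionE.
apply: continuous_prod_at => i.
have c := smooth_continuous (smooth_chart_section t) uO.
have E (v : 'rV[R]_(n + n)) : decoords (coords (fun i => t i * chart_section v i)) i = t i * chart_section v i.
  by rewrite coordsK.
apply: continuous_complex.
  apply: (eq_continuous_at (f := fun v => coords (fun i => t i * chart_section v i) 0
     (lshift _ (enum_rank i)))) => [v|]; first by rewrite -E.
  exact: (@continuous_mx_coord R _ _ _ _ u 0 _ c).
apply: (eq_continuous_at (f := fun v => coords (fun i => t i * chart_section v i) 0
   (rshift _ (enum_rank i)))) => [v|]; first by rewrite -E.
exact: (@continuous_mx_coord R _ _ _ _ u 0 _ c).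
Qed.

Lemma vertex_chart_is_chart : is_chart vertex_chart.
Proof.
have surj := ma_class_surj (P := P) (lambda := lambda).
split.
- exact: open_vertex_chart.
- move=> q q' /set_mem qU /set_mem q'U.
  move: qU q'U; have [z <-] := surj q; have [z' <-] := surj q'.
  rewrite !vertex_chart1 !vertex_chart2 => *; exact: vertex_chart_inj.
- move=> q qU; apply: (quotient_map_continuous_at (ma_class_quotient_map P lambda)
    open_vertex_chart _ qU) => z /vertex_chart1 z0.
  apply: (eq_continuous_at (f := fun w : ma => chart_map (val w))).
    by move=> w; exact: (esym (vertex_chart2 w)).
  exact: continuous_chart_map.
- move=> V oV VU.
  (* The empty case is split off because [local_section] needs a default point. *)
  have [->|/set0P[q0 Vq0]] := eqVneq V set0; first by rewrite image_set0; exact: open0.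
  have [z0 _] := surj q0.
  (* On the open set [chart_image] the class of the section is a continuous inverse of the chart, so
     the image of [V] is a preimage and therefore open. *)
  have -> : vertex_chart.2 @` V =
      chart_image `&` (fun u => cl (local_section z0 (fun=> 1) u)) @^-1` V.
    apply/seteqP; split=> [u [q Vq <-]|u [uO Vu]]; last first.
      exists (cl (local_section z0 (fun=> 1) u)) => //.
      by case: (local_section_chart z0 ker_one uO).
    have qU := VU _ Vq; move: Vq qU; have [z <-] := surj q.
    move=> Vq /vertex_chart1 zU; rewrite vertex_chart2.
    have uO : chart_image (chart_map (val z)) by exact: chart_map_image.
    split=> //; rewrite /preimage /= (_ : cl _ = cl z) //.
    have [h1 h2] := local_section_chart z0 ker_one uO.
    by apply: vertex_chart_inj; [exact/vertex_chart1|exact: zU|rewrite -vertex_chart2].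
  rewrite openE => u [uO Vu]; apply: filterI.
    by apply: open_nbhs_nbhs; split=> //; exact: open_chart_image.
  have c : {for u, continuous (fun u => cl (local_section z0 (fun=> 1) u))}.
    apply: (@continuous_comp _ _ _ (local_section z0 (fun=> 1)) cl).
      by apply: continuous_local_section => //; case: ker_one.
    by have [c _ _] := ma_class_quotient_map P lambda; exact: c.
  by apply: c; exact: open_nbhs_nbhs.
Qed.

Lemma vertex_chart_atlas : ma_quotient_atlas P lambda vertex_chart.
Proof.
split; first exact: vertex_chart_is_chart.
- move=> z /vertex_chart1 zU; exists off_coords, (fun v => chart_map (decoords v)); split.
  + exact: open_off_coords.
  + by rewrite /off_coords /= coordsK.
  + exact: smooth_chart_map.
  + by move=> w _ _; rewrite vertex_chart2 coordsK.
- move=> z /vertex_chart1 zU.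
  have uO : chart_image (chart_map (val z)) by exact: chart_map_image.
  have [t kt zt] := chart_section_map vx e_inj fx B2 zU.
  have t1 : torus t by case: kt.
  (* The slice meets the orbit of [z]; translating it by [t] makes the section pass through [z]
     itself. *)
  exists chart_image, (local_section z t); rewrite vertex_chart2; split.
  + exact: open_chart_image.
  + exact: uO.
  + apply: (smooth_ext open_chart_image _ (smooth_chart_section t)) => u hu.
    by rewrite local_sectionE.
  + by apply: val_inj; rewrite local_sectionE // -zt.
  + by move=> u hu; exact: local_section_chart.
Qed.

End VertexChartSmooth.

(** * Toric manifolds *)

Section UnitComplex.
Context {R : realType}.

Lemma modulus_cis (t : R) : modulus (cis t) = 1.
Proof. by rewrite /cis /= cos2Dsin2 sqrtr1. Qed.

Lemma unit_cis (z : R[i]^o) : modulus z = 1 -> exists t, z = cis t.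
Proof.
case: z => a b /= h.
have ab : a ^+ 2 + b ^+ 2 = 1.
  by rewrite -[LHS]sqr_sqrtr ?h ?expr1n // addr_ge0 // sqr_ge0.
have a1 : -1 <= a <= 1.
  by rewrite -ler_norml -(@ler_pXn2r _ 2) ?nnegrE // expr1n real_normK ?num_real //
    -ab lerDl sqr_ge0.
have b2 : b ^+ 2 = 1 - a ^+ 2 by rewrite -ab addrC addKr.
have [b0|b0] := leP 0 b.
  exists (acos a); rewrite /cis acosK // sin_acos // -b2 sqrtr_sqr ger0_norm //.
exists (- acos a); rewrite /cis cosN sinN acosK // sin_acos // -b2 sqrtr_sqr.
by rewrite ltr0_norm // opprK.
Qed.

Lemma cis_sum (J : Type) (r : seq J) (Q : pred J) (F : J -> R) :
  cis (\sum_(j <- r | Q j) F j) = \prod_(j <- r | Q j) cis (F j) :> R[i].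
Proof.
elim/big_rec2: _ => [|j a b _ <-]; first exact: cis0.
by rewrite cisD.
Qed.

Lemma cis_exprz (t : R) (k : int) : cis (t * k%:~R) = cis t ^ k :> R[i].
Proof.
have N k' : cis (t * k'%:R) = cis t ^+ k' :> R[i].
  elim: k' => [|k' IH]; first by rewrite mulr0 expr0; exact: cis0.
  by rewrite -natr1 mulrDr mulr1 cisD IH exprSr.
case: k => k; first exact: N.
by rewrite NegzE mulrNz mulrN cisN N.
Qed.

Lemma cis_lambda (J : Type) (r : seq J) (Q : pred J) (t : J -> R) (k : J -> int) :
  cis (\sum_(j <- r | Q j) t j * (k j)%:~R) = \prod_(j <- r | Q j) cis (t j) ^ k j :> R[i].
Proof. by rewrite cis_sum; apply: eq_bigr => j _; exact: cis_exprz. Qed.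

Section Continuity.
Variable T : topologicalType.
Implicit Types (f g : T -> R[i]^o) (x : T).

Lemma continuous_mulc f g x : {for x, continuous f} -> {for x, continuous g} ->
  {for x, continuous (fun y => f y * g y : R[i]^o)}.
Proof. exact: continuousM. Qed.

Lemma continuous_exprzc f x (k : int) : f x != 0 -> {for x, continuous f} ->
  {for x, continuous (fun y => f y ^ k : R[i]^o)}.
Proof.
move=> fx0 cf.
have N k' : {for x, continuous (fun y => f y ^+ k' : R[i]^o)}.
  elim: k' => [|k' IH].
    by apply: (@eq_continuous_at T (R[i]^o) (fun=> 1)) => [y|]; [rewrite expr0|exact: cst_continuous].
  apply: (@eq_continuous_at T (R[i]^o) (fun y => f y * f y ^+ k')) => [y|]; first by rewrite exprS.
  exact: continuous_mulc.
case: k => k; first exact: N.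
have n0 : f x ^+ k.+1 != 0 by exact: expf_neq0.
exact: (@continuousV _ _ (fun y => f y ^+ k.+1) x n0 (N k.+1)).
Qed.

Lemma continuous_prodc (J : Type) (r : seq J) (F : J -> T -> R[i]^o) x :
  (forall j, {for x, continuous (F j)}) ->
  {for x, continuous (fun y => \prod_(j <- r) F j y : R[i]^o)}.
Proof.
move=> h; elim: r => [|j r IH].
  by apply: (@eq_continuous_at T (R[i]^o) (fun=> 1)) => [y|]; [rewrite big_nil|exact: cst_continuous].
apply: (@eq_continuous_at T (R[i]^o) (fun y => F j y * \prod_(i <- r) F i y)) => [y|].
  by rewrite big_cons.
by apply: continuous_mulc; [exact: h|exact: IH].
Qed.

Lemma continuous_realc (a : T -> R) x : {for x, continuous a} ->
  {for x, continuous (fun y => (a y)%:C%C : R[i]^o)}.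
Proof. by move=> ca; apply: continuous_complex => //; exact: continuous_cstr. Qed.

End Continuity.
End UnitComplex.

(** * Compactness and separation *)

Section CompactSpaces.
Context {R : realType} {n : nat} {I : finType} (P : halfspaces R n I).

Lemma continuous_ell i : continuous (ell P i).
Proof.
move=> x; apply: (@continuous_addr R _ (slope P i) (fun=> offset P i) x); last first.
  exact: continuous_cstr.
apply: continuous_sum => k _.
apply: (@continuous_mulr R _ (fun=> normal P i 0 k) (fun y : 'rV[R]_n => y 0 k) x).
  exact: continuous_cstr.
exact: coord_continuous.
Qed.

Lemma compact_polytope : bounded_set (polytope P) -> compact (polytope P).
Proof.
move=> bP; apply: bounded_closed_compact => //.
rewrite (_ : polytope P = \bigcap_(i : I) (ell P i @^-1` [set a | 0 <= a])).
  apply: closed_bigI => i _; apply: closed_comp => [x _|]; first exact: continuous_ell.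
  exact: closed_ge.
by apply/seteqP; split=> x h i; [move=> _; exact: h|exact: h].
Qed.

Lemma compact_torus (D : finType) : compact [set t : Cspace R D | torus t].
Proof. exact: (tychonoff (fun _ => compact_circle)). Qed.

Lemma compact_torus_polytope (D : finType) :
  bounded_set (polytope P) -> compact (@torus_polytope R n D I P).
Proof.
move=> bP; rewrite (_ : torus_polytope P =
  [set t : Cspace R D | torus t] `*` polytope P) //.
by apply: compact_setX; [exact: compact_torus|exact: compact_polytope].
Qed.

Lemma hausdorff_prod (X Y : topologicalType) :
  hausdorff_space X -> hausdorff_space Y -> hausdorff_space (X * Y)%type.
Proof.
move=> hX hY [p1 p2] [q1 q2] h; congr pair; [apply: hX|apply: hY] => U V Up Vq.
  have [z [Uz Vz]] := h (fst @^-1` U) (fst @^-1` V) (cvg_fst Up) (cvg_fst Vq).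
  by exists z.1.
have [z [Uz Vz]] := h (snd @^-1` U) (snd @^-1` V) (cvg_snd Up) (cvg_snd Vq).
by exists z.2.
Qed.

Lemma hausdorff_Cspace (D : finType) : hausdorff_space (Cspace R D).
Proof. by apply: hausdorff_product => d; exact: complex_hausdorff. Qed.

Lemma hausdorff_torus_polytope (D : finType) :
  hausdorff_space (set_type (@torus_polytope R n D I P)).
Proof.
apply: hausdorff_set_type; apply: hausdorff_prod; first exact: hausdorff_Cspace.
exact: norm_hausdorff.
Qed.

Lemma hausdorff_moment_angle : hausdorff_space (set_type (moment_angle P)).
Proof. by apply: hausdorff_set_type; exact: hausdorff_Cspace. Qed.

End CompactSpaces.

Lemma prod_set_support (F : fieldType) (I : finType) (A : {set I}) (f : I -> F) :
  (forall i, i \notin A -> f i = 1) -> \prod_i f i = \prod_(i in A) f i.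
Proof.
move=> h; rewrite (bigID (fun i => i \in A)) /= [X in _ * X]big1 ?mulr1 //.
Qed.

Lemma prod_div_exprz (F : fieldType) (I : finType) (x y t : I -> F) (k : I -> int) :
  \prod_i (x i / y i / t i) ^ k i =
  (\prod_i x i ^ k i) / (\prod_i y i ^ k i) / (\prod_i t i ^ k i).
Proof.
rewrite -!prodfV -!big_split /=; apply: eq_bigr => i _.
by rewrite !expfzMl !exprz_inv !invr_expz.
Qed.

Lemma prod_div_exprz1 (F : fieldType) (I : finType) (x y t : I -> F) (k : I -> int) :
  \prod_i t i ^ k i = 1 ->
  (\prod_i y i ^ k i)^-1 * \prod_i x i ^ k i = \prod_i (x i / y i / t i) ^ k i.
Proof. by move=> t1; rewrite prod_div_exprz t1 divr1 mulrC. Qed.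

Lemma divf_div (F : fieldType) (x y : F) : x != 0 -> y != 0 -> x / y / (y^-1 * x) = 1.
Proof. by move=> x0 y0; field; rewrite x0 y0. Qed.

Lemma continuous_pair_at (T U V : topologicalType) (f : T -> U) (g : T -> V) (x : T) :
  {for x, continuous f} -> {for x, continuous g} -> {for x, continuous (fun y => (f y, g y))}.
Proof.
by move=> cf cg; exact: (@cvg_pair _ _ _ (nbhs x) _ _ (nbhs_filter x)
  (nbhs_filter (f x)) (nbhs_filter (g x)) f g cf cg).
Qed.

(** * The two quotients of torus times polytope *)

Section Identification.
Context {R : realType} {n : nat} {D I : finType}.
Variables (P : halfspaces R n I) (lambda : D -> I -> int).
Hypothesis sP : simple_polytope P.
Local Notation ma := (set_type (moment_angle P)).
Local Notation TP := (set_type (@torus_polytope R n D I P)).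
Local Notation SP := (set_type (@torus_polytope R n I I P)).

(** The inverse is given entrywise and on both sides, as the rows are indexed by an arbitrary finite
    type [D]. *)
Definition unimodular : Prop :=
  forall x (e : 'I_n -> I), vertex P x -> injective e ->
    facets_at P x = [set e k | k : 'I_n]%SET ->
    exists B : 'I_n -> D -> int,
      (forall k l, \sum_d B k d * lambda d (e l) = (k == l)%:R) /\
      (forall d d', \sum_k lambda d (e k) * B k d' = (d == d')%:R).

Hypothesis uni : unimodular.

Lemma moment_angle_off_facets x (z : ma) p : polytope P p ->
  (forall i, modulus (val z i) ^+ 2 = ell P i p) ->
  off_facets P x (val z) <-> facets_at P p \subset facets_at P x.
Proof.
move=> Pp zp; have E i : (val z i == 0) = (i \in facets_at P p).
  by rewrite facets_atE -zp expf_eq0 /= modulus_eq0.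
split=> [h|/fintype.subsetP h i].
  by apply/fintype.subsetP => i; rewrite -E; apply: contraLR => /h.
by apply: contraNneq => /eqP; rewrite E => /h.
Qed.

Lemma ma_quotient_smooth_atlas : smooth_atlas (ma_quotient_atlas P lambda).
Proof.
split; [by move=> c []| |exact: ma_quotient_atlas_transition].
move=> q; have [z <-] := ma_class_surj q.
have [p Pp zp] := set_valP z.
have [x vx px] := polytope_vertex sP Pp.
have [e e_inj fx] := vertex_enum sP vx.
have [B [B1 B2]] := uni vx e_inj fx.
exists (vertex_chart P lambda x e B); first exact: vertex_chart_atlas.
by apply/vertex_chart1 => //; apply/(moment_angle_off_facets _ Pp zp).
Qed.

(* The product of the torus of all facets with the polytope covers both
   quotients. *)
Definition torus_image (s : I -> R[i]^o) : D -> R[i]^o :=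
  fun d => \prod_i s i ^ lambda d i.

Lemma torus_imageP s : torus s -> torus (torus_image s).
Proof. by move=> s1 d; apply: modulus_prod => i _; exact: modulus_unitZ. Qed.

Lemma toric_cover_subproof (a : SP) :
  @torus_polytope R n D I P (torus_image (val a).1, (val a).2).
Proof. by have [s1 Pp] := set_valP a; split=> //; exact: torus_imageP. Qed.

Definition toric_cover (a : SP) : TP := SigSub (mem_set (toric_cover_subproof a)).

Lemma ma_cover_subproof (a : SP) :
  moment_angle P (fun i => (Num.sqrt (ell P i (val a).2))%:C%C * (val a).1 i).
Proof.
have [s1 Pp] := set_valP a; exists (val a).2 => // i.
by rewrite ComplexField.Normc.normcM s1 mulr1 modulus_real ?sqrtr_ge0 // sqr_sqrtr.
Qed.

Definition ma_cover (a : SP) : ma := SigSub (mem_set (ma_cover_subproof a)).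

Lemma SP_exists (s : I -> R[i]^o) p : torus s -> polytope P p ->
  exists a : SP, val a = (s, p).
Proof.
move=> s1 Pp; have h : @torus_polytope R n I I P (s, p) by [].
by exists (SigSub (mem_set h)).
Qed.

Lemma continuous_torus_coord (a : SP) i : {for a, continuous (fun b : SP => (val b).1 i : R[i]^o)}.
Proof.
apply: (continuous_comp_at (fun b : SP => (val b).1) (fun s : Cspace R I => s i)); last first.
  exact: continuous_eval.
apply: (continuous_comp_at (fun b : SP => val b) fst); first exact: val_continuous.
exact: cvg_fst.
Qed.

Lemma continuous_polytope_coord (a : SP) : {for a, continuous (fun b : SP => (val b).2)}.
Proof.
apply: (continuous_comp_at (fun b : SP => val b) snd); first exact: val_continuous.
exact: cvg_snd.
Qed.

Lemma continuous_toric_cover : continuous toric_cover.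
Proof.
move=> a; apply: continuous_val_at.
have c1 : {for a, continuous (fun b : SP => torus_image (val b).1 : Cspace R D)}.
  apply: continuous_prod_at => d; apply: continuous_prodc => i.
  apply: continuous_exprzc; last exact: continuous_torus_coord.
  by apply: modulus_neq0; have [s1 _] := set_valP a; exact: s1.
exact: (@continuous_pair_at _ (Cspace R D) 'rV[R]_n (fun b : SP => torus_image (val b).1)
  (fun b : SP => (val b).2) a c1 (@continuous_polytope_coord a)).
Qed.

Lemma continuous_ma_cover : continuous ma_cover.
Proof.
move=> a; apply: continuous_val_at; apply: continuous_prod_at => i.
apply: continuous_mulc; last exact: continuous_torus_coord.
apply: continuous_realc; apply: continuous_sqrtr.
apply: (continuous_comp_at (fun b : SP => (val b).2) (ell P i)).
  exact: continuous_polytope_coord.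
exact: continuous_ell.
Qed.

Lemma vertex_lift x (e : 'I_n -> I) (sigma : 'I_n -> R[i]^o) :
  injective e -> facets_at P x = [set e k | k : 'I_n]%SET ->
  (forall k, modulus (sigma k) = 1) ->
  exists s : I -> R[i]^o, [/\ torus s, forall k, s (e k) = sigma k,
    forall i, i \notin facets_at P x -> s i = 1 &
    forall d, torus_image s d = \prod_k sigma k ^ lambda d (e k)].
Proof.
move=> e_inj fx s1.
pose s i : R[i]^o := if [pick k | e k == i] is Some k then sigma k else 1.
have sE k : s (e k) = sigma k.
  by rewrite /s; case: pickP => [l /eqP /e_inj -> //|/(_ k)]; rewrite eqxx.
have s_off i : i \notin facets_at P x -> s i = 1.
  rewrite /s; case: pickP => [k /eqP <-|//]; by rewrite (vertex_facet fx).
exists s; split=> //.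
  move=> i; rewrite /s; case: pickP => [k _|_]; first exact: s1.
  exact: ComplexField.Normc.normc1.
move=> d; rewrite /torus_image (bigID (fun i => i \in facets_at P x)) /=.
rewrite (prod_facets e_inj fx) [X in _ * X]big1 ?mulr1; last first.
  by move=> i /s_off ->; rewrite exp1rz.
by apply: eq_bigr => k _; rewrite sE.
Qed.

(** Since the inverse [B] has integer entries, [sigma k] can be taken to be a monomial in [t]. *)
Lemma vertex_torus (e : 'I_n -> I) B (t : D -> R[i]^o) : torus t ->
  (forall d d', \sum_k lambda d (e k) * B k d' = (d == d')%:R) ->
  exists2 sigma : 'I_n -> R[i]^o, forall k, modulus (sigma k) = 1 &
    forall d, t d = \prod_k sigma k ^ lambda d (e k).
Proof.
move=> t1 B2; exists (fun k => \prod_d t d ^ B k d) => [k|d].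
  by apply: modulus_prod => d _; exact: modulus_unitZ.
transitivity (\prod_k \prod_d' t d' ^ (lambda d (e k) * B k d') : R[i]); last first.
  apply: eq_bigr => k _; rewrite exprz_prod; apply: eq_bigr => d' _.
  by rewrite exprz_exp mulrC.
have E d' : \prod_k t d' ^ (lambda d (e k) * B k d') = t d' ^ (d == d')%:R.
  by rewrite prod_exprz ?B2 //; exact: modulus_neq0.
rewrite exchange_big; under eq_bigr do rewrite E.
rewrite (bigD1 d) //= eqxx expr1z.
have -> : \prod_(i | i != d) t i ^ (d == i)%:R = 1 :> R[i].
  by apply: big1 => d' /negbTE dd'; rewrite eq_sym dd' expr0z.
exact: esym (mulr1 _).
Qed.

(** One vertex suffices, whatever the point of the polytope: the circles of its [n] facets generate
    the whole torus. *)
Lemma toric_cover_surj b : exists a, toric_cover a = b.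
Proof.
have [t1 Pp] := set_valP b.
have [p0 Pp0] := polytope_nonempty sP.
have [x vx _] := polytope_vertex sP Pp0.
have [e e_inj fx] := vertex_enum sP vx.
have [B [_ B2]] := uni vx e_inj fx.
have [sigma sig1 tE] := vertex_torus t1 B2.
have [s [s1 _ _ sE]] := vertex_lift e_inj fx sig1.
have [a aE] := SP_exists s1 Pp; exists a; apply: val_inj; rewrite /= aE /=.
by rewrite [RHS]surjective_pairing; congr pair; apply/funext => d; rewrite sE -tE.
Qed.

Lemma ma_cover_surj z : exists a, ma_cover a = z.
Proof.
have [p Pp zp] := set_valP z.
(* Where a coordinate of [z] vanishes the phase is arbitrary, and 1 is taken. *)
pose s i : R[i]^o := if val z i == 0 then 1 else phase (val z i).
have s1 : torus s.
  move=> i; rewrite /s; case: eqVneq => [_|]; first exact: ComplexField.Normc.normc1.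
  exact: phase_unit.
have [a aE] := SP_exists s1 Pp; exists a; apply: val_inj; apply/funext => i.
rewrite /= aE /= -zp sqrtr_sqr ger0_norm ?modulus_ge0 // /s.
case: eqVneq => [z0|_]; last by rewrite -phaseE.
by rewrite z0 ComplexField.Normc.normc0 mul0r; exact: esym z0.
Qed.

Lemma toric_classP (b c : TP) : toric_class P lambda b = toric_class P lambda c <->
  (val b).2 = (val c).2 /\ subtorus lambda (facets_at P (val b).2)
    (fun d => ((val b).1 d)^-1 * (val c).1 d).
Proof.
rewrite /toric_class; split=> [/eqmodP /asboolP //|h].
by apply/eqmodP/asboolP.
Qed.

(** Both relations amount to [p = p'] and [s' = s t c] with [t] in the kernel and [c] supported on
    the facets through [p]: [torus_image] does not see [t], and the vanishing coordinates of
    [ma_cover] do not see [c]. *)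
Lemma cover_equiv (a a' : SP) :
  toric_class P lambda (toric_cover a) = toric_class P lambda (toric_cover a') <->
  ma_class P lambda (ma_cover a) = ma_class P lambda (ma_cover a').
Proof.
rewrite toric_classP ma_classP; move: (set_valP a) (set_valP a') => /=.
move: (sval a) (sval a') => [s p] [s' p'] /= [s1 Pp] [s1' Pp'].
have s0 i : s i != 0 by exact: modulus_neq0.
have s0' i : s' i != 0 by exact: modulus_neq0.
have im0 d : torus_image s d != 0 by apply: modulus_neq0; exact: torus_imageP.
split.
- move=> [pp' [th thE]]; subst p'.
  (* A lift of the given element of the subtorus to the torus of all facets. *)
  pose c i : R[i]^o := if i \in facets_at P p then cis (th i) else 1.
  have c0 i : c i != 0.
    rewrite /c; case: ifP => _; last exact: oner_neq0.
    by apply: modulus_neq0; exact: modulus_cis.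
  have c1 i : modulus (c i) = 1.
    rewrite /c; case: ifP => _; first exact: modulus_cis.
    exact: ComplexField.Normc.normc1.
  exists (fun i => s' i * (s i)^-1 * (c i)^-1).
    split=> [i|d].
      by rewrite !ComplexField.Normc.normcM !ComplexField.Normc.normcV s1 s1' c1 !(invr1, mulr1).
    have -> : \prod_i (s' i / s i / c i) ^ lambda d i =
        torus_image s' d / torus_image s d / \prod_i c i ^ lambda d i by exact: prod_div_exprz.
    have -> : \prod_i c i ^ lambda d i = (torus_image s d)^-1 * torus_image s' d.
      rewrite thE cis_lambda.
      transitivity (\prod_(i in facets_at P p) c i ^ lambda d i).
        apply: (@prod_set_support R[i] _ _ (fun i => c i ^ lambda d i)) => i nif.
        by rewrite /c (negbTE nif) exp1rz.
      by apply: eq_bigr => i fi; rewrite /c fi.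
    by apply: divf_div => //; apply: modulus_neq0; exact: torus_imageP.
  apply/funext => i; rewrite /c; case: ifPn => [|_].
    by rewrite facets_atE => /eqP ->; rewrite sqrtr0 !mul0r mulr0.
  by rewrite invr1 mulr1 mulrCA mulfVK.
- move=> [t [t1 kt] E].
  (* The squared moduli recover all values [ell P i p], which determine the point. *)
  have pp' : p = p'.
    apply: (ell_inj sP) => i; have /(congr1 (fun z : I -> R[i]^o => modulus (z i) ^+ 2)) := E.
    rewrite !ComplexField.Normc.normcM s1 s1' t1 !mulr1 mul1r.
    by rewrite !modulus_real ?sqrtr_ge0 // !sqr_sqrtr.
  subst p'; split=> //.
  have h i : exists th, s' i * (s i)^-1 * (t i)^-1 = cis th.
    apply: unit_cis.
    by rewrite !ComplexField.Normc.normcM !ComplexField.Normc.normcV s1 s1' t1 !(invr1, mulr1).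
  have [th thE] := choice h.
  exists th => d; rewrite cis_lambda.
  have tf i : i \notin facets_at P p -> s' i * (s i)^-1 * (t i)^-1 = 1.
    rewrite facets_atE => pi0; have /(congr1 (fun z : I -> R[i]^o => z i)) := E.
    rewrite mulrCA => /mulfI ->; last by rewrite (inj_eq (@complexI R)) sqrtr_eq0 -ltNge lt_neqAle eq_sym pi0 Pp.
    by rewrite mulfK ?s0 // mulfV //; exact: modulus_neq0.
  have -> : (torus_image s d)^-1 * torus_image s' d =
      \prod_i (s' i / s i / t i) ^ lambda d i.
    exact: (prod_div_exprz1 _ _ (kt d)).
  transitivity (\prod_i cis (th i) ^ lambda d i : R[i]).
    by apply: eq_bigr => i _; rewrite thE.
  apply: (@prod_set_support R[i] _ _ (fun i => cis (th i) ^ lambda d i)) => i nif.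
  by rewrite -thE tf // exp1rz.
Qed.

End Identification.

(** * Charts of the toric manifold *)

Section ToricAtlas.
Context {R : realType} {n : nat} {D I : finType}.
Variables (P : halfspaces R n I) (lambda : D -> I -> int).
Hypotheses (sP : simple_polytope P) (uni : unimodular P lambda).

Lemma toric_class_quotient_map : quotient_map (toric_class P lambda).
Proof. exact: quotient_map_pi. Qed.

Lemma toric_ma_homeo : exists (F : toric P lambda -> ma_quotient P lambda)
    (Fi : ma_quotient P lambda -> toric P lambda),
  [/\ continuous F, continuous Fi, cancel F Fi, cancel Fi F &
    forall a, F (toric_class P lambda (toric_cover lambda a)) =
      ma_class P lambda (ma_cover a)].
Proof.
have bP : bounded_set (polytope P) by case: sP.
have cS : compact [set: set_type (@torus_polytope R n I I P)].
  by apply: compact_set_type; exact: compact_torus_polytope.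
have q1 : quotient_map (toric_class P lambda \o @toric_cover R n D I P lambda).
  apply: quotient_map_comp; last exact: toric_class_quotient_map.
  apply: compact_quotient_map cS _ _ _.
  - exact: hausdorff_torus_polytope.
  - exact: continuous_toric_cover.
  - exact: toric_cover_surj.
have q2 : quotient_map (ma_class P lambda \o @ma_cover R n I P).
  apply: quotient_map_comp; last exact: ma_class_quotient_map.
  apply: compact_quotient_map cS _ _ _.
  - exact: hausdorff_moment_angle.
  - exact: continuous_ma_cover.
  - exact: ma_cover_surj.
have [a a'|F [Fi [cF cFi FK FiK FE]]] := quotient_map_homeo q1 q2.
  exact: cover_equiv.
by exists F, Fi.
Qed.

Section Charts.
Variables (F : toric P lambda -> ma_quotient P lambda).
Hypothesis FE : forall a, F (toric_class P lambda (toric_cover lambda a)) =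
  ma_class P lambda (ma_cover a).
Variables (x : 'rV[R]_n) (e : 'I_n -> I) (B : 'I_n -> D -> int).
Hypotheses (vx : vertex P x) (e_inj : injective e)
  (fx : facets_at P x = [set e k | k : 'I_n]%SET).
Hypotheses (B1 : forall k l, \sum_d B k d * lambda d (e l) = (k == l)%:R)
  (B2 : forall d d', \sum_k lambda d (e k) * B k d' = (d == d')%:R).

Lemma vertex_chart1_toric b : (vertex_chart P lambda x e B).1 (F (toric_class P lambda b)) <->
  facets_at P (val b).2 \subset facets_at P x.
Proof.
have [a <-] := toric_cover_surj sP uni b; rewrite FE vertex_chart1.
have [s1 Pp] := set_valP a; apply: moment_angle_off_facets => // i.
by rewrite ComplexField.Normc.normcM s1 mulr1 modulus_real ?sqrtr_ge0 // sqr_sqrtr.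
Qed.

Lemma vertex_chart2_toric (theta : 'I_n -> R) b :
  facets_at P (val b).2 \subset facets_at P x ->
  (forall d, (val b).1 d = cis (\sum_k theta k * (lambda d (e k))%:~R)) ->
  (vertex_chart P lambda x e B).2 (F (toric_class P lambda b)) =
    row_mx (\row_k (Num.sqrt (ell P (e k) (val b).2) * cos (theta k)))
           (\row_k (Num.sqrt (ell P (e k) (val b).2) * sin (theta k))).
Proof.
move=> bx bE; have [_ Pp] := set_valP b.
(* This lift is 1 off the facets at [x], so the product in [chart_coord] is trivial. *)
have [s [s1 se s_off sE]] := vertex_lift lambda e_inj fx (fun k => modulus_cis (theta k)).
have [a aE] := SP_exists s1 Pp.
have <- : toric_cover lambda a = b.
  apply: val_inj; rewrite /= aE /= [RHS]surjective_pairing; congr pair.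
  by apply/funext => d; rewrite sE bE cis_lambda.
rewrite FE vertex_chart2 // /chart_map.
have -> : (val (toric_cover lambda a)).2 = (val b).2 by rewrite /= aE.
have E k : chart_coord P lambda x e B k (val (ma_cover a)) =
    (Num.sqrt (ell P (e k) (val b).2))%:C%C * cis (theta k).
  rewrite /chart_coord /= aE /= se big1 ?mulr1 // => i nif.
  rewrite s_off // mulr1 phase_pos ?exp1rz // sqrtr_gt0 lt_neqAle Pp andbT eq_sym.
  by rewrite -facets_atE; apply: contra nif; exact: (fintype.subsetP bx).
rewrite /cvec; congr row_mx; apply/rowP => k; rewrite !mxE E /=.
  by rewrite mul0r subr0.
by rewrite mul0r addr0.
Qed.

End Charts.

Lemma toric_atlas_pulled_back F :
  (forall a, F (toric_class P lambda (toric_cover lambda a)) = ma_class P lambda (ma_cover a)) ->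
  forall c, toric_atlas P lambda c ->
  exists2 c0, ma_quotient_atlas P lambda c0 & pulled_back F c c0.
Proof.
move=> FE c [x [e [vx e_inj fx c1 c2]]].
have [B [B1 B2]] := uni vx e_inj fx.
have [_ surj _] := toric_class_quotient_map.
exists (vertex_chart P lambda x e B); first exact: vertex_chart_atlas.
split=> q; have [b <-] := surj q; first by rewrite c1 (vertex_chart1_toric FE x e B).
move=> cb; have [t1 _] := set_valP b.
(* [toric_atlas] prescribes coordinates through angles; such angles exist for every point of the
   torus. *)
have [sigma sig1 tE] := vertex_torus t1 B2.
have [theta thE] := choice (fun k => unit_cis (sig1 k)).
have bE d : (val b).1 d = cis (\sum_k theta k * (lambda d (e k))%:~R).
  by rewrite tE cis_lambda; apply: eq_bigr => k _; rewrite thE.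
by rewrite (c2 theta) // (vertex_chart2_toric FE e_inj fx B1 _ bE) //; apply/c1.
Qed.

(** [toric_atlas] describes its charts by their values on representatives; that such charts exist is
    seen by pulling back the vertex charts along [F]. *)
Lemma toric_atlas_cover F :
  (forall a, F (toric_class P lambda (toric_cover lambda a)) = ma_class P lambda (ma_cover a)) ->
  forall q, exists2 c, toric_atlas P lambda c & c.1 q.
Proof.
move=> FE q; have [_ surj _] := toric_class_quotient_map.
have [b bq] := surj q; have [_ Pp] := set_valP b.
have [x vx px] := polytope_vertex sP Pp.
have [e e_inj fx] := vertex_enum sP vx.
have [B [B1 B2]] := uni vx e_inj fx.
pose v := vertex_chart P lambda x e B.
exists (F @^-1` v.1, v.2 \o F); last first.
  by rewrite /= -bq; apply/(vertex_chart1_toric FE x e B).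
exists x, e; split=> //= [a|theta a].
  exact: (vertex_chart1_toric FE x e B).
move=> /(vertex_chart1_toric FE x e B) ax aE.
exact: (vertex_chart2_toric FE e_inj fx B1 ax aE).
Qed.

End ToricAtlas.

(** * Polyhedral products *)

Lemma complex_scaleA (R : realType) (a b : R) (z : R[i]) :
  a%:C%C * (b%:C%C * z) = (a * b)%:C%C * z.
Proof. by rewrite mulrA -rmorphM. Qed.

(** * The radial homeomorphism *)

Section Radial.
Context {R : realType} {j : nat}.
Implicit Types (z y : 'I_j -> R[i]^o).

Lemma maxnorm_ge0 z : 0 <= maxnorm z. Proof. exact: bigmax_ge_id. Qed.

Lemma maxnorm_ge z t : modulus (z t) <= maxnorm z.
Proof. exact: (le_bigmax _ (fun t => modulus (z t)) t). Qed.

Lemma l2norm_ge0 z : 0 <= l2norm z. Proof. exact: sqrtr_ge0. Qed.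

Lemma l2norm_scale (c : R) z : 0 <= c -> l2norm (fun t => c%:C%C * z t) = c * l2norm z.
Proof.
move=> c0; rewrite /l2norm.
under eq_bigr do rewrite ComplexField.Normc.normcM modulus_real // exprMn.
by rewrite -mulr_sumr sqrtrM ?sqr_ge0 // sqrtr_sqr ger0_norm.
Qed.

Lemma maxnorm_scale (c : R) z : 0 <= c -> maxnorm (fun t => c%:C%C * z t) = c * maxnorm z.
Proof.
move=> c0; rewrite /maxnorm.
under eq_bigr do rewrite ComplexField.Normc.normcM modulus_real //.
by elim/big_rec2: _ => [|t a b _ ->]; rewrite ?mulr0 // maxr_pMr.
Qed.

Lemma l2norm_eq0 z : (l2norm z == 0) = [forall t, z t == 0].
Proof.
rewrite sqrtr_eq0; apply/idP/forallP => [h t|h].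
  have : \sum_t modulus (z t) ^+ 2 == 0.
    by rewrite eq_le h sumr_ge0 // => t' _; exact: sqr_ge0.
  rewrite psumr_eq0 => [/allP /(_ _ (mem_index_enum t))|t' _]; last exact: sqr_ge0.
  by rewrite expf_eq0 /= modulus_eq0.
rewrite big1 // => t _; have /eqP -> := h t.
by rewrite ComplexField.Normc.normc0 expr0n.
Qed.

Lemma maxnorm_eq0 z : (maxnorm z == 0) = [forall t, z t == 0].
Proof.
apply/idP/forallP => [/eqP h t|h].
  by rewrite -modulus_eq0 eq_le modulus_ge0 andbT -h maxnorm_ge.
rewrite eq_le maxnorm_ge0 andbT; apply: bigmax_le => // t _.
by have /eqP -> := h t; rewrite ComplexField.Normc.normc0.
Qed.

Lemma maxnorm_l2norm0 z : (maxnorm z == 0) = (l2norm z == 0).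
Proof. by rewrite maxnorm_eq0 l2norm_eq0. Qed.

(** This is what carries the polydisc and its boundary to the ball and the sphere. At [z = 0] the
    factor is 0 / 0 = 0, and both norms vanish. *)
Lemma l2norm_radial z : l2norm (radial z) = maxnorm z.
Proof.
rewrite /radial l2norm_scale ?divr_ge0 ?maxnorm_ge0 ?l2norm_ge0 //.
have [l0|l0] := eqVneq (l2norm z) 0; last by rewrite divfK.
by rewrite l0 mulr0; apply/esym/eqP; rewrite maxnorm_l2norm0 l0.
Qed.

(* For y = 0 the factor is 0 / 0 = 0. *)
Definition unradial y : 'I_j -> R[i]^o := fun t => (l2norm y / maxnorm y)%:C%C * y t.

Lemma maxnorm_unradial y : maxnorm (unradial y) = l2norm y.
Proof.
rewrite /unradial maxnorm_scale ?divr_ge0 ?maxnorm_ge0 ?l2norm_ge0 //.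
have [l0|l0] := eqVneq (maxnorm y) 0; last by rewrite divfK.
by rewrite l0 mulr0; apply/esym/eqP; rewrite -maxnorm_l2norm0 l0.
Qed.

Lemma unradialK : cancel unradial radial.
Proof.
move=> y; apply/funext => t; rewrite /radial maxnorm_unradial.
have [m0|m0] := eqVneq (maxnorm y) 0.
  have l0 : l2norm y = 0 by apply/eqP; rewrite -maxnorm_l2norm0 m0.
  by rewrite l0 mul0r mul0r; move/eqP: m0; rewrite maxnorm_eq0 => /forallP/(_ t) /eqP ->.
have l0 : l2norm y != 0 by rewrite -maxnorm_l2norm0.
rewrite [l2norm (unradial _)]l2norm_scale ?divr_ge0 ?maxnorm_ge0 ?l2norm_ge0 //.
rewrite complex_scaleA [X in X%:C%C](_ : _ = 1) ?mul1r //.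
by field; rewrite m0 l0.
Qed.

Lemma radialK : cancel radial unradial.
Proof.
move=> z; apply/funext => t; rewrite /unradial l2norm_radial.
have [m0|m0] := eqVneq (maxnorm z) 0.
  by rewrite m0 mul0r mul0r; move/eqP: m0; rewrite maxnorm_eq0 => /forallP/(_ t) /eqP ->.
have l0 : l2norm z != 0 by rewrite -maxnorm_l2norm0.
rewrite [maxnorm (radial _)]maxnorm_scale ?divr_ge0 ?maxnorm_ge0 ?l2norm_ge0 //.
rewrite complex_scaleA [X in X%:C%C](_ : _ = 1) ?mul1r //.
by field; rewrite m0 l0.
Qed.

Lemma modulus_radial_le z t : modulus (radial z t) <= maxnorm z.
Proof.
rewrite -l2norm_radial /l2norm -[leLHS]ger0_norm ?modulus_ge0 // -sqrtr_sqr.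
by rewrite ler_wsqrtr // (bigD1 t) //= lerDl sumr_ge0 // => t' _; exact: sqr_ge0.
Qed.

End Radial.

Section ContinuousRadial.
Context {R : realType}.

(** Serves where [f] vanishes and its formula divides by zero: at the origin for [radial], at zero
    coordinates for [to_moment_angle]. *)
Lemma continuous_squeeze (T : topologicalType) (f : T -> R[i]^o) (g : T -> R) (x : T) :
  (forall y, modulus (f y) <= g y) -> g x = 0 -> {for x, continuous g} ->
  {for x, continuous f}.
Proof.
move=> fg g0 cg.
have fx0 : f x = 0.
  by apply/eqP; rewrite -modulus_eq0 eq_le modulus_ge0 andbT -g0 fg.
have sq (h : R[i] -> R) : (forall w, `|h w| <= modulus w) -> h 0 = 0 ->
    {for x, continuous (fun y => h (f y))}.
  move=> hle h0; suff : h (f y) @[y --> x] --> h (f x) by [].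
  rewrite fx0 h0; apply/(@cvgr0Pnorm_lt _ _ _ (nbhs x) (nbhs_filter x)) => e e0.
  have : \forall y \near x, `|g x - g y| < e.
    exact: (((@cvgrPdist_lt _ _ _ (nbhs x) (nbhs_filter x) g (g x)).1 cg) e e0).
  apply: filterS => y; rewrite g0 sub0r normrN => h1.
  by apply: le_lt_trans h1; rewrite (le_trans (hle _)) // (le_trans (fg y)) // ler_norm.
by apply: continuous_complex; apply: sq => //; [exact: Re_le_modulus|exact: Im_le_modulus].
Qed.

Lemma continuous_modulus_at (T : topologicalType) (f : T -> R[i]^o) (x : T) :
  {for x, continuous f} -> {for x, continuous (fun y => modulus (f y))}.
Proof.
move=> cf; apply: (continuous_comp_at f (fun z : R[i]^o => modulus z)) => //.
exact: continuous_modulus.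
Qed.

Lemma continuous_radial (T : topologicalType) (j : nat) (f : T -> 'I_j -> R[i]^o) (x : T) t :
  (forall t, {for x, continuous (fun y => f y t)}) ->
  {for x, continuous (fun y => radial (f y) t)}.
Proof.
move=> cf.
have cm t' := @continuous_modulus_at T (fun y => f y t') x (cf t').
have cmax : {for x, continuous (fun y => maxnorm (f y))}.
  exact: (@continuous_bigmaxr R T _ _ _ (fun t' y => modulus (f y t')) 0 x cm).
have [m0|m0] := eqVneq (maxnorm (f x)) 0.
  by apply: (continuous_squeeze _ m0 cmax) => y; exact: modulus_radial_le.
apply: continuous_mulc; last exact: cf.
apply: continuous_realc; apply: continuous_mulr => //; apply: continuous_invr.
  by rewrite -maxnorm_l2norm0.
apply: continuous_sqrtr; apply: continuous_sum => t' _.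
apply: (eq_continuous_at (f := fun y => modulus (f y t') * modulus (f y t'))).
  by move=> y; rewrite expr2.
by apply: continuous_mulr; exact: cm.
Qed.

End ContinuousRadial.

(** * From discs and circles to the moment-angle manifold *)

Section MomentAngleComplex.
Context {R : realType} {n : nat} {I : finType} (P : halfspaces R n I).
Variable K : {set {set I}}.
Hypotheses (sP : simple_polytope P) (dK : dual_complex P K).

Definition ma_complex : set (Cspace R I) :=
  polyhedral_product K (fun=> disk) (fun=> circle).
Local Notation Z := (set_type ma_complex).
Local Notation moduli z := (fun i => modulus (z i)).

(** A simplex witnessing membership contains every index with modulus below 1; these indices form
    the smallest witness, a simplex because [K] is closed under subsets. *)
Lemma ma_complexE (z : I -> R[i]^o) : ma_complex z <-> admissible K (moduli z).
Proof.
split=> [[s sK zs]|[z1 zK]].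
  split=> [i|].
    rewrite modulus_ge0 /=; have := zs i; case: ifP => _; first by [].
    by rewrite /circle /= => ->.
  apply: (complex_sub dK sK); apply/fintype.subsetP => i; rewrite inE.
  apply: contraTT => nis; have := zs i; rewrite (negbTE nis) /circle /= => ->.
  by rewrite ltxx.
exists [set i | modulus (z i) < 1]%SET => // i; have /andP[_ zi] := z1 i.
rewrite inE; case: ifPn => [_|]; first exact: zi.
by rewrite -leNgt => zi'; apply/eqP; rewrite eq_le zi zi'.
Qed.

Lemma compact_ma_complex : compact ma_complex.
Proof.
pose C (s : {set I}) : set (Cspace R I) :=
  [set z | forall i, (if i \in s then disk else circle) (z i)].
have -> : ma_complex = \big[setU/set0]_(s <- enum K) C s.
  rewrite -bigcup_seq; apply/seteqP; split=> z.
    by move=> [s sK zs]; exists s; rewrite ?inE //= mem_enum.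
  by move=> [s /=]; rewrite mem_enum => sK zs; exists s.
apply: bigsetU_compact => s _.
apply: (@tychonoff I (fun=> R[i]^o) (fun i => if i \in s then disk else circle)) => i.
by case: (i \in s); [exact: compact_disk|exact: compact_circle].
Qed.

Lemma continuous_modulus_eval i : continuous (fun z : Z => modulus (val z i)).
Proof.
move=> z; apply: (@continuous_modulus_at R Z (fun w : Z => val w i) z).
apply: (continuous_comp_at (fun w : Z => val w) (fun w : Cspace R I => w i)).
  exact: val_continuous.
exact: continuous_eval.
Qed.

Lemma continuous_weight s : continuous (fun z : Z => weight (moduli (val z)) s).
Proof.
move=> z.
have ce i := @continuous_modulus_eval i z.
have cmin := @continuous_bigminr R Z _ (index_enum I) (fun i => i \notin s)
  (fun i (w : Z) => modulus (val w i)) 1 z ce.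
have cmax := @continuous_bigmaxr R Z _ (index_enum I) (fun i => i \in s)
  (fun i (w : Z) => modulus (val w i)) 0 z ce.
exact: (@continuous_maxr R Z _ _ z (@continuous_cstr R Z 0 z)
  (@continuous_addr R Z _ _ z cmin (@continuous_oppr R Z _ z cmax))).
Qed.

Lemma continuous_ell_cubical i : continuous (fun z : Z => ell P i (cubical P K (moduli (val z)))).
Proof.
move=> z.
have cs s : {for z, continuous (fun w : Z =>
    weight (moduli (val w)) s * slope P i (bary P K s))}.
  exact: (@continuous_mulr R Z _ _ z (@continuous_weight s z) (@continuous_cstr R Z _ z)).
have csum : {for z, continuous (fun w : Z =>
    \sum_(s in K) weight (moduli (val w)) s * slope P i (bary P K s))}.
  by apply: continuous_sum => s _; exact: cs.
apply: (@eq_continuous_at Z R (fun w : Z => _) _ z _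
  (@continuous_addr R Z _ _ z csum (@continuous_cstr R Z (offset P i) z))) => w.
by rewrite ellE slope_sum; congr (_ + _); apply: eq_bigr => s _; rewrite slopeZ.
Qed.

Lemma phase0 : phase (0 : R[i]) = 0. Proof. exact: mul0r. Qed.

Lemma modulus_phase (z : R[i]) : modulus (phase z) = (z != 0)%:R.
Proof.
case: eqVneq => [->|z0]; first by rewrite phase0 ComplexField.Normc.normc0.
exact: phase_unit.
Qed.

Lemma to_moment_angleE z i : to_moment_angle P K z i =
  (Num.sqrt (ell P i (cubical P K (moduli z))))%:C%C * phase (z i).
Proof. by []. Qed.

Lemma modulus_to_moment_angle z i : ma_complex z ->
  modulus (to_moment_angle P K z i) ^+ 2 = ell P i (cubical P K (moduli z)).
Proof.
move=> /ma_complexE za; rewrite to_moment_angleE ComplexField.Normc.normcM modulus_phase.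
rewrite modulus_real ?sqrtr_ge0 // exprMn sqr_sqrtr; last exact: (cubical_polytope sP dK za).
have [zi0|zi0] := eqVneq (z i) 0; last by rewrite expr1n mulr1.
rewrite expr0n mulr0; apply/esym/eqP.
by rewrite (ell_cubical_eq0 sP dK i za) zi0 ComplexField.Normc.normc0.
Qed.

Lemma to_moment_angle_subproof (z : Z) : moment_angle P (to_moment_angle P K (val z)).
Proof.
have zZ := set_valP z; exists (cubical P K (moduli (val z))).
  by apply: (cubical_polytope sP dK); apply/ma_complexE.
by move=> i; exact: modulus_to_moment_angle.
Qed.

Definition ma_map (z : Z) : set_type (moment_angle P) :=
  SigSub (mem_set (to_moment_angle_subproof z)).

Lemma continuous_ma_map : continuous ma_map.
Proof.
move=> z; apply: continuous_val_at; apply: continuous_prod_at => i.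
have ce := @continuous_ell_cubical i z.
have cs : {for z, continuous (fun w : Z => Num.sqrt (ell P i (cubical P K (moduli (val w)))))}.
  exact: (@continuous_sqrtr R Z _ z ce).
have cz : {for z, continuous (fun w : Z => val w i : R[i]^o)}.
  apply: (continuous_comp_at (fun w : Z => val w) (fun w : Cspace R I => w i)).
    exact: val_continuous.
  exact: continuous_eval.
(* The phase is discontinuous at 0, but there the square root tends to 0 and bounds the modulus. *)
have [zi0|zi0] := eqVneq (val z i) 0.
  apply: (continuous_squeeze _ _ cs) => [w|].
    rewrite /= to_moment_angleE ComplexField.Normc.normcM modulus_phase.
    by rewrite modulus_real ?sqrtr_ge0 // ler_piMr ?sqrtr_ge0 // lern1 leq_b1.
  have za := (ma_complexE _).1 (set_valP z).
  have /eqP -> : ell P i (cubical P K (moduli (val z))) == 0.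
    by rewrite (ell_cubical_eq0 sP dK i za) zi0 ComplexField.Normc.normc0.
  exact: sqrtr0.
apply: (@continuous_mulc R Z (fun w => (Num.sqrt (ell P i (cubical P K (moduli (val w)))))%:C%C)
  (fun w => phase (val w i)) z); first exact: continuous_realc.
apply: (@continuous_mulc R Z (fun w => val w i) (fun w => ((modulus (val w i))%:C%C)^-1) z cz).
have n0 : (modulus (val z i))%:C%C != 0 :> R[i].
  by rewrite (inj_eq (@complexI R)) modulus_eq0.
apply: (@continuousV _ Z (fun w => (modulus (val w i))%:C%C) z n0).
by apply: continuous_realc; exact: continuous_modulus_eval.
Qed.

(** The moduli come from the inverse of [cubical], the phases from [w]. *)
Lemma ma_map_surj w : exists z, ma_map z = w.
Proof.
have [p Pp wp] := set_valP w.
have [y ya yp] := cubical_surj sP dK Pp.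
have [y01 _] := ya.
have y0 i : (y i == 0) = (val w i == 0).
  by rewrite -(ell_cubical_eq0 sP dK i ya) yp -wp expf_eq0 /= modulus_eq0.
pose z i : R[i]^o := (y i)%:C%C * phase (val w i).
have zy : moduli z = y.
  apply/funext => i; rewrite /z ComplexField.Normc.normcM modulus_phase.
  rewrite modulus_real; last by case/andP: (y01 i).
  by rewrite -y0; case: eqVneq => [->|_]; rewrite ?mulr0 ?mulr1.
have zZ : ma_complex z by apply/ma_complexE; rewrite zy.
exists (SigSub (mem_set zZ)); apply: val_inj; apply/funext => i.
rewrite [LHS]to_moment_angleE [val _]/= zy yp -wp sqrtr_sqr ger0_norm ?modulus_ge0 //.
rewrite [RHS](phaseE (val w i)); congr (_ * _).
have [yi0|yi0] := eqVneq (y i) 0.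
  have /eqP wi0 : val w i == 0 by rewrite -y0 yi0.
  by rewrite /z wi0 phase0 mulr0 phase0.
have wi0 : val w i != 0 by rewrite -y0.
rewrite /z mulrC phaseM ?phase_unit // phase_pos ?mulr1 //.
by rewrite lt_neqAle eq_sym yi0; case/andP: (y01 i).
Qed.

Lemma to_moment_angleM (t z : I -> R[i]^o) : torus t ->
  to_moment_angle P K (fun i => t i * z i) = (fun i => t i * to_moment_angle P K z i).
Proof.
move=> t1; apply/funext => i; rewrite !to_moment_angleE phaseM // mulrCA.
congr (_ * (_ * _)); congr (_%:C%C); congr (Num.sqrt (ell P i (cubical P K _))).
by apply/funext => k; rewrite ComplexField.Normc.normcM t1 mul1r.
Qed.

(** Equal moduli in the moment-angle manifold give the same point of the polytope, hence by
    [cubical_inj] the same moduli in the polydisc; phases are compared where the coordinate is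
    nonzero. *)
Lemma to_moment_angle_inj (t z z' : I -> R[i]^o) : torus t -> ma_complex z -> ma_complex z' ->
  to_moment_angle P K z' = (fun i => t i * to_moment_angle P K z i) ->
  z' = (fun i => t i * z i).
Proof.
move=> t1 zZ zZ' E.
have cE : cubical P K (moduli z) = cubical P K (moduli z').
  apply: (ell_inj sP) => i; rewrite -!modulus_to_moment_angle // E.
  by congr (_ ^+ 2); rewrite [RHS]ComplexField.Normc.normcM t1 mul1r.
have mE i : modulus (z i) = modulus (z' i).
  by apply: (cubical_inj sP dK _ _ cE); apply/ma_complexE.
apply/funext => i; have /(congr1 (fun f : I -> R[i]^o => f i)) := E.
rewrite !to_moment_angleE -cE [t i * _]mulrCA.
have [z0|z0] := eqVneq (z i) 0.
  move=> _; rewrite z0 mulr0; apply/eqP; rewrite -modulus_eq0 -mE z0.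
  by rewrite ComplexField.Normc.normc0.
have e0 : (Num.sqrt (ell P i (cubical P K (moduli z))))%:C%C != 0 :> R[i].
  rewrite (inj_eq (@complexI R)) sqrtr_eq0 -ltNge lt_neqAle eq_sym.
  have za := (ma_complexE _).1 zZ.
  rewrite (ell_cubical_eq0 sP dK i za) modulus_eq0 z0 /=.
  exact: (cubical_polytope sP dK za).
move=> /(mulfI e0) h; rewrite (phaseE (z' i)) (phaseE (z i)) h -mE.
by rewrite mulrCA.
Qed.

End MomentAngleComplex.

Lemma prod_two_terms (F : fieldType) (I : finType) (a b : I) (f : I -> F) :
  a != b -> (forall i, i != a -> i != b -> f i = 1) -> \prod_i f i = f a * f b.
Proof.
move=> ab f1; rewrite (bigD1 a) //= (bigD1 b) /=; last by rewrite eq_sym.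
by rewrite [X in _ * (_ * X)]big1 ?mulr1 // => i /andP[]; exact: f1.
Qed.

(** * Balls and spheres modulo the kernel *)

Section ZDSQuotient.
Context {R : realType} {n m N : nat}.
Variables (P : halfspaces R n 'I_m) (K : {set {set 'I_m}}).
Variables (lambda : 'M[int]_(n, m)) (J : 'I_m -> nat).
Local Notation VJ := {i : 'I_m & 'I_(J i)}.
Variable PJ : halfspaces R N VJ.
Hypotheses (sP : simple_polytope P) (dK : dual_complex P K)
  (J0 : forall i, (0 < J i)%N)
  (sPJ : simple_polytope PJ) (dKJ : dual_complex PJ (KJ J K)).
Local Notation Z := (set_type (@ma_complex R VJ (KJ J K))).
Local Notation ZD := (set_type (@ZDS R m K J)).
Local Notation lJ := (lambdaJ (J := J) lambda).
Local Notation vtx i t := (Tagged (fun i => 'I_(J i)) (t : 'I_(J i)) : VJ).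

(** A nonface inside [s] of least cardinality would be a minimal nonface. *)
Lemma complex_no_minimal_nonface (s : {set 'I_m}) :
  (forall r : {set 'I_m}, minimal_nonface K r -> ~~ (r \subset s)) -> s \in K.
Proof.
move=> h; apply/negPn/negP => sK.
have Q0 : (s \notin K) && (s \subset s) by rewrite sK fintype.subxx.
have [r /andP[rK rs] rmin] := @arg_minnP _ s (fun r => (r \notin K) && (r \subset s))
  (fun r => #|r|) Q0.
apply: (negP (h r _)) => //; apply/andP; split=> //; apply/forallP => q; apply/implyP => qr.
apply/negPn/negP => qK; have := rmin q; rewrite qK /= => /(_ _) /=.
have qs : q \subset s by apply: fintype.subset_trans rs; exact: proper_sub.
by move=> /(_ qs); rewrite leqNgt proper_card.
Qed.

Lemma full_blocks_complex (s : {set VJ}) : s \in KJ J K ->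
  [set i | [forall t : 'I_(J i), vtx i t \in s]]%SET \in K.
Proof.
rewrite inE => /forallP h; apply: complex_no_minimal_nonface => r mr.
have := h r; rewrite mr /=; apply: contra => /fintype.subsetP rs.
apply/fintype.subsetP => -[i t]; rewrite inE /= => /rs; rewrite inE => /forallP.
exact.
Qed.

(** A block that [s] does not contain has a coordinate on the circle; its max norm is then 1, and
    [radial] sends it to the sphere. *)
Lemma ZDS_radials (z : Z) : @ZDS R m K J (radials (val z)).
Proof.
have [s sK zs] := set_valP z.
exists [set i | [forall t : 'I_(J i), vtx i t \in s]]%SET.
  exact: full_blocks_complex.
have z1 v : modulus (val z v) <= 1.
  have := zs v; case: ifP => _; first by [].
  by rewrite /circle /= => ->.
have max1 i : maxnorm (fun t => val z (vtx i t)) <= 1 by apply: bigmax_le.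
move=> i; rewrite inE; case: ifPn => [_|].
  by rewrite /ball2 /= /radials l2norm_radial.
rewrite negb_forall => /existsP[t ts].
rewrite /sphere2 /= /radials l2norm_radial; apply/eqP; rewrite eq_le max1 /=.
have := zs (vtx i t); rewrite (negbTE ts) /circle /= => <-.
exact: (maxnorm_ge (fun t => val z (vtx i t))).
Qed.

Definition ZDS_map (z : Z) : ZD := SigSub (mem_set (ZDS_radials z)).

Lemma continuous_ZDS_map : continuous ZDS_map.
Proof.
move=> z; apply: continuous_val_at; apply: continuous_prod_at => i.
apply: continuous_prod_at => t.
apply: (@continuous_radial R Z (J i) (fun w t => val w (vtx i t)) z t) => t'.
apply: (continuous_comp_at (fun w : Z => val w) (fun w : Cspace R VJ => w (vtx i t'))).
  exact: val_continuous.
exact: continuous_eval.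
Qed.

Lemma hausdorff_ZDS : hausdorff_space ZD.
Proof.
apply: hausdorff_set_type; apply: hausdorff_product => i; exact: hausdorff_Cspace.
Qed.

Lemma ZDS_map_surj x : exists z, ZDS_map z = x.
Proof.
have [r rK xr] := set_valP x.
have x1 i : l2norm (val x i) <= 1.
  have := xr i; case: ifP => _; first by [].
  by rewrite /sphere2 /= => ->.
pose z (v : VJ) : R[i]^o := unradial (val x (tag v)) (tagged v).
have zE i : (fun t => z (vtx i t)) = unradial (val x i) by [].
have zZ : ma_complex (KJ J K) z.
  apply/(ma_complexE dKJ); split=> [v|].
    rewrite modulus_ge0 /=; case: v => i t; rewrite (le_trans _ (x1 i)) //.
    by rewrite -maxnorm_unradial; exact: maxnorm_ge.
  rewrite inE; apply/forallP => r'; apply/implyP => mr'; apply/negP => /fintype.subsetP h.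
  case/andP: mr' => /negP r'K _; apply: r'K; apply: (complex_sub dK rK).
  (* If [i] were outside [r], block [i] would lie on the sphere, yet all its coordinates before
     rescaling have modulus below 1. *)
  apply/fintype.subsetP => i ir'; apply/negPn/negP => ir.
  have := xr i; rewrite (negbTE ir) /sphere2 /=.
  rewrite -maxnorm_unradial => m1; have : (1 : R) < 1; last by rewrite ltxx.
  rewrite -{1}m1; apply: bigmax_lt => // t _.
  have := h (vtx i t); rewrite !inE /=; exact.
exists (SigSub (mem_set zZ)); apply: val_inj.
by apply: functional_extensionality_dep => i; rewrite /= /radials zE unradialK.
Qed.

Lemma radials_equivariant (t : 'I_m -> R[i]^o) (z z' : VJ -> R[i]^o) : torus t ->
  (forall i s, @radials m J R z' i s = t i * @radials m J R z i s) <->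
  z' = (fun v => block_diag (J := J) t v * z v).
Proof.
move=> t1; split=> [h|-> i s]; last first.
  exact: (congr1 (fun f => f s) (radial_equivariant (fun s => z (vtx i s)) (t1 i))).
apply/funext => -[i s]; have : @radials m J R z' i = radial (fun s => t i * z (vtx i s)).
  by rewrite radial_equivariant //; apply/funext => s'; exact: h.
by move=> /(can_inj radialK) /(congr1 (fun f => f s)).
Qed.

(** The row numbered [s] of block [i] equates the entries [s + 1] and 0 of the block, so [t] is
    constant on blocks. This matches [ZDS_sim], which ranges over block-diagonal elements only. *)
Lemma ker_lambdaJ (t : VJ -> R[i]^o) : ker_torus lJ t ->
  exists2 u : 'I_m -> R[i]^o, torus u & t = block_diag (J := J) u.
Proof.
move=> [t1 kt]; pose v0 i := vtx i (Ordinal (J0 i)).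
exists (fun i => t (v0 i)); first by move=> i; exact: t1.
apply/funext => -[i [s hs]]; rewrite /block_diag /=; case: s hs => [|s] hs.
  by congr (t (vtx i _)); exact: val_inj.
have hs' : (s < (J i).-1)%N by rewrite -ltnS prednK.
have v0n : vtx i (Ordinal hs) != v0 i.
  by apply/eqP => /eqP; rewrite -tag_eqE /tag_eq /= eqxx tagged_asE.
have := kt (inl (existT (fun i => 'I_(J i).-1) i (Ordinal hs'))).
rewrite (@prod_two_terms R[i] _ (vtx i (Ordinal hs)) (v0 i)
  (fun v => t v ^ lJ (inl (existT (fun i => 'I_(J i).-1) i (Ordinal hs'))) v) v0n).
  rewrite /lambdaJ /= !eqxx /= expr1z exprN1.
  move=> /(congr1 (fun x => x * t (v0 i))).
  by rewrite mulfVK ?mul1r //; exact: modulus_neq0.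
move=> [k s'] h1 h2; rewrite /lambdaJ /=.
case: ifPn => [_|]; first by rewrite expr0z.
rewrite negbK => /eqP ki; subst k.
case: ifPn => [/eqP s1|_].
  by case/eqP: h1; congr (vtx i _); exact: val_inj.
case: ifPn => [/eqP s0|_]; last by rewrite expr0z.
by case/eqP: h2; congr (vtx i _); exact: val_inj.
Qed.

Lemma ZDS_classP (x y : ZD) : ZDS_class K lambda J x = ZDS_class K lambda J y <->
  exists t : 'I_m -> R[i]^o, ker_torus lJ (block_diag (J := J) t) /\
    torus t /\ forall i s, val y i s = t i * val x i s.
Proof.
rewrite /ZDS_class; split=> [/eqmodP /asboolP //|h].
by apply/eqmodP/asboolP.
Qed.

Local Notation maJ := (ma_map sPJ dKJ).

Lemma ZDS_ma_equiv (z z' : Z) :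
  ZDS_class K lambda J (ZDS_map z) = ZDS_class K lambda J (ZDS_map z') <->
  ma_class PJ lJ (maJ z) = ma_class PJ lJ (maJ z').
Proof.
rewrite ZDS_classP ma_classP; split.
  move=> [t [kt [t1 E]]]; exists (block_diag (J := J) t) => //.
  have tt1 : torus (block_diag (J := J) t) by move=> v; exact: t1.
  rewrite -(to_moment_angleM PJ (KJ J K) (val z) tt1); congr (to_moment_angle _ _ _).
  exact/radials_equivariant.
move=> [t kt E]; have [u u1 tu] := ker_lambdaJ kt; subst t.
exists u; split=> //; split=> //.
apply/radials_equivariant => //.
apply: (to_moment_angle_inj sPJ dKJ _ (set_valP z) (set_valP z') E).
by move=> v; exact: u1.
Qed.

Lemma ZDS_ma_homeo : exists (G : ZDS_quotient R K lambda J -> ma_quotient PJ lJ)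
    (Gi : ma_quotient PJ lJ -> ZDS_quotient R K lambda J),
  [/\ continuous G, continuous Gi, cancel G Gi, cancel Gi G &
    forall z, G (ZDS_class K lambda J (ZDS_map z)) = ma_class PJ lJ (maJ z)].
Proof.
have cZ : compact [set: Z] by apply: compact_set_type; exact: compact_ma_complex.
have q1 : quotient_map (ZDS_class K lambda J \o ZDS_map).
  apply: quotient_map_comp; last exact: quotient_map_pi.
  apply: (compact_quotient_map cZ).
  - exact: hausdorff_ZDS.
  - exact: continuous_ZDS_map.
  - exact: ZDS_map_surj.
have q2 : quotient_map (ma_class PJ lJ \o maJ).
  apply: quotient_map_comp; last exact: quotient_map_pi.
  apply: (compact_quotient_map cZ).
  - exact: hausdorff_moment_angle.
  - exact: continuous_ma_map.
  - exact: ma_map_surj.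
have [z z'|G [Gi [cG cGi GK GiK GE]]] := quotient_map_homeo q1 q2.
  exact: ZDS_ma_equiv.
by exists G, Gi.
Qed.

Section Charts.
Variable G : ZDS_quotient R K lambda J -> ma_quotient PJ lJ.
Hypothesis GE : forall z, G (ZDS_class K lambda J (ZDS_map z)) = ma_class PJ lJ (maJ z).

Lemma ZDS_class_surj q : exists z, ZDS_class K lambda J (ZDS_map z) = q.
Proof.
have [z zE] := ZDS_map_surj (repr q); exists z.
by rewrite zE /ZDS_class reprK.
Qed.

Lemma ZDS_atlas_pulled_back c : ZDS_atlas K lambda PJ c ->
  exists2 c0, ma_quotient_atlas PJ lJ c0 & pulled_back G c c0.
Proof.
move=> [c0 hc0 h]; exists c0 => //.
have H z := h (val z) (ZDS_map z) (maJ z) (set_valP z) erefl erefl.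
split=> q; have [z <-] := ZDS_class_surj q; rewrite GE; first by case: (H z).
by case: (H z).
Qed.

Lemma ZDS_atlas_cover : smooth_atlas (ma_quotient_atlas PJ lJ) ->
  forall q, exists2 c, ZDS_atlas K lambda PJ c & c.1 q.
Proof.
move=> [_ cov _] q; have [c0 hc0 c0q] := cov (G q).
exists (G @^-1` c0.1, c0.2 \o G) => //; exists c0 => // z x w zZ xE wE.
pose z' : Z := SigSub (mem_set zZ).
have -> : x = ZDS_map z' by apply: val_inj.
have -> : w = maJ z' by apply: val_inj.
by rewrite -GE.
Qed.

End Charts.
End ZDSQuotient.

(** * Unimodularity of lambda(J) *)

(** An independent family of full rank has nonzero determinant, and the adjugate puts [\det A *: w]
    in the span for every [w]. For [w] in the complement [N] this vector lies in both, so it is zero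
    and [w = 0]: the complement is trivial. *)
Lemma summand_full_rank (n m : nat) (lambda : 'M[int]_(n, m)) (s : {set 'I_m}) :
  #|s| = n -> columns_independent lambda s -> direct_summand (column_span lambda s) ->
  forall u, column_span lambda s u.
Proof.
move=> sn ind [N [N0 NB LN dec]] u.
pose g (k : 'I_n) : 'I_m := enum_val (cast_ord (esym sn) k).
have g_inj : injective g by move=> k l /enum_val_inj /cast_ord_inj.
have gs k : g k \in s by exact: enum_valP.
have sg : s = [set g k | k : 'I_n]%SET.
  apply/esym/eqP; rewrite eqEcard card_imset // card_ord sn leqnn andbT.
  by apply/fintype.subsetP => i /imsetP[k _ ->].
have sumE (c : 'I_m -> int) : \sum_(i in s) c i *: col i lambda = \sum_k c (g k) *: col (g k) lambda.
  transitivity (\sum_(i in [set g k | k : 'I_n]%SET) c i *: col i lambda).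
    by apply: eq_bigl => i; rewrite -sg.
  by rewrite big_imset //= => k l _ _; exact: g_inj.
pose A : 'M[int]_n := \matrix_(i, k) lambda i (g k).
have AL (v : 'cV[int]_n) : column_span lambda s (A *m v).
  pose c (i : 'I_m) : int := if [pick k | g k == i] is Some k then v k 0 else 0.
  exists c; rewrite sumE; apply/colP => i; rewrite !mxE summxE; apply: eq_bigr => k _.
  rewrite !mxE /c; case: pickP => [l /eqP /g_inj ->|/(_ k)]; first by rewrite mulrC.
  by rewrite eqxx.
have dA : \det A != 0.
  rewrite -det_tr; apply/det0P => -[v v0 vA]; case/eqP: v0; apply/rowP => k.
  pose c (i : 'I_m) : int := if [pick k | g k == i] is Some k then v 0 k else 0.
  have cg l : c (g l) = v 0 l.
    by rewrite /c; case: pickP => [l' /eqP /g_inj ->|/(_ l)] //; rewrite eqxx.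
  rewrite mxE -cg; apply: (ind c _ _ (gs k)); rewrite sumE; apply/colP => i.
  have := congr1 (fun M : 'rV[int]_n => M 0 i) vA; rewrite !mxE => <-.
  by rewrite summxE; apply: eq_bigr => l _; rewrite !mxE cg.
have NN w : N w -> N (- w) by move=> Nw; rewrite -sub0r; exact: NB.
have ND w w' : N w -> N w' -> N (w + w').
  by move=> Nw Nw'; rewrite -[w']opprK; apply: NB => //; exact: NN.
have Nn w k : N w -> N (w *+ k).
  by move=> Nw; elim: k => [|k IH]; rewrite ?mulr0n // mulrS; exact: ND.
have NZ w (a : int) : N w -> N (a *: w).
  move=> Nw; rewrite -[a]intz scaler_int; case: a => k; first exact: Nn.
  by rewrite NegzE mulrNz; apply: NN; exact: Nn.
have [v [w [Lv Nw ->]]] := dec u.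
suff -> : w = 0 by rewrite addr0.
have /LN /eqP : (column_span lambda s `&` N) (\det A *: w).
  split; last exact: NZ.
  by rewrite -mul_scalar_mx -mul_mx_adj -mulmxA; exact: AL.
move=> /eqP dw; apply/colP => i; have := congr1 (fun M : 'cV[int]_n => M i 0) dw.
by rewrite !mxE => /eqP; rewrite mulf_eq0 (negbTE dA) => /eqP.
Qed.

Section LambdaJ.
Context {R : realType} {n m : nat}.
Variables (P : halfspaces R n 'I_m) (K : {set {set 'I_m}}).
Variables (lambda : 'M[int]_(n, m)) (J : 'I_m -> nat).
Local Notation VJ := {i : 'I_m & 'I_(J i)}.
Local Notation DJ := ({i : 'I_m & 'I_(J i).-1} + 'I_n)%type.
Local Notation N := (\sum_(i < m) J i - m + n)%N.
Variable PJ : halfspaces R N VJ.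
Hypotheses (sP : simple_polytope P) (dK : dual_complex P K)
  (hl : characteristic P lambda) (J0 : forall i, (0 < J i)%N)
  (sPJ : simple_polytope PJ) (dKJ : dual_complex PJ (KJ J K)).
Local Notation lJ := (lambdaJ (J := J) lambda).
Local Notation vtx i t := (Tagged (fun i => 'I_(J i)) (t : 'I_(J i)) : VJ).

(** The face of a maximal simplex is one vertex, of dimension 0, so [characteristic] applies with
    codimension [n]. *)
Lemma maximal_simplex_span (r : {set 'I_m}) : r \in K -> #|r| = n ->
  forall u, column_span lambda r u.
Proof.
move=> rK rn; have [ind sm] : columns_independent lambda r /\ direct_summand (column_span lambda r).
  apply: hl; exists 0%N => //.
  have [x [vx fx fE]] := maximal_face sP ((dK r).1 rK) rn.
  split=> [|y hy].
    exists (fun=> x); first by move=> _; rewrite fE.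
    by rewrite /affinely_independent /row_free [\matrix__ _]flatmx0 mxrank0.
  have yx k : y k = x by have := hy k; rewrite fE.
  rewrite /affinely_independent /row_free (_ : \matrix__ _ = 0) ?mxrank0 //.
  by apply/matrixP => k l; rewrite !mxE !yx subrr.
exact: summand_full_rank.
Qed.

Lemma card_VJ : #|{: VJ}| = (\sum_(i < m) J i)%N.
Proof.
rewrite card_tagged sumnE big_map big_enum /=.
by apply: eq_bigr => i _; rewrite card_ord.
Qed.

Lemma le_sumJ : (m <= \sum_(i < m) J i)%N.
Proof. by rewrite -[leqLHS]card_ord -sum1_card; apply: leq_sum => i _; exact: J0. Qed.

Lemma card_DJ : #|{: DJ}| = N.
Proof.
rewrite card_sum card_ord card_tagged sumnE big_map big_enum /=; congr (_ + _)%N.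
have -> : (\sum_(i < m) J i = \sum_(i < m) (J i).-1 + m)%N.
  rewrite -[X in (_ + X)%N]card_ord -sum1_card -big_split /=; apply: eq_bigr => i _.
  by rewrite addn1 prednK.
by rewrite addnK; apply: eq_bigr => i _; rewrite card_ord.
Qed.

Definition full_blocks (s : {set VJ}) : {set 'I_m} :=
  [set i | [forall t : 'I_(J i), vtx i t \in s]]%SET.

(* Each of the [m - #|r|] blocks that are not full misses a vertex, but only
   [m - n] vertices are missing altogether, where [#|r| <= n]. *)
Lemma maximal_simplex_blocks (s : {set VJ}) : s \in KJ J K -> #|s| = N ->
  [/\ full_blocks s \in K, #|full_blocks s| = n &
    forall i (t t' : 'I_(J i)), vtx i t \notin s -> vtx i t' \notin s -> t = t'].
Proof.
move=> sK sN; set r := full_blocks s.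
have rK : r \in K by exact: full_blocks_complex.
have rn : (#|r| <= n)%N by apply: (face_card sP); exact/dK.
have missing i : exists t : 'I_(J i), i \notin r -> vtx i t \notin s.
  have [ir|] := boolP (i \in r); first by exists (Ordinal (J0 i)).
  by rewrite inE negb_forall => /existsP[t ts]; exists t.
(* A vertex missing from [s] in each block that is not full, an arbitrary vertex in a full block. *)
pose mu i := vtx i (sval (cid (missing i))).
have muP i : i \notin r -> mu i \notin s by rewrite /mu; case: cid.
have mu_inj : injective mu by move=> i i' /(congr1 (@tag _ _)).
have sub : [set mu i | i in ~: r]%SET \subset ~: s.
  apply/fintype.subsetP => v vE; have [i ir ->] := imsetP vE.
  by rewrite inE; apply: muP; move: ir; rewrite inE.
have c1 : (#|r| + #|~: r| = m)%N by rewrite cardsC card_ord.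
have c2 : (#|s| + #|~: s| = \sum_(i < m) J i)%N by rewrite cardsC card_VJ.
have c3 : (#|~: r| <= #|~: s|)%N.
  by rewrite -(card_imset _ mu_inj); exact: subset_leq_card.
(* This makes the truncated subtraction in [N] a true one in the counts below. *)
have lm := le_sumJ.
have c4 : (#|~: s| + n = m)%N by move: c2; rewrite sN; lia.
have rn' : #|r| = n by lia.
have c5 : #|~: r| = #|~: s| by lia.
have muE : [set mu i | i in ~: r]%SET = ~: s.
  by apply/eqP; rewrite eqEcard sub card_imset // c5 leqnn.
split=> // i t t' ts ts'.
have h (t0 : 'I_(J i)) : vtx i t0 \notin s -> vtx i t0 = mu i.
  move=> t0s; have : vtx i t0 \in ~: s by rewrite inE.
  rewrite -muE => vE; have [i' _ e] := imsetP vE; rewrite e; congr mu.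
  exact: esym (congr1 (@tag _ _) e).
have : vtx i t = vtx i t' by rewrite h // (h t').
by move=> /eqP; rewrite -tag_eqE /tag_eq /= eqxx tagged_asE => /eqP.
Qed.

Section Span.
Variable s : {set VJ}.

Definition in_span (f : DJ -> int) : Prop :=
  exists c : VJ -> int, forall d, f d = \sum_(v in s) c v * lJ d v.

Lemma in_span_ext f g : (forall d, f d = g d) -> in_span f -> in_span g.
Proof. by move=> fg [c fc]; exists c => d; rewrite -fg. Qed.

Lemma in_span_col v : v \in s -> in_span (fun d => lJ d v).
Proof.
move=> vs; exists (fun w => (w == v)%:R) => d.
rewrite (bigD1 v) //= eqxx mul1r big1 ?addr0 // => w /andP[_ /negbTE ->].
by rewrite mul0r.
Qed.

Lemma in_spanD f g : in_span f -> in_span g -> in_span (fun d => f d + g d).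
Proof.
move=> [a fa] [b gb]; exists (fun v => a v + b v) => d.
by rewrite fa gb -big_split /=; apply: eq_bigr => v _; rewrite mulrDl.
Qed.

Lemma in_spanZ (c : int) f : in_span f -> in_span (fun d => c * f d).
Proof.
move=> [a fa]; exists (fun v => c * a v) => d.
by rewrite fa mulr_sumr; apply: eq_bigr => v _; rewrite mulrA.
Qed.

Lemma in_spanN f : in_span f -> in_span (fun d => - f d).
Proof. by move=> /(in_spanZ (-1)); apply: in_span_ext => d; rewrite mulN1r. Qed.

Lemma in_span_sum (T : Type) (q : seq T) (Q : pred T) (F : T -> DJ -> int) :
  (forall i, Q i -> in_span (F i)) -> in_span (fun d => \sum_(i <- q | Q i) F i d).
Proof.
move=> h; elim: q => [|i q IH].
  by exists (fun=> 0) => d; rewrite big_nil big1 // => v _; rewrite mul0r.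
case Qi : (Q i).
  by apply: in_span_ext (in_spanD (h i Qi) IH) => d; rewrite big_cons Qi.
by apply: in_span_ext IH => d; rewrite big_cons Qi.
Qed.

Hypotheses (sK : s \in KJ J K) (sN : #|s| = N).

Definition unit_vec (d0 d : DJ) : int := (d == d0)%:R.

Definition lambda_col (i : 'I_m) (d : DJ) : int :=
  if d is inr k then lambda k i else 0.

Lemma lambdaJ_pos i (t' : 'I_(J i).-1) (t : 'I_(J i)) d : t = t'.+1 :> nat ->
  lJ d (vtx i t) = unit_vec (inl (existT (fun i => 'I_(J i).-1) i t')) d.
Proof.
move=> tt'; rewrite /unit_vec /lambdaJ; case: d => [[k t2]|k] /=; last by rewrite tt'.
case: eqVneq => [ik|ik] /=.
  subst k; rewrite tt' eqSS /=.
  rewrite -[inl _ == inl _]/(existT (fun i => 'I_(J i).-1) i t2 == existT _ i t').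
  rewrite -tag_eqE /tag_eq /= eqxx tagged_asE /= eq_sym.
  by rewrite (_ : (t2 == t' :> nat) = (t2 == t')) //; case: (t2 == t').
rewrite -[inl _ == inl _]/(existT (fun i => 'I_(J i).-1) k t2 == existT _ i t').
by rewrite -tag_eqE /tag_eq /= eq_sym (negbTE ik).
Qed.

Lemma lambdaJ_0 i (t : 'I_(J i)) d : t = 0%N :> nat ->
  lJ d (vtx i t) = lambda_col i d -
    \sum_(t' < (J i).-1) unit_vec (inl (existT (fun i => 'I_(J i).-1) i t')) d.
Proof.
move=> t0; rewrite /unit_vec /lambdaJ /lambda_col; case: d => [[k t2]|k] /=; last first.
  by rewrite t0 /= big1 ?subr0.
have [ik|ik] := eqVneq i k.
  subst k; rewrite t0 /= sub0r (bigD1 t2) //= eqxx big1 ?addr0 // => t3 t32.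
  rewrite -[inl _ == inl _]/(existT (fun i => 'I_(J i).-1) i t2 == existT _ i t3).
  by rewrite -tag_eqE /tag_eq /= eqxx tagged_asE eq_sym (negbTE t32).
rewrite big1 ?subr0 // => t3 _.
rewrite -[inl _ == inl _]/(existT (fun i => 'I_(J i).-1) k t2 == existT _ i t3).
by rewrite -tag_eqE /tag_eq /= eq_sym (negbTE ik).
Qed.

(** Full blocks give their own unit vectors, and then the columns of [lambda] over [r]. These span
    Z^n, which yields the bottom unit vectors and so all columns of [lambda]. A block that is not
    full misses one vertex: if it is the first, all its unit vectors are columns already; otherwise
    the column of the first vertex supplies the remaining one. *)
Lemma unit_vec_span d0 : in_span (unit_vec d0).
Proof.
have [rK rn missing] := maximal_simplex_blocks sK sN.
set r := full_blocks s in rK rn.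
pose u i t' := unit_vec (inl (existT (fun i => 'I_(J i).-1) i t')).
have succ_lt i (t' : 'I_(J i).-1) : (t'.+1 < J i)%N by rewrite -[ltnRHS]prednK // ltnS.
pose S i (t' : 'I_(J i).-1) : 'I_(J i) := Ordinal (succ_lt i t').
have u_pos i (t' : 'I_(J i).-1) : vtx i (S i t') \in s -> in_span (u i t').
  move=> /in_span_col; apply: in_span_ext => d.
  by rewrite (@lambdaJ_pos i t').
pose z i : 'I_(J i) := Ordinal (J0 i).
have full i (t : 'I_(J i)) : i \in r -> vtx i t \in s by rewrite inE => /forallP.
have lam_full i : i \in r -> in_span (lambda_col i).
  move=> ir; have h := in_spanD (in_span_col (full i (z i) ir))
    (in_span_sum (index_enum _) (Q := xpredT) (fun t' _ => u_pos i t' (full _ _ ir))).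
  by apply: in_span_ext h => d; rewrite lambdaJ_0 // subrK.
have bottom k : in_span (unit_vec (inr k)).
  have [c cE] := maximal_simplex_span rK rn (delta_mx k 0).
  have := in_span_sum (index_enum _) (Q := fun i => i \in r)
    (fun i ir => in_spanZ (c i) (lam_full i ir)).
  apply: in_span_ext => -[d|l]; first by rewrite /= big1 // => i _; rewrite mulr0.
  have /colP /(_ l) := cE; rewrite !mxE summxE andbT /unit_vec.
  rewrite -[inr l == inr k]/(l == k) => ->.
  by apply: eq_bigr => i _; rewrite !mxE.
have lam i : in_span (lambda_col i).
  have := in_span_sum (index_enum 'I_n) (Q := xpredT)
    (fun k _ => in_spanZ (lambda k i) (bottom k)).
  apply: in_span_ext => -[d|l] /=; first by rewrite big1 // => k _; rewrite mulr0.
  rewrite (bigD1 l) //= /unit_vec eqxx mulr1 big1 ?addr0 // => k kl.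
  by rewrite -[inr l == inr k]/(l == k) eq_sym (negbTE kl) mulr0.
case: d0 => [[i t']|k]; last exact: bottom.
have [St|St] := boolP (vtx i (S i t') \in s); first exact: u_pos.
(* [S i t'] is the only vertex missing from its block, so the column of the first vertex is
   available; it contains the wanted unit vector with coefficient -1, next to vectors already in the
   span. *)
have in_s (t : 'I_(J i)) : t != S i t' -> vtx i t \in s.
  by apply: contraNT => ts; apply/eqP; exact: missing ts St.
have z_s : vtx i (z i) \in s by apply: in_s; apply/eqP => /(congr1 val).
have others t2 : t2 != t' -> in_span (u i t2).
  move=> t2t'; apply: u_pos; apply: in_s; apply: contra t2t' => /eqP /(congr1 val) [e].
  exact/eqP/val_inj.
have := in_spanD (lam i) (in_spanN (in_spanD (in_span_col z_s)
  (in_span_sum (index_enum _) (Q := fun t2 => t2 != t') others))).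
apply: in_span_ext => d; rewrite lambdaJ_0 // (bigD1 t') //= /u.
by rewrite opprD opprB addrA addrC; ring.
Qed.

End Span.

(** There are as many rows as facets at a vertex, so the matrix is square; spanning gives a right
    inverse, which over a commutative ring is two-sided. *)
Lemma lambdaJ_unimodular : unimodular PJ lJ.
Proof.
move=> x e vx e_inj fx.
set s := facets_at PJ x in fx.
have sK : s \in KJ J K.
  by apply: (facets_at_complex dKJ); case: vx.
have sN : #|s| = N by case: sPJ => _ _ _ _ /(_ _ vx).
have [c cE] := choice (unit_vec_span sK sN).
pose h (k : 'I_N) : DJ := enum_val (cast_ord (esym card_DJ) k).
have h_bij : bijective h.
  exists (fun d => cast_ord card_DJ (enum_rank d)) => [k|d].
    by rewrite /h enum_valK cast_ordKV.
  by rewrite /h cast_ordK enum_rankK.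
have sumE (F : VJ -> int) : \sum_(v in s) F v = \sum_k F (e k).
  by rewrite fx big_imset //= => k l _ _; exact: e_inj.
pose A : 'M[int]_N := \matrix_(i, k) lJ (h i) (e k).
pose B : 'M[int]_N := \matrix_(k, i) c (h i) (e k).
have AB : A *m B = 1%:M.
  apply/matrixP => i i'; rewrite !mxE.
  have := cE (h i') (h i); rewrite /unit_vec (bij_eq h_bij) sumE => ->.
  by apply: eq_bigr => k _; rewrite !mxE mulrC.
exists (fun k d => c d (e k)); split=> [k l|d d'].
  have /matrixP /(_ k l) := mulmx1C AB; rewrite !mxE => <-.
  rewrite (reindex h) /=; last exact: onW_bij.
  by apply: eq_bigr => i _; rewrite !mxE.
have := cE d' d; rewrite /unit_vec sumE => ->.
by apply: eq_bigr => k _; rewrite mulrC.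
Qed.

End LambdaJ.

Theorem theorem9p2 (R : realType) (n m : nat)
    (P : halfspaces R n 'I_m) (K : {set {set 'I_m}})
    (lambda : 'M[int]_(n, m)) (J : 'I_m -> nat)
    (PJ : halfspaces R (\sum_(i < m) J i - m + n)%N {i : 'I_m & 'I_(J i)}) :
  simple_polytope P ->
  dual_complex P K ->
  characteristic P lambda ->
  (forall i, (0 < J i)%N) ->
  simple_polytope PJ ->
  dual_complex PJ (KJ J K) ->
  exists f : toric PJ (lambdaJ lambda) -> ZDS_quotient R K lambda J,
    diffeomorphism (toric_atlas PJ (lambdaJ lambda)) (ZDS_atlas K lambda PJ) f.
Proof.
move=> sP dK hl J0 sPJ dKJ.
have uni := lambdaJ_unimodular sP dK hl J0 sPJ dKJ.
have [F [Fi [cF cFi FK FiK FE]]] := toric_ma_homeo sPJ uni.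
have [G [Gi [cG cGi GK GiK GE]]] := ZDS_ma_homeo lambda dK J0 sPJ dKJ.
have sB := ma_quotient_smooth_atlas sPJ uni.
have AB := toric_atlas_pulled_back sPJ uni FE.
have AB' := ZDS_atlas_pulled_back dK GE.
have [_ _ sm] := sB.
(* In the pulled-back charts this map and its inverse [Fi \o G] both read as the identity of the
   moment-angle quotient. *)
exists (Gi \o F); split.
- exact: (pulled_back_atlas cF cFi FK FiK AB (toric_atlas_cover sPJ uni FE) sB).
- exact: (pulled_back_atlas cG cGi GK GiK AB' (ZDS_atlas_cover GE sB) sB).
exists (Fi \o G); split.
  split.
  - by move=> x; rewrite /= GiK FK.
  - by move=> y; rewrite /= FiK GK.
  - by move=> x; apply: continuous_comp; [exact: cF|exact: cGi].
  - by move=> y; apply: continuous_comp; [exact: cG|exact: cFi].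
split; [apply: (smooth_map_transport _ AB AB' sm)|apply: (smooth_map_transport _ AB' AB sm)].
  by move=> x; rewrite /= GiK.
by move=> y; rewrite /= FiK.
Qed.
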